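(* In the finite-window setting of the context, let the seven error entries be instantiated as in the context, with concrete budget $\mathcal B^{\mathrm{conc}}_\Lambda$. Assume the following. (1) Quotient lifting: there are $0\le\varepsilon_G<1$ and $\delta_G\ge0$ such that for every $\mathfrak D\in\mathcal U^{\mathrm{loc}}_\Lambda$ and $b\in\mathcal C^{\mathrm{cl}}_\Lambda$ there is $a\in\mathcal C^{\mathrm{loc}}_\Lambda$ with $\|\mathfrak D-G^{\mathrm{loc}}_\Lambda a\|_{\mathrm{loc}}\le\frac1{1-\varepsilon_G}\|\Theta_\Lambda\mathfrak D-G^{\mathrm{cl}}_\Lambda b\|_{\mathrm{cl}}+\frac{\delta_G}{1-\varepsilon_G}$. (2) Componentwise detection: for every $\mathfrak D\in\mathcal U^{\mathrm{loc}}_\Lambda$, $\|O^{\mathrm{loc}}_\Lambda\mathfrak D\|\ge\|O^{\mathrm{cl}}_\Lambda\Theta_\Lambda\mathfrak D\|-(\mathsf{Err}_{\mathrm{prs}}+\mathsf{Err}_{\mathrm{loc}}+\mathsf{Err}_{\mathrm{tr}}+\mathsf{Err}_{\mathrm{gauge}})(\mathfrak D)$; $C_E\|\mathcal E^{\mathrm{loc}}_\Lambda(\mathfrak D)\|\ge C_E\|\mathcal E^{\mathrm{cl}}_\Lambda(\Theta_\Lambda\mathfrak D)\|-\mathsf{Err}_{\mathrm{nl}}(\mathfrak D)$; $C_R\mathsf{Rep}^{\mathrm{loc}}_\Lambda(\mathfrak D)\ge C_R\mathsf{Rep}^{\mathrm{cl}}_\Lambda(\Theta_\Lambda\mathfrak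 D)-\mathsf{Err}_{\mathrm{rep}}(\mathfrak D)$; $[\mathsf P^{\mathrm{loc}}_\Lambda(\mathfrak D)]_+\ge[\mathsf P^{\mathrm{cl}}_\Lambda(\Theta_\Lambda\mathfrak D)]_+-\mathsf{Err}_{\mathrm{prof}}(\mathfrak D)$. (3) Clean gap: there is $c^{\mathrm{cl}}_\Lambda>0$ with $\|\mathcal F^{\mathrm{cl}}_\Lambda(d)\|_{\mathrm{cl}}\ge c^{\mathrm{cl}}_\Lambda\operatorname{dist}_{\mathrm{cl}}(d,\operatorname{Im}G^{\mathrm{cl}}_\Lambda)$ for all $d\in\Theta_\Lambda(\mathcal U^{\mathrm{loc}}_\Lambda)$. (4) Concrete-budget condition: there are $\eta_{\mathrm{conc}},\Delta_{\mathrm{conc}}\ge0$ with $\mathcal B^{\mathrm{conc}}_\Lambda(\mathfrak D)\le\eta_{\mathrm{conc}}\operatorname{dist}_{\mathrm{loc}}(\mathfrak D,\operatorname{Im}G^{\mathrm{loc}}_\Lambda)+\Delta_{\mathrm{conc}}$ for every $\mathfrak D\in\mathcal U^{\mathrm{loc}}_\Lambda$. (5) $\eta_{\mathrm{conc}}<c^{\mathrm{cl}}_\Lambda(1-\varepsilon_G)$. Then, with $c^{\mathrm{loc}}_\Lambda=c^{\mathrm{cl}}_\Lambda(1-\varepsilon_G)-\eta_{\mathrm{conc}}>0$ and $\Delta'_\Lambda=\Delta_{\mathrm{conc}}+c^{\mathrm{cl}}_\Lambda\delta_G$, every $\mathfrak D\in\mathcal U^{\mathrm{loc}}_\Lambda$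 satisfies \[ \|O^{\mathrm{loc}}_\Lambda\mathfrak D\|+C_E\|\mathcal E^{\mathrm{loc}}_\Lambda(\mathfrak D)\|+C_R\mathsf{Rep}^{\mathrm{loc}}_\Lambda(\mathfrak D)+[\mathsf P^{\mathrm{loc}}_\Lambda(\mathfrak D)]_+\ \ge\ c^{\mathrm{loc}}_\Lambda\operatorname{dist}_{\mathrm{loc}}(\mathfrak D,\operatorname{Im}G^{\mathrm{loc}}_\Lambda)-\Delta'_\Lambda , \] equivalently \[ \|O^{\mathrm{loc}}_\Lambda\mathfrak D\|+C_E\|\mathcal E^{\mathrm{loc}}_\Lambda(\mathfrak D)\|+C_R\mathsf{Rep}^{\mathrm{loc}}_\Lambda(\mathfrak D)\ \ge\ c^{\mathrm{loc}}_\Lambda\operatorname{dist}_{\mathrm{loc}}(\mathfrak D,\operatorname{Im}G^{\mathrm{loc}}_\Lambda)-[\mathsf P^{\mathrm{loc}}_\Lambda(\mathfrak D)]_+-\Delta'_\Lambda . \]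
   Context: Finite-window setting. $\Lambda$ is a fixed finite window with finite scale set $\Lambda_{\mathrm{sc}}\subset\mathbb Z$. $\mathcal D^{\mathrm{loc}}_\Lambda$, $\mathcal D^{\mathrm{cl}}_\Lambda$ are finite-dimensional normed spaces (norms $\|\cdot\|_{\mathrm{loc}}$, $\|\cdot\|_{\mathrm{cl}}$). For $\bullet\in\{\mathrm{loc},\mathrm{cl}\}$, $\mathcal C^\bullet_\Lambda$ is a finite-dimensional normed space, $G^\bullet_\Lambda:\mathcal C^\bullet_\Lambda\to\mathcal D^\bullet_\Lambda$ a cleaning map, $\operatorname{dist}_\bullet(d,\operatorname{Im}G^\bullet_\Lambda)=\inf_a\|d-G^\bullet_\Lambda a\|_\bullet$. The chart $\Theta_\Lambda:\mathcal U^{\mathrm{loc}}_\Lambda\to\mathcal D^{\mathrm{cl}}_\Lambda$, $\mathcal U^{\mathrm{loc}}_\Lambda\subseteq\mathcal D^{\mathrm{loc}}_\Lambda$, is a composition of continuous maps (core restriction, cutoff flattening, harmonic-gauge projection, periodization, clean projection, coordinate extraction) through finite-dimensional normed spaces. $O^\bullet_\Lambda,\mathcal E^\bullet_\Lambda$ map $\mathcal D^\bullet_\Lambda$ to normed spaces, $\mathsf{Rep}^\bullet_\Lambda:\mathcal D^\bullet_\Lambda\to[0,\infty)$, $\mathsf P^\bullet_\Lambda:\mathcal D^\bullet_\Lambda\to\mathbb R$, $C_E,C_R\ge0$ are fixed, $[x]_+=\max\{x,0\}$, and $\|\mathcal F^\bullet_\Lambda(d)\|_\bullet=\|O^\bullet_\Lambda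 d\|+C_E\|\mathcal E^\bullet_\Lambda(d)\|+C_R\mathsf{Rep}^\bullet_\Lambda(d)+[\mathsf P^\bullet_\Lambda(d)]_+$. Each package $\mathfrak D$ carries, for each $k\in\Lambda_{\mathrm{sc}}$, the data below; all weights $\omega$ are fixed and nonnegative. Pressure. $B_r\subset\mathbb R^3$ are balls centred at $0$, $A_{3/4,1}=B_1\setminus\overline B_{3/4}$, $I_k$ is a finite time interval, $\eta_k\in C_c^\infty(B_1)$ with $0\le\eta_k\le1$ and $\eta_k\equiv1$ on $B_{3/4}$, $f_k=(f_{k,ij})$ and $F^{\mathrm{cl}}_k=(F^{\mathrm{cl}}_{k,ij})$ are tensor sources, $p^{\mathrm{harm}}_k\in L^2(I_k;L^2(B_{3/4}))$ is harmonic in $B_{3/4}$ for a.e. $t$; $(1-\eta_k)f_{k,ij}$ is supported in $A_{3/4,1}$ and lies in $L^{3/2}(I_k;L^{3/2}(A_{3/4,1}))$; $f_{k,ij}-F^{\mathrm{cl}}_{k,ij}$ extended by zero outside $B_1$ lies in $L^{3/2}(I_k;L^{3/2}(\mathbb R^3))$. $M\ge0$ is a fixed integer; $C_{\mathrm{nlp}}<\infty$ is a constant depending only on the fixed geometry and the kernels of $R_iR_j$ ($R_i$ Riesz transforms) for the commutator estimate $\|R_iR_j(\eta f_{ij})-\eta R_iR_jf_{ij}\|_{L^{3/2}(I;L^{3/2}(B_{1/2}))}\le C_{\mathrm{nlp}}\sum_{i,j}\|(1-\eta)f_{ij}\|_{L^{3/2}(I;L^{3/2}(A_{3/4,1}))}$,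 and $C_{\mathrm{CZ}}$ is the Calder\'on--Zygmund constant in $\|R_iR_jG_{ij}\|_{L^{3/2}(\mathbb R^3)}\le C_{\mathrm{CZ}}\sum_{i,j}\|G_{ij}\|_{L^{3/2}(\mathbb R^3)}$ (summation convention). $Y_{\mathrm{prs},k}=L^{3/2}(I_k;L^{3/2}(B_{1/2}))$, $\mathsf P^{\mathrm{cl}}_{\mathrm{prs},N}$ is a fixed bounded linear projection of $Y_{\mathrm{prs},k}$ onto a fixed finite-dimensional subspace, $q^{\mathrm{cl}}_k,q^{\mathrm{prs}}_k\in Y_{\mathrm{prs},k}$ are pressure observations, $q^{\mathrm{per}}_k\in L^{3/2}(I_k;L^{3/2}(\mathbb T^3))$ with $\mathbb T^3$ a unit torus containing a copy of $B_{1/2}$ in one chart, $\mathsf{Per}$ is extension by zero from $B_{1/2}$ to $\mathbb T^3$, and $\langle q\rangle_{B_{1/2}}(t)$ is the spatial mean. Put $\mathsf{Err}_{\mathrm{proj},k}=\|q^{\mathrm{cl}}_k-\mathsf P^{\mathrm{cl}}_{\mathrm{prs},N}q^{\mathrm{cl}}_k\|_{Y_{\mathrm{prs},k}}$, $\mathsf{Err}_{\mathrm{mean},k}=\|\langle q^{\mathrm{prs}}_k\rangle_{B_{1/2}}\|_{Y_{\mathrm{prs},k}}$, $\mathsf{Err}_{\mathrm{per},k}=\|\mathsf{Per}\,q^{\mathrm{prs}}_k-q^{\mathrm{per}}_k\|_{L^{3/2}(I_k;L^{3/2}(\mathbb T^3))}$, \[ \begin{aligned} \mathcal B^{\mathrm{norm}}_{\mathrm{prs}}(\mathfrak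 D)=\sum_{k}\omega_{\mathrm{prs},k}\Big(&|I_k|^{1/6}|B_{1/2}|^{1/6}(\tfrac23)^{M+1}\|p^{\mathrm{harm}}_k\|_{L^2(I_k;L^2(B_{3/4}))}+C_{\mathrm{nlp}}\sum_{i,j}\|(1-\eta_k)f_{k,ij}\|_{L^{3/2}(I_k;L^{3/2}(A_{3/4,1}))}\\ &+C_{\mathrm{CZ}}\sum_{i,j}\|f_{k,ij}-F^{\mathrm{cl}}_{k,ij}\|_{L^{3/2}(I_k;L^{3/2}(B_1))}+\mathsf{Err}_{\mathrm{proj},k}+\mathsf{Err}_{\mathrm{mean},k}+\mathsf{Err}_{\mathrm{per},k}\Big). \end{aligned} \] $\mathsf{Err}_{\mathrm{prs}}(\mathfrak D)=\sum_k\omega_{\mathrm{prs},k}(\mathsf{Err}_{\text{harm-tail},k}+\mathsf{Err}_{\mathrm{comm},k}+\mathsf{Err}_{\mathrm{active},k}+\mathsf{Err}_{\mathrm{proj},k}+\mathsf{Err}_{\mathrm{mean},k}+\mathsf{Err}_{\mathrm{per},k})$, with the first three entries given by the first three terms inside the bracket of $\mathcal B^{\mathrm{norm}}_{\mathrm{prs}}$. Localization and cutoff nonlinearity. $Q_1=B_1\times(-1,0)$, $Q_{1/2}=B_{1/2}\times(-1/4,0)$; $\chi$ is smooth, compactly supported in $B_1\times(-1,0]$, $0\le\chi\le1$, $\chi\equiv1$ on $Q_{1/2}$; $C_\chi=\|\partial_t\chi\|_{L^\infty(Q_1)}+\|\Delta\chi\|_{L^\infty(Q_1)}+\|\nabla\chi\|_{L^\infty(Q_1)}$.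 The normalized component $(u_k,p_k)$ on $Q_1$ satisfies $u_k\in L^2(-1,0;H^1(B_1))\cap L^3(Q_1)$, $p_k^\circ:=p_k-(p_k)_{B_1}(t)\in L^{3/2}(Q_1)$ and the incompressible Navier--Stokes momentum equation in distributions. $A_k=\operatorname{ess\,sup}_{-1<t<0}\int_{B_1}|u_k|^2$, $C_k=\int_{Q_1}|u_k|^3$, $D_k=\int_{Q_1}|p_k^\circ|^{3/2}$, $E_k=\int_{Q_1}|\nabla u_k|^2$. $\mathsf{Err}^{\mathrm{en}}_{\mathrm{loc}}(u)=\int_{Q_1}|u|^2(|\partial_t\chi|+|\Delta\chi|)$, $\mathsf{Err}^{\mathrm{flux}}_{\mathrm{loc}}(u)=\int_{Q_1}|u|^2|u\cdot\nabla\chi|$, $\mathsf{Err}^{\mathrm{prs}}_{\mathrm{loc}}(u,p)=\int_{Q_1}|p^\circ||u||\nabla\chi|$, and $\mathsf{Err}^{\mathrm{mom}}_{\mathrm{loc}}(u,p)=\sup|\langle\partial_t(\chi u)-\Delta(\chi u)+\nabla\cdot(\chi u\otimes u)+\nabla(\chi p^\circ),\varphi\rangle|$ over $\varphi\in C_c^\infty(Q_1;\mathbb R^3)$ with $\|\varphi\|_{L^2(Q_1)}+\|\varphi\|_{L^3(Q_1)}\le1$. $\mathsf{Err}_{\mathrm{loc}}(\mathfrak D)=\sum_k(\omega_{\mathrm{en},k}\mathsf{Err}^{\mathrm{en}}_{\mathrm{loc}}(u_k)+\omega_{\mathrm{flux},k}\mathsf{Err}^{\mathrm{flux}}_{\mathrm{loc}}(u_k)+\omega^{\mathrm{loc}}_{\mathrm{prs},k}\mathsf{Err}^{\mathrm{prs}}_{\mathrm{loc}}(u_k,p_k)+\omega_{\mathrm{mom},k}\mathsf{Err}^{\mathrm{mom}}_{\mathrm{loc}}(u_k,p_k))$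 and \[ \mathcal B^{\mathrm{norm}}_{\mathrm{loc}}(\mathfrak D)=C_\chi\sum_k\big(\omega_{\mathrm{en},k}A_k+\omega_{\mathrm{flux},k}C_k+\omega^{\mathrm{loc}}_{\mathrm{prs},k}C_k^{1/3}D_k^{2/3}+\omega_{\mathrm{mom},k}(A_k^{1/2}+E_k^{1/2}+C_k^{2/3}+D_k^{2/3})\big). \] $\mathsf{Err}^{\mathrm{cut}}_{\mathrm{nl}}(u)=\sup|\langle\nabla\cdot((\chi u)\otimes(\chi u)-\chi u\otimes u),\varphi\rangle|$ over $\varphi\in C_c^\infty(Q_1;\mathbb R^3)$ with $\|\varphi\|_{L^3(Q_1)}+\|\nabla\varphi\|_{L^3(Q_1)}\le1$; $\mathsf{Err}^{\mathrm{cut}}_{\mathrm{nl}}(\mathfrak D)=\sum_k\omega^{\mathrm{cut}}_{\mathrm{nl},k}\mathsf{Err}^{\mathrm{cut}}_{\mathrm{nl}}(u_k)$, $\mathcal B^{\mathrm{cut}}_{\mathrm{nl}}(\mathfrak D)=C_\chi\sum_k\omega^{\mathrm{cut}}_{\mathrm{nl},k}C_k^{2/3}$; $\mathsf{Err}_{\mathrm{nl}}=\mathsf{Err}^{\mathrm{cut}}_{\mathrm{nl}}+\mathsf{Err}^{\mathrm{rem}}_{\mathrm{nl}}$ where $\mathsf{Err}^{\mathrm{rem}}_{\mathrm{nl}}(\mathfrak D)\ge0$ is the remaining nonlinear residual. Truncation. $\mathcal Y_{\mathrm{tr},k}$ is a Banach space, $\mathsf T_{\mathrm{tr},N,k}$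 a bounded linear projection onto a finite-dimensional subspace, $z_k(\mathfrak D)\in\mathcal Y_{\mathrm{tr},k}$; $\mathsf{Err}_{\mathrm{tr}}(\mathfrak D)=\sum_k\omega_{\mathrm{tr},k}\|z_k-\mathsf T_{\mathrm{tr},N,k}z_k\|$ and $\mathcal B^{\mathrm{norm}}_{\mathrm{tr}}(\mathfrak D)=\sum_k\omega_{\mathrm{tr},k}(1+\|\mathsf T_{\mathrm{tr},N,k}\|)\|z_k(\mathfrak D)\|$. Reproduction, gauge, profit. With component spaces $\mathcal D^{\mathrm{loc}}_k,\mathcal D^{\mathrm{cl}}_k$ (finite-dimensional normed), components $D^{\mathrm{loc}}_k$ of $\mathfrak D$, bounded linear component charts $\Theta_k:\mathcal D^{\mathrm{loc}}_k\to\mathcal D^{\mathrm{cl}}_k$ and bounded linear reproduction maps $R^\bullet_k:\mathcal D^\bullet_k\to\mathcal D^\bullet_{k+1}$, $\mathsf{Err}_{\mathrm{rep}}(\mathfrak D)=\big(\sum_{k,k+1\in\Lambda_{\mathrm{sc}}}\|\Theta_{k+1}R^{\mathrm{loc}}_kD^{\mathrm{loc}}_k-R^{\mathrm{cl}}_k\Theta_kD^{\mathrm{loc}}_k\|^2_{\mathcal D^{\mathrm{cl}}_{k+1}}\big)^{1/2}$. $\mathsf{Err}_{\mathrm{gauge}}(\mathfrak D)\ge0$ is the gauge mismatch error, and $\mathsf{Err}_{\mathrm{prof}}(\mathfrak D)=|\mathsf P^{\mathrm{loc}}_\Lambda(\mathfrak D)-\mathsf P^{\mathrm{cl}}_\Lambda(\Theta_\Lambda\mathfrak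 D)|$. Concrete budget: $\mathcal B^{\mathrm{conc}}_\Lambda=\mathcal B^{\mathrm{norm}}_{\mathrm{prs}}+\mathcal B^{\mathrm{norm}}_{\mathrm{loc}}+\mathcal B^{\mathrm{norm}}_{\mathrm{tr}}+\mathcal B^{\mathrm{cut}}_{\mathrm{nl}}+\mathsf{Err}^{\mathrm{rem}}_{\mathrm{nl}}+\mathsf{Err}_{\mathrm{rep}}+\mathsf{Err}_{\mathrm{gauge}}+\mathsf{Err}_{\mathrm{prof}}$. *)

(* Defs.v *)
From HB Require Import structures.
From mathcomp Require Import all_boot all_order all_algebra finmap.
From mathcomp Require Import all_classical all_reals all_analysis.
From mathcomp Require Import measurable_realfun ess_sup_inf.
Set Implicit Arguments.
Unset Strict Implicit.
Unset Printing Implicit Defensive.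
Import Order.TTheory GRing.Theory Num.Theory numFieldNormedType.Exports.
Local Open Scope classical_set_scope.
Local Open Scope ring_scope.

Section Calculus.
Variable R : realType.
Implicit Type V : normedModType R.

Fixpoint iter_derive V (s : seq V) (f : V -> R) : V -> R :=
  if s is v :: s' then 'D_v (iter_derive s' f) else f.

(* C^oo on a finite-dimensional space: all iterated directional derivatives
   exist and are continuous. *)
Definition smooth V (f : V -> R) : Prop := forall s : seq V,
  continuous (iter_derive s f) /\ forall x v, derivable (iter_derive s f) x v.

(* C_c^oo(A), each function being extended by zero to the whole space *)
Definition test_fun V (A : set V) (f : V -> R) : Prop :=
  smooth f /\
  exists K : set V, [/\ compact K, K `<=` A & forall x, ~ K x -> f x = 0].

Definition fin_spanned V (A : set V) : Prop :=
  exists (n : nat) (e : 'I_n -> V), forall v, A v ->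
    exists c : 'I_n -> R, v = \sum_(i < n) c i *: e i.

Definition finite_dim V : Prop := fin_spanned [set: V].

Definition bounded_linear V (W : normedModType R) (T : {linear V -> W}) : Prop :=
  exists C : R, forall x, `|T x| <= C * `|x|.

Definition opnorm V (W : normedModType R) (T : {linear V -> W}) : R :=
  sup [set `|T x| | x in [set x | `|x| <= 1]].

Definition pos_part (x : R) : R := Num.max x 0.

End Calculus.

(* The product measure m1 \x m2, with its sigma-finite structure: on the constant
   behind \x the library's canonical structure is the one for subprobabilities. *)
Section ProductMeasure.
Local Open Scope ereal_scope.
Context d1 d2 (R : realType) (T1 : measurableType d1) (T2 : measurableType d2)
  (m1 : {sigma_finite_measure set T1 -> \bar R})
  (m2 : {sigma_finite_measure set T2 -> \bar R}).

Definition prod_measure : set (T1 * T2) -> \bar R := m1 \x m2.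

HB.instance Definition _ := Measure.on prod_measure.

Let prod_measure_sigma_finite : sigma_finite setT prod_measure.
Proof.
have /sigma_finiteP[F [TF ndF Foo]] := sigma_finiteT m1.
have /sigma_finiteP[G [TG ndG Goo]] := sigma_finiteT m2.
exists (fun n => F n `*` G n).
  rewrite -setXTT TF TG predeqE => -[x y]; split.
    move=> [/= [n _ Fnx] [k _ Gky]]; exists (maxn n k) => //; split.
    - by move: x Fnx; exact/subsetPset/ndF/leq_maxl.
    - by move: y Gky; exact/subsetPset/ndG/leq_maxr.
  by move=> [n _ []/= ? ?]; split; exists n.
move=> k; have [? ?] := Foo k; have [? ?] := Goo k.
split; first exact: measurableX.
by rewrite /prod_measure product_measure1E// lte_mul_pinfty// ge0_fin_numE.
Qed.

HB.instance Definition _ := Measure_isSigmaFinite.Build _ _ _ prod_measure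
  prod_measure_sigma_finite.

Definition prod_sf : {sigma_finite_measure set (T1 * T2)%type -> \bar R} :=
  prod_measure.

End ProductMeasure.

(* [space3 R] is R^3 and [spacetime R] is the set of pairs (t, x).  The library norm
   of these products is the max norm; Euclidean lengths are [vnorm], [enorm]. *)
Definition space3 (R : realType) : Type := (R * R * R)%type.
Definition spacetime (R : realType) : Type := (R * space3 R)%type.

HB.instance Definition _ (R : realType) := NormedModule.on (space3 R).
HB.instance Definition _ (R : realType) :=
  NormedModule.copy (spacetime R) (R * space3 R)%type.
HB.instance Definition _ (R : realType) := Measurable.copy (space3 R)
  (measurableTypeR R * measurableTypeR R * measurableTypeR R)%type.
HB.instance Definition _ (R : realType) := Measurable.copy (spacetime R)
  (measurableTypeR R * space3 R)%type.

Section Space.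
Variable R : realType.
Local Notation X := (space3 R).
Local Notation ST := (spacetime R).

Definition leb1 : {sigma_finite_measure set (measurableTypeR R) -> \bar R} :=
  @lebesgue_measure R.
Definition leb3 : {sigma_finite_measure set X -> \bar R} :=
  prod_sf (prod_sf leb1 leb1) leb1.
Definition leb4 : {sigma_finite_measure set ST -> \bar R} := prod_sf leb1 leb3.

Definition crd (x : X) (i : 'I_3) : R := [:: x.1.1; x.1.2; x.2]`_i.

Definition evec (i : 'I_3) : X :=
  ((i == 0 :> nat)%:R, (i == 1 :> nat)%:R, (i == 2 :> nat)%:R).

Definition vnorm (v : 'I_3 -> R) : R := Num.sqrt (\sum_(i < 3) v i ^+ 2).
Definition mnorm (m : 'I_3 -> 'I_3 -> R) : R :=
  Num.sqrt (\sum_(i < 3) \sum_(j < 3) m i j ^+ 2).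
Definition enorm (x : X) : R := vnorm (crd x).

Definition Bal (r : R) : set X := [set x | enorm x < r].
Definition annulus : set X := Bal 1 `\` closure (Bal (3 / 4)).
Definition I1 : set R := [set t | -1 < t < 0].
Definition Q1 : set ST := I1 `*` Bal 1.
Definition Qhalf : set ST := [set t | - (1 / 4) < t < 0] `*` Bal (1 / 2).

(* The unit torus through its fundamental cell; B_{1/2} lies inside the cell. *)
Definition torus : set X := [set x | forall i, - (1 / 2) <= crd x i < 1 / 2].

Definition dt (f : ST -> R) : ST -> R := 'D_((1, 0) : ST) f.
Definition dx (j : 'I_3) (f : ST -> R) : ST -> R := 'D_((0, evec j) : ST) f.
Definition lap (f : ST -> R) (z : ST) : R := \sum_(j < 3) dx j (dx j f) z.
Definition grad (f : ST -> R) (z : ST) : 'I_3 -> R := fun j => dx j f z.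

Definition harmonic_on (A : set X) (h : X -> R) : Prop := forall x, A x ->
  [/\ forall i, derivable h x (evec i),
      forall i j, derivable ('D_(evec i) h) x (evec j),
      forall i j, {for x, continuous ('D_(evec j) ('D_(evec i) h))} &
      \sum_(i < 3) 'D_(evec i) ('D_(evec i) h) x = 0].

Definition normLp d (T : measurableType d) (mu : {measure set T -> \bar R})
  (p : \bar R) (A : set T) (f : T -> R) : \bar R :=
  Lnorm mu p ((EFin \o f) \_ A).

Definition in_Lp d (T : measurableType d) (mu : {measure set T -> \bar R})
  (p : \bar R) (A : set T) (f : T -> R) : Prop :=
  measurable_fun A f /\ (normLp mu p A f < +oo)%E.

(* L^p(I; L^q(B)) *)
Definition normLL (p q : \bar R) (I : set R) (B : set X) (f : ST -> R) : \bar R :=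
  Lnorm leb1 p ((fun t => normLp leb3 q B (fun x => f (t, x))) \_ I).

Definition in_LL (p q : \bar R) (I : set R) (B : set X) (f : ST -> R) : Prop :=
  measurable_fun (I `*` B) f /\ (normLL p q I B f < +oo)%E.

Definition L32 : \bar R := (3 / 2)%:E.

Definition mean (B : set X) (f : ST -> R) (t : R) : R :=
  (\int[leb3]_(x in B) f (t, x)) / fine (leb3 B).

(* R_j f(x) = Gamma(2) / pi^2 p.v. \int (x_j - y_j) / |x - y|^4 f(y) dy *)
Definition riesz (j : 'I_3) (f : X -> R) (x : X) : R :=
  lim ((fun e : R => (pi ^+ 2)^-1 *
    \int[leb3]_(y in [set y | e < enorm (x - y)])
      (crd (x - y) j / enorm (x - y) ^+ 4 * f y)) @ 0^'+).

Definition fin_interval (I : set R) : Prop := is_interval I /\ bounded_set I.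

Definition prs_cutoff (eta : X -> R) : Prop :=
  [/\ test_fun (Bal 1) eta, forall x, 0 <= eta x <= 1 &
      forall x, Bal (3 / 4) x -> eta x = 1].

Definition off_cutoff (eta : X -> R) (f : ST -> R) : ST -> R :=
  fun z => (1 - eta z.2) * f z.

Definition supported_in (I : set R) (A : set X) (f : ST -> R) : Prop :=
  {ae leb4, forall z, I z.1 -> ~ A z.2 -> f z = 0}.

Definition CZ_constant (C : R) : Prop := 0 <= C /\
  forall G : 'I_3 -> 'I_3 -> X -> R,
    (forall i j, in_Lp leb3 L32 setT (G i j)) ->
    (normLp leb3 L32 setT
       (fun x => (\sum_(i < 3) \sum_(j < 3) riesz i (riesz j (G i j)) x)%R)
     <= C%:E * \sum_(i < 3) \sum_(j < 3) normLp leb3 L32 setT (G i j))%E.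

Definition nlp_constant (C : R) : Prop := 0 <= C /\
  forall (I : set R) (eta : X -> R) (f : 'I_3 -> 'I_3 -> ST -> R),
    fin_interval I -> prs_cutoff eta ->
    (forall i j, in_LL L32 L32 I setT (f i j)) ->
    (forall i j, supported_in I annulus (off_cutoff eta (f i j))) ->
    (normLL L32 L32 I (Bal (1 / 2)) (fun z => (\sum_(i < 3) \sum_(j < 3)
       (riesz i (riesz j (fun y => eta y * f i j (z.1, y))) z.2
        - eta z.2 * riesz i (riesz j (fun y => f i j (z.1, y))) z.2))%R)
     <= C%:E * \sum_(i < 3) \sum_(j < 3)
          normLL L32 L32 I annulus (off_cutoff eta (f i j)))%E.

End Space.

Arguments normLp {R d T} mu p%_E A%_classical_set_scope f%_R.
Arguments normLL {R} (p q)%_E (I B)%_classical_set_scope f%_R.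

Section Pressure.
Variable R : realType.
Local Notation X := (space3 R).
Local Notation ST := (spacetime R).
Local Notation L32 := (L32 R).

Definition Yprs (I : set R) : set (ST -> R) :=
  [set q | in_LL L32 L32 I (Bal (1 / 2)) q].

Definition Yeq (I : set R) (q q' : ST -> R) : Prop :=
  ae_eq (leb4 R) (I `*` Bal (1 / 2)) q q'.

(* P represents, on functions, a bounded linear projection of the Banach space
   Yprs I (functions modulo Yeq I) onto the span of e_0, ..., e_(n-1). *)
Definition Yprojection (I : set R) (P : (ST -> R) -> (ST -> R)) : Prop :=
  [/\ (forall q, Yprs I q -> Yprs I (P q)) /\
      (forall q q', Yprs I q -> Yprs I q' -> Yeq I q q' -> Yeq I (P q) (P q')),
      forall (a : R) q q', Yprs I q -> Yprs I q' ->
        Yeq I (P (a \*: q \+ q')) (a \*: P q \+ P q'),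
      exists C : R, forall q, Yprs I q ->
        (normLL L32 L32 I (Bal (1 / 2)) (P q)
         <= C%:E * normLL L32 L32 I (Bal (1 / 2)) q)%E &
      exists (n : nat) (e : 'I_n -> ST -> R),
        (forall i, Yprs I (e i) /\ Yeq I (P (e i)) (e i)) /\
        forall q, Yprs I q -> exists c : 'I_n -> R,
          Yeq I (P q) (fun z => \sum_(i < n) c i * e i z)].

Record pressure_setup := PressureSetup {
  prs_I : int -> set R;
  prs_proj : int -> (ST -> R) -> (ST -> R);
  prs_M : nat;
  prs_Cnlp : R;
  prs_CCZ : R;
  prs_w : int -> R }.

Record pressure_data := PressureData {
  prs_eta : X -> R;
  prs_f : 'I_3 -> 'I_3 -> ST -> R;
  prs_Fcl : 'I_3 -> 'I_3 -> ST -> R;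
  prs_harm : ST -> R;
  prs_qcl : ST -> R;
  prs_q : ST -> R;
  prs_qper : ST -> R }.

Variables (Sc : {fset int}) (S : pressure_setup).

Definition pressure_setup_wf : Prop :=
  [/\ nlp_constant (prs_Cnlp S), CZ_constant (prs_CCZ S) &
      forall k, k \in Sc -> [/\ fin_interval (prs_I S k),
        Yprojection (prs_I S k) (prs_proj S k) & 0 <= prs_w S k]].

Definition pressure_data_wf (I : set R) (d : pressure_data) : Prop :=
  [/\ prs_cutoff (prs_eta d),
      in_LL 2%:E 2%:E I (Bal (3 / 4)) (prs_harm d) /\
      {ae leb1 R, forall t, I t -> exists2 h, harmonic_on (Bal (3 / 4)) h &
        ae_eq (leb3 R) (Bal (3 / 4)) (fun x => prs_harm d (t, x)) h},
      forall i j, supported_in I (@annulus R) (off_cutoff (prs_eta d) (prs_f d i j))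
        /\ in_LL L32 L32 I (@annulus R) (off_cutoff (prs_eta d) (prs_f d i j)),
      forall i j, in_LL L32 L32 I setT
        ((prs_f d i j \- prs_Fcl d i j) \_ (setT `*` Bal 1)) &
      [/\ Yprs I (prs_qcl d), Yprs I (prs_q d) &
          in_LL L32 L32 I (@torus R) (prs_qper d)]].

Definition Err_harm_tail (k : int) (d : pressure_data) : \bar R :=
  (leb1 R (prs_I S k) `^ (1 / 6) * leb3 R (Bal (1 / 2)) `^ (1 / 6)
   * ((2 / 3) ^+ (prs_M S).+1)%:E
   * normLL 2%:E 2%:E (prs_I S k) (Bal (3 / 4)) (prs_harm d))%E.

Definition Err_comm (k : int) (d : pressure_data) : \bar R :=
  ((prs_Cnlp S)%:E * \sum_(i < 3) \sum_(j < 3)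
    normLL L32 L32 (prs_I S k) (@annulus R)
      (off_cutoff (prs_eta d) (prs_f d i j)))%E.

Definition Err_active (k : int) (d : pressure_data) : \bar R :=
  ((prs_CCZ S)%:E * \sum_(i < 3) \sum_(j < 3)
    normLL L32 L32 (prs_I S k) (Bal 1) (prs_f d i j \- prs_Fcl d i j))%E.

Definition Err_proj (k : int) (d : pressure_data) : \bar R :=
  normLL L32 L32 (prs_I S k) (Bal (1 / 2))
    (prs_qcl d \- prs_proj S k (prs_qcl d)).

Definition Err_mean (k : int) (d : pressure_data) : \bar R :=
  normLL L32 L32 (prs_I S k) (Bal (1 / 2))
    (fun z => mean (Bal (1 / 2)) (prs_q d) z.1).

Definition Per (q : ST -> R) : ST -> R := q \_ (setT `*` Bal (1 / 2)).

Definition Err_per (k : int) (d : pressure_data) : \bar R :=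
  normLL L32 L32 (prs_I S k) (@torus R) (Per (prs_q d) \- prs_qper d).

Definition Err_prs (d : int -> pressure_data) : \bar R :=
  (\sum_(k <- Sc) (prs_w S k)%:E *
    (Err_harm_tail k (d k) + Err_comm k (d k) + Err_active k (d k)
     + Err_proj k (d k) + Err_mean k (d k) + Err_per k (d k)))%E.

Definition B_prs (d : int -> pressure_data) : \bar R :=
  (\sum_(k <- Sc) (prs_w S k)%:E *
    (leb1 R (prs_I S k) `^ (1 / 6) * leb3 R (Bal (1 / 2)) `^ (1 / 6)
       * ((2 / 3) ^+ (prs_M S).+1)%:E
       * normLL 2%:E 2%:E (prs_I S k) (Bal (3 / 4)) (prs_harm (d k))
     + (prs_Cnlp S)%:E * (\sum_(i < 3) \sum_(j < 3)
         normLL L32 L32 (prs_I S k) (@annulus R)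
           (off_cutoff (prs_eta (d k)) (prs_f (d k) i j)))
     + (prs_CCZ S)%:E * (\sum_(i < 3) \sum_(j < 3)
         normLL L32 L32 (prs_I S k) (Bal 1)
           (prs_f (d k) i j \- prs_Fcl (d k) i j))
     + Err_proj k (d k) + Err_mean k (d k) + Err_per k (d k)))%E.

End Pressure.

Section Localization.
Variable R : realType.
Local Notation X := (space3 R).
Local Notation ST := (spacetime R).
Local Notation I1 := (@I1 R).
Local Notation Q1 := (@Q1 R).
Local Notation leb4 := (leb4 R).

(* chi is smooth up to t = 0, i.e. it is given on t <= 0 as the restriction of a
   smooth function; its values for t > 0 are irrelevant. *)
Definition loc_cutoff (chi : ST -> R) : Prop :=
  [/\ smooth chi,
      exists K : set ST, [/\ compact K, K `<=` [set t | -1 < t <= 0] `*` Bal 1 &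
        forall z, z.1 <= 0 -> ~ K z -> chi z = 0],
      forall z, z.1 <= 0 -> 0 <= chi z <= 1 &
      forall z, Qhalf z -> chi z = 1].

Definition C_chi (chi : ST -> R) : \bar R :=
  (normLp leb4 +oo Q1 (dt chi) + normLp leb4 +oo Q1 (lap chi)
   + normLp leb4 +oo Q1 (fun z => vnorm (grad chi z)))%E.

(* [flow_Du v i j] stands for d_j u_i. *)
Record flow := Flow {
  flow_u : 'I_3 -> ST -> R;
  flow_Du : 'I_3 -> 'I_3 -> ST -> R;
  flow_p : ST -> R }.

Definition uvec (v : flow) (z : ST) : 'I_3 -> R := fun i => flow_u v i z.

Definition pcirc (v : flow) (z : ST) : R :=
  flow_p v z - mean (Bal 1) (flow_p v) z.1.

Definition weak_grad (w : 'I_3 -> X -> R) (Dw : 'I_3 -> 'I_3 -> X -> R) : Prop :=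
  forall phi : X -> R, test_fun (Bal 1) phi -> forall i j,
    \int[leb3 R]_(x in Bal 1) (w i x * 'D_(evec R j) phi x) =
    - (\int[leb3 R]_(x in Bal 1) (Dw i j x * phi x)).

(* < d_t U - Laplace U + div T + grad P , phi > on Q_1 *)
Definition mom_pairing (U : 'I_3 -> ST -> R) (T : 'I_3 -> 'I_3 -> ST -> R)
  (P : ST -> R) (phi : 'I_3 -> ST -> R) : R :=
  \int[leb4]_(z in Q1)
    (- (\sum_(i < 3) U i z * dt (phi i) z)
     - (\sum_(i < 3) U i z * lap (phi i) z)
     - (\sum_(i < 3) \sum_(j < 3) T i j z * dx j (phi i) z)
     - P z * (\sum_(i < 3) dx i (phi i) z)).

(* < div T , phi > on Q_1 *)
Definition div_pairing (T : 'I_3 -> 'I_3 -> ST -> R) (phi : 'I_3 -> ST -> R) : R :=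
  - (\int[leb4]_(z in Q1)
       (\sum_(i < 3) \sum_(j < 3) T i j z * dx j (phi i) z)).

Definition vtest (phi : 'I_3 -> ST -> R) : Prop :=
  forall i, test_fun Q1 (phi i).

Definition momentum_eq (v : flow) : Prop := forall phi, vtest phi ->
  mom_pairing (flow_u v) (fun i j z => flow_u v i z * flow_u v j z)
    (flow_p v) phi = 0.

Definition loc_integrable (f : ST -> R) : Prop :=
  measurable_fun Q1 f /\
  forall K : set ST, compact K -> K `<=` Q1 -> leb4.-integrable K (EFin \o f).

Definition flow_wf (v : flow) : Prop :=
  [/\ (* u in L^2(-1, 0; H^1(B_1)) *)
      [/\ forall i, in_LL 2%:E 2%:E I1 (Bal 1) (flow_u v i),
          forall i j, in_LL 2%:E 2%:E I1 (Bal 1) (flow_Du v i j) &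
          {ae leb1 R, forall t, I1 t ->
            weak_grad (fun i x => flow_u v i (t, x))
                      (fun i j x => flow_Du v i j (t, x))}],
      forall i, in_Lp leb4 3%:E Q1 (flow_u v i),
      loc_integrable (flow_p v),
      in_Lp leb4 (L32 R) Q1 (pcirc v) &
      momentum_eq v].

Definition flow_A (v : flow) : \bar R := ess_sup (leb1 R)
  ((fun t => \int[leb3 R]_(x in Bal 1) (vnorm (uvec v (t, x)) ^+ 2)%:E)
    \_ I1)%E.
Definition flow_C (v : flow) : \bar R :=
  (\int[leb4]_(z in Q1) (vnorm (uvec v z) ^+ 3)%:E)%E.
Definition flow_D (v : flow) : \bar R :=
  (\int[leb4]_(z in Q1) (`|pcirc v z| `^ (3 / 2))%:E)%E.
Definition flow_E (v : flow) : \bar R :=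
  (\int[leb4]_(z in Q1) (mnorm (fun i j => flow_Du v i j z) ^+ 2)%:E)%E.

Record loc_setup := LocSetup {
  loc_chi : ST -> R;
  w_en : int -> R;
  w_flux : int -> R;
  w_lprs : int -> R;
  w_mom : int -> R;
  w_cut : int -> R }.

Variables (Sc : {fset int}) (S : loc_setup).
Local Notation chi := (loc_chi S).

Definition loc_setup_wf : Prop := loc_cutoff chi /\
  forall k, k \in Sc -> [/\ 0 <= w_en S k, 0 <= w_flux S k, 0 <= w_lprs S k,
    0 <= w_mom S k & 0 <= w_cut S k].

Definition Err_en (v : flow) : \bar R :=
  (\int[leb4]_(z in Q1)
    (vnorm (uvec v z) ^+ 2 * (`|dt chi z| + `|lap chi z|))%:E)%E.

Definition Err_flux (v : flow) : \bar R :=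
  (\int[leb4]_(z in Q1)
    (vnorm (uvec v z) ^+ 2 * `|\sum_(i < 3) flow_u v i z * dx i chi z|)%:E)%E.

Definition Err_lprs (v : flow) : \bar R :=
  (\int[leb4]_(z in Q1)
    (`|pcirc v z| * vnorm (uvec v z) * vnorm (grad chi z))%:E)%E.

Definition vec_norm (p : \bar R) (phi : 'I_3 -> ST -> R) : \bar R :=
  normLp leb4 p Q1 (fun z => vnorm (fun i => phi i z)).
Definition grad_norm (p : \bar R) (phi : 'I_3 -> ST -> R) : \bar R :=
  normLp leb4 p Q1 (fun z => mnorm (fun i j => dx j (phi i) z)).

Definition Err_mom (v : flow) : \bar R :=
  ereal_sup [set `|mom_pairing (fun i z => chi z * flow_u v i z)
                     (fun i j z => chi z * flow_u v i z * flow_u v j z)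
                     (fun z => chi z * pcirc v z) phi|%:E
            | phi in [set phi | vtest phi /\
                        (vec_norm 2%:E phi + vec_norm 3%:E phi <= 1)%E]].

Definition Err_cut1 (v : flow) : \bar R :=
  ereal_sup [set `|div_pairing (fun i j z =>
                     (chi z * flow_u v i z) * (chi z * flow_u v j z)
                     - chi z * flow_u v i z * flow_u v j z) phi|%:E
            | phi in [set phi | vtest phi /\
                        (vec_norm 3%:E phi + grad_norm 3%:E phi <= 1)%E]].

Definition Err_loc (v : int -> flow) : \bar R :=
  (\sum_(k <- Sc)
    ((w_en S k)%:E * Err_en (v k) + (w_flux S k)%:E * Err_flux (v k)
     + (w_lprs S k)%:E * Err_lprs (v k) + (w_mom S k)%:E * Err_mom (v k)))%E.

Definition B_loc (v : int -> flow) : \bar R :=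
  (C_chi chi * \sum_(k <- Sc)
    ((w_en S k)%:E * flow_A (v k) + (w_flux S k)%:E * flow_C (v k)
     + (w_lprs S k)%:E * (flow_C (v k) `^ (1 / 3) * flow_D (v k) `^ (2 / 3))
     + (w_mom S k)%:E * (flow_A (v k) `^ (1 / 2) + flow_E (v k) `^ (1 / 2)
                         + flow_C (v k) `^ (2 / 3) + flow_D (v k) `^ (2 / 3))))%E.

Definition Err_cut (v : int -> flow) : \bar R :=
  (\sum_(k <- Sc) (w_cut S k)%:E * Err_cut1 (v k))%E.

Definition B_cut (v : int -> flow) : \bar R :=
  (C_chi chi * \sum_(k <- Sc) (w_cut S k)%:E * flow_C (v k) `^ (2 / 3))%E.

End Localization.

Section Window.
Variable R : realType.

Record trunc_setup := TruncSetup {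
  tr_Y : int -> completeNormedModType R;
  tr_T : forall k, {linear tr_Y k -> tr_Y k};
  tr_w : int -> R }.

Definition trunc_setup_wf (Sc : {fset int}) (S : trunc_setup) : Prop :=
  forall k, k \in Sc -> [/\ bounded_linear (tr_T S k),
    forall y, tr_T S k (tr_T S k y) = tr_T S k y,
    fin_spanned (range (tr_T S k)) & 0 <= tr_w S k].

Definition Err_tr (Sc : {fset int}) (S : trunc_setup)
  (z : forall k, tr_Y S k) : R :=
  \sum_(k <- Sc) tr_w S k * `|z k - tr_T S k (z k)|.

Definition B_tr (Sc : {fset int}) (S : trunc_setup)
  (z : forall k, tr_Y S k) : R :=
  \sum_(k <- Sc) tr_w S k * ((1 + opnorm (tr_T S k)) * `|z k|).

Record rep_setup := RepSetup {
  rep_Dloc : int -> normedModType R;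
  rep_Dcl : int -> normedModType R;
  rep_Theta : forall k, {linear rep_Dloc k -> rep_Dcl k};
  rep_Rloc : forall k, {linear rep_Dloc k -> rep_Dloc (k + 1)};
  rep_Rcl : forall k, {linear rep_Dcl k -> rep_Dcl (k + 1)} }.

Definition rep_setup_wf (Sc : {fset int}) (S : rep_setup) : Prop :=
  (forall k, k \in Sc -> [/\ finite_dim (rep_Dloc S k),
     finite_dim (rep_Dcl S k) & bounded_linear (rep_Theta S k)]) /\
  (forall k, k \in Sc -> k + 1 \in Sc ->
     bounded_linear (rep_Rloc S k) /\ bounded_linear (rep_Rcl S k)).

Definition Err_rep (Sc : {fset int}) (S : rep_setup)
  (D : forall k, rep_Dloc S k) : R :=
  Num.sqrt (\sum_(k <- Sc | k + 1 \in Sc)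
    `|rep_Theta S (k + 1) (rep_Rloc S k (D k))
      - rep_Rcl S k (rep_Theta S k (D k))| ^+ 2).

(* The data attached to each of the two sides, local and clean. *)
Record side := Side {
  sD : normedModType R;
  sC : normedModType R;
  sYO : normedModType R;
  sYE : normedModType R;
  sG : sC -> sD;
  sO : sD -> sYO;
  sE : sD -> sYE;
  sRep : sD -> R;
  sP : sD -> R }.

Definition side_wf (s : side) : Prop :=
  [/\ finite_dim (sD s), finite_dim (sC s) & forall d, 0 <= sRep (s := s) d].

Definition dist_im (s : side) (d : sD s) : R :=
  inf [set `|d - sG a| | a in [set: sC s]].

Definition Fnorm (CE CR : R) (s : side) (d : sD s) : R :=
  `|sO d| + CE * `|sE d| + CR * sRep d + pos_part (sP d).

Record chart (V W : normedModType R) := Chart {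
  ch_X1 : normedModType R;
  ch_X2 : normedModType R;
  ch_X3 : normedModType R;
  ch_X4 : normedModType R;
  ch_X5 : normedModType R;
  core_restriction : V -> ch_X1;
  cutoff_flattening : ch_X1 -> ch_X2;
  gauge_projection : ch_X2 -> ch_X3;
  periodization : ch_X3 -> ch_X4;
  clean_projection : ch_X4 -> ch_X5;
  coordinate_extraction : ch_X5 -> W }.

Definition chart_map (V W : normedModType R) (c : chart V W) : V -> W :=
  @coordinate_extraction _ _ c \o @clean_projection _ _ c \o
  @periodization _ _ c \o @gauge_projection _ _ c \o
  @cutoff_flattening _ _ c \o @core_restriction _ _ c.

Definition chart_wf (V W : normedModType R) (U : set V) (c : chart V W) : Prop :=
  [/\ finite_dim (ch_X1 c), finite_dim (ch_X2 c), finite_dim (ch_X3 c),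
      finite_dim (ch_X4 c) & finite_dim (ch_X5 c)] /\
  [/\ {within U, continuous (@core_restriction _ _ c)},
      continuous (@cutoff_flattening _ _ c),
      continuous (@gauge_projection _ _ c),
      continuous (@periodization _ _ c) &
      continuous (@clean_projection _ _ c) /\
      continuous (@coordinate_extraction _ _ c)].

Record package_data (D : Type) (TS : trunc_setup) (RS : rep_setup) := PackageData {
  pk_prs : D -> int -> pressure_data R;
  pk_flow : D -> int -> flow R;
  pk_z : D -> forall k, tr_Y TS k;
  pk_comp : D -> forall k, rep_Dloc RS k;
  pk_rem : D -> R;
  pk_gauge : D -> R }.

Definition package_wf (Sc : {fset int}) (PS : pressure_setup R)
  (D : Type) (U : set D) TS RS (K : package_data D TS RS) : Prop :=
  forall d, U d ->
    [/\ 0 <= pk_rem K d, 0 <= pk_gauge K d &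
        forall k, k \in Sc ->
          pressure_data_wf (prs_I PS k) (pk_prs K d k) /\
          flow_wf (pk_flow K d k)].

Definition Err_nl (Sc : {fset int}) (LS : loc_setup R) (D : Type) TS RS
  (K : package_data D TS RS) (d : D) : \bar R :=
  (Err_cut Sc LS (pk_flow K d) + (pk_rem K d)%:E)%E.

Definition Err_prof (L C : side) (Theta : sD L -> sD C) (d : sD L) : R :=
  `|sP d - sP (Theta d)|.

Definition B_conc (Sc : {fset int}) (PS : pressure_setup R) (LS : loc_setup R)
  (L C : side) (Theta : sD L -> sD C) TS RS (K : package_data (sD L) TS RS)
  (d : sD L) : \bar R :=
  (B_prs Sc PS (pk_prs K d) + B_loc Sc LS (pk_flow K d)
   + (B_tr Sc (pk_z K d))%:E + B_cut Sc LS (pk_flow K d) + (pk_rem K d)%:E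
   + (Err_rep Sc (pk_comp K d))%:E + (pk_gauge K d)%:E
   + (Err_prof Theta d)%:E)%E.

End Window.

(* Main.v *)
(** Each error entry is dominated by its budget, so the detection inequalities
    give F^loc(d) >= F^cl(Theta d) - B^conc(d); the clean gap and quotient lifting
    then conclude.  The substantial domination is that of the momentum error.
    Testing the momentum equation with chi phi, and integrating
    2 (grad chi . grad) phi by parts onto u, the localized pairing equals

      int u.phi (d_t chi - lap chi) - 2 Du : (phi (x) grad chi)
          + (u.phi)(u.grad chi) + (p - mean p) phi.grad chi,

    since the mean of p only sees the integral of div(chi phi) over B_1.
    The factor 2 is absorbed by |grad chi| <= |lap chi|_oo =: F, which holds
    because chi(t) is a bump with values in [0, 1], supported in the unit ball:
    comparison with F |x|^2 / 6 gives F >= 6 (as chi = 1 at the center), and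
    doubling of variables gives (d_j chi)^2 <= 2 F, so
    |grad chi|^2 <= 6 F <= F^2. *)

Require Import Defs.
From mathcomp Require Import all_boot all_order all_algebra finmap.
From mathcomp Require Import all_classical all_reals all_analysis.
From mathcomp Require Import measurable_realfun ess_sup_inf.
From mathcomp Require Import ring lra.
Set Implicit Arguments.
Unset Strict Implicit.
Unset Printing Implicit Defensive.
Import Order.TTheory GRing.Theory Num.Theory numFieldNormedType.Exports.
Local Open Scope classical_set_scope.
Local Open Scope ring_scope.

(** * Smooth functions *)

(** The budget of the momentum error carries the constant C_chi exactly, with no numerical factor to
    spare, and the dual norm in that error controls phi but none of its derivatives. So every term
    in which phi is differentiated has to be removed exactly, and the remaining factor 2 has to be
    paid for by the terms of C_chi itself. The number 6 is the Laplacian of |x|^2 in dimension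
    three; in |grad chi|^2 <= 6 F it is three coordinates times 2 F. The bound F >= 6 also gives
    C_chi >= 1, on which the cutoff nonlinearity depends: its error contains no derivative of chi,
    yet its budget is scaled by C_chi. Errors and budgets are extended reals, since the integrals
    may a priori diverge. The budget condition makes every budget finite, which reduces the
    conclusion to linear arithmetic over the reals. *)

Section Smooth.
Variable R : realType.
Implicit Types V W : normedModType R.

Lemma iter_derive_rcons V (s : seq V) v (f : V -> R) :
  iter_derive (rcons s v) f = iter_derive s ('D_v f).
Proof. by elim: s => //= w s ->. Qed.

Lemma smooth_continuous V (f : V -> R) : smooth f -> continuous f.
Proof. by move=> /(_ [::])[]. Qed.

Lemma smooth_derivable V (f : V -> R) (sf : smooth f) x v : derivable f x v.
Proof. by have [_ /(_ x v)] := sf [::]. Qed.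
Arguments smooth_derivable {V f} sf x v.

Lemma smooth_derive V (f : V -> R) v : smooth f -> smooth ('D_v f).
Proof. by move=> sf s; rewrite -iter_derive_rcons; exact: sf. Qed.

(** The coinductive principle for smoothness: a class stable under directional derivatives replaces
    an induction over lists of directions. The list is taken apart from its end because
    [iter_derive] differentiates first along its last entry. *)
Lemma smooth_ind V (P : (V -> R) -> Prop) :
  (forall f, P f -> continuous f /\ forall x v, derivable f x v) ->
  (forall f v, P f -> P ('D_v f)) -> forall f, P f -> smooth f.
Proof.
move=> P1 P2 f Pf s; elim/last_ind: s f Pf => [|s v IH] f Pf; first exact: P1.
by rewrite iter_derive_rcons; apply: IH; exact: P2.
Qed.
Arguments smooth_ind {V} P _ _ f _.

Lemma smooth_cst V (c : R) : smooth (cst c : V -> R).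
Proof.
apply: (smooth_ind (fun f => exists c, f = cst c)); last by exists c.
  by move=> _ [k ->]; split => [x|x v]; [exact: cvg_cst|exact: derivable_cst].
by move=> _ v [k ->]; exists 0; apply/funext => x; rewrite derive_cst.
Qed.

Lemma derive_addE V (f g : V -> R) v : smooth f -> smooth g ->
  'D_v (f \+ g) = 'D_v f \+ 'D_v g.
Proof.
by move=> sf sg; apply/funext => x; apply: deriveD; exact: smooth_derivable.
Qed.

Lemma derive_mulE V (f g : V -> R) v : smooth f -> smooth g ->
  'D_v (f \* g) = (f \* 'D_v g) \+ ('D_v f \* g).
Proof.
move=> sf sg; apply/funext => x.
rewrite (deriveM (smooth_derivable sf x v) (smooth_derivable sg x v)) /=.
by rewrite /GRing.scale /= (mulrC (g x)).
Qed.

(** By the Leibniz rule, products of smooth functions are not stable under differentiation, but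
    finite sums of such products are. This is the class given to [smooth_ind]. *)
Inductive sum_of_smooth_products V : (V -> R) -> Prop :=
| smooth_product f g :
    smooth f -> smooth g -> sum_of_smooth_products (f \* g)
| sum_smooth_products f g :
    sum_of_smooth_products f -> sum_of_smooth_products g ->
    sum_of_smooth_products (f \+ g).

Lemma sum_of_smooth_products_smooth V (f : V -> R) :
  sum_of_smooth_products f -> smooth f.
Proof.
have P1 (h : V -> R) : sum_of_smooth_products h ->
    continuous h /\ forall x v, derivable h x v.
  elim=> {h} [a b sa sb|a b _ [ca da] _ [cb db]].
    split => [x|x v]; first by apply: continuousM; exact: smooth_continuous.
    by apply: derivableM; exact: smooth_derivable.
  split => [x|x v]; first by apply: continuousD; [exact: ca|exact: cb].
  by apply: derivableD; [exact: da|exact: db].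
suff P2 (h : V -> R) v : sum_of_smooth_products h -> sum_of_smooth_products ('D_v h).
  move=> pf; exact: (smooth_ind _ P1 P2 f pf).
elim=> {h} [a b sa sb|a b pa IHa pb IHb].
  rewrite (derive_mulE v sa sb).
  exact: (sum_smooth_products (smooth_product sa (smooth_derive v sb))
                              (smooth_product (smooth_derive v sa) sb)).
suff -> : 'D_v (a \+ b) = 'D_v a \+ 'D_v b by exact: sum_smooth_products.
apply/funext => x; apply: deriveD; first by have [_] := P1 _ pa.
by have [_] := P1 _ pb.
Qed.

Lemma smoothM V (f g : V -> R) : smooth f -> smooth g -> smooth (f \* g).
Proof.
by move=> sf sg; apply: sum_of_smooth_products_smooth; exact: smooth_product.
Qed.

Lemma smoothD V (f g : V -> R) : smooth f -> smooth g -> smooth (f \+ g).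
Proof.
move=> sf sg; apply: sum_of_smooth_products_smooth.
have -> : f \+ g = (cst 1 \* f) \+ (cst 1 \* g).
  by apply/funext => x /=; rewrite !mul1r.
exact: (sum_smooth_products (smooth_product (smooth_cst 1) sf)
                            (smooth_product (smooth_cst 1) sg)).
Qed.

Lemma smooth_sum V n (f : 'I_n -> V -> R) :
  (forall i, smooth (f i)) -> smooth (fun x => \sum_(i < n) f i x).
Proof.
elim: n f => [|n IH] f sf.
  have -> : (fun x => \sum_(i < 0) f i x) = cst 0.
    by apply/funext => x; rewrite big_ord0.
  exact: smooth_cst.
have -> : (fun x => \sum_(i < n.+1) f i x) =
    f ord0 \+ (fun x => \sum_(i < n) f (lift ord0 i) x).
  by apply/funext => x; rewrite big_ord_recl.
by apply: smoothD; [exact: sf|apply: IH => i; exact: sf].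
Qed.

(** The difference quotients of [f \o A] at x along v are literally those of f at [A x] along [L v].
    No chain rule is involved, hence no total differentiability of f. *)
Lemma derive_affine V W (A : W -> V) (L : W -> V) (f : V -> R) x v :
  (forall h : R, A (h *: v + x) = h *: L v + A x) ->
  derivable (f \o A) x v = derivable f (A x) (L v) /\
  'D_v (f \o A) x = 'D_(L v) f (A x).
Proof.
move=> AL; rewrite /derivable /derive.
suff -> : (fun h : R => h^-1 *: (((f \o A) \o shift x) (h *: v) - (f \o A) x)) =
          (fun h : R => h^-1 *: ((f \o shift (A x)) (h *: L v) - f (A x))) by [].
by apply/funext => h /=; rewrite AL.
Qed.

Lemma smooth_affine V W (A : W -> V) (L : W -> V) (f : V -> R) :
  continuous A -> (forall x v (h : R), A (h *: v + x) = h *: L v + A x) ->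
  smooth f -> smooth (f \o A).
Proof.
move=> cA AL sf; apply: (smooth_ind
  (fun h => exists2 g, smooth g & h = g \o A)); last by exists f.
  move=> _ [g sg ->]; split => [x|x v].
    by apply: continuous_comp; [exact: cA|exact: smooth_continuous].
  have [-> _] := derive_affine g (AL x v); exact: smooth_derivable.
move=> _ v [g sg ->]; exists ('D_(L v) g); first exact: smooth_derive.
by apply/funext => x; have [_ ->] := derive_affine g (AL x v).
Qed.

Lemma compact_closed_normed V (K : set V) : compact K -> closed K.
Proof. by apply: compact_closed; exact: norm_hausdorff. Qed.

Lemma derive_eq0_nbhs V (f : V -> R) v x :
  (\forall y \near x, f y = 0) -> 'D_v f x = 0.
Proof. by move=> f0; rewrite (@near_eq_derive _ _ _ f (cst 0)) // derive_cst. Qed.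

Lemma near_notin_compact V (K : set V) x : compact K -> ~ K x ->
  \forall y \near x, ~ K y.
Proof.
move=> cK nKx; apply: (open_nbhs_nbhs (conj _ nKx)).
by rewrite openC; exact: compact_closed_normed.
Qed.

Lemma test_fun_derive V (A : set V) (f : V -> R) v :
  test_fun A f -> test_fun A ('D_v f).
Proof.
move=> [sf [K [cK KA fK]]]; split; first exact: smooth_derive.
exists K; split => // x nKx; apply: derive_eq0_nbhs.
by apply: filterS (near_notin_compact cK nKx) => y; exact: fK.
Qed.

Lemma test_funMl V (A : set V) (f g : V -> R) :
  smooth f -> test_fun A g -> test_fun A (f \* g).
Proof.
move=> sf [sg [K [cK KA gK]]]; split; first exact: smoothM.
by exists K; split => // x nKx /=; rewrite gK // mulr0.
Qed.

Lemma test_fun_smooth V (A : set V) (f : V -> R) : test_fun A f -> smooth f.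
Proof. by case. Qed.

Lemma test_fun_out V (A : set V) (f : V -> R) x : test_fun A f -> ~ A x -> f x = 0.
Proof. by move=> [_ [K [_ KA fK]]] nAx; apply: fK => /KA. Qed.

End Smooth.
Arguments smooth_derivable {R V f} sf x v.

(** * The second derivative test on the line *)

Section DerivativeTest.
Variable R : realType.

Lemma derive_gt0_right (g : R -> R) (d : R) : is_derive (0 : R) 1 g d -> 0 < d ->
  exists2 r, 0 < r & forall s, 0 < s < r -> g 0 < g s.
Proof.
move=> [D' Dd] d0.
have : \forall h \near 0^', 0 < h^-1 *: (g (h *: 1 + 0) - g 0).
  by rewrite -Dd in d0; apply: (cvgr_gt _ D').
move=> /nbhs_ballP[r /= r0 rg]; exists r => // s /andP[s0 sr].
have := rg s; rewrite /ball /= sub0r normrN gtr0_norm // => /(_ sr).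
move=> /(_ (lt0r_neq0 s0)); rewrite addr0 /GRing.scale /= mulr1.
by rewrite pmulr_rgt0 ?invr_gt0 // subr_gt0.
Qed.

(** If d were positive, g' would be positive just to the right of its zero at 0, and the mean value
    theorem would make g exceed [g 0] there. *)
Lemma local_max_second_derive (g g' : R -> R) (d e : R) : 0 < e ->
  (forall s : R, is_derive s 1 g (g' s)) -> is_derive (0 : R) 1 g' d ->
  (forall s, `|s| < e -> g s <= g 0) -> g' 0 = 0 /\ d <= 0.
Proof.
move=> e0 dg dg' gmax.
have g'0 : g' 0 = 0.
  have : is_derive (0 : R) 1 g 0.
    apply: (@derive1_at_max R g (- e) e 0); first by lra.
    - by move=> t _; have [] := dg t.
    - by rewrite in_itv /= oppr_lt0 e0.
    - by move=> t; rewrite in_itv /= => te; apply: gmax; rewrite ltr_norml.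
  by move=> h; rewrite -(derive_val (is_derive := dg 0)) (derive_val (is_derive := h)).
split => //; rewrite leNgt; apply/negP => d0.
have [r r0 rg] := derive_gt0_right dg' d0.
pose s := Num.min r e / 2.
have s0 : 0 < s by rewrite divr_gt0 // lt_min r0.
have [sr se] : s < r /\ s < e.
  have : s < Num.min r e by rewrite /s ltr_pdivrMr // ltr_pMr ?lt_min ?r0 //; lra.
  by rewrite lt_min => /andP.
have [c cs gE] : exists2 c, c \in `]0, s[ & g s - g 0 = g' c * (s - 0).
  apply: MVT => //; apply: derivable_within_continuous => x _.
  by have [] := dg x.
have {}gs : g s <= g 0 by apply: gmax; rewrite gtr0_norm.
move: cs; rewrite in_itv /= => /andP[c0 cs].
have gc : 0 < g' c by rewrite -g'0 rg // c0 (lt_trans cs).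
have : 0 < g' c * (s - 0) by rewrite subr0 mulr_gt0.
by rewrite -gE subr_gt0 ltNge gs.
Qed.
End DerivativeTest.

(** * Coordinates and the maximum principle *)

Section Geometry.
Variable R : realType.
Local Notation X := (space3 R).
Local Notation ST := (spacetime R).
Implicit Types (x y : X) (i j : 'I_3).

Lemma crdD x y i : crd (x + y) i = crd x i + crd y i.
Proof. by rewrite /crd; case: i => [[|[|[|//]]] ?]. Qed.

Lemma crdZ (a : R) x i : crd (a *: x) i = a * crd x i.
Proof. by rewrite /crd; case: i => [[|[|[|//]]] ?]. Qed.

Lemma crdN x i : crd (- x) i = - crd x i.
Proof. by rewrite /crd; case: i => [[|[|[|//]]] ?]. Qed.

Lemma crd_evec i j : crd (evec R j) i = (i == j)%:R.
Proof.
rewrite /crd /evec -val_eqE.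
by case: i j => [[|[|[|//]]] ?] [[|[|[|//]]] ?].
Qed.

Lemma crd0 i : crd (0 : X) i = 0.
Proof. by rewrite /crd; case: i => [[|[|[|//]]] ?]. Qed.

Lemma crd_inj x y : (forall i, crd x i = crd y i) -> x = y.
Proof.
case: x y => [[a b] c] [[a' b'] c'] xy.
have := xy (Ordinal (isT : (0 < 3)%N)); have := xy (Ordinal (isT : (1 < 3)%N)).
by have := xy (Ordinal (isT : (2 < 3)%N)); rewrite /crd /= => -> -> ->.
Qed.

Lemma crd_continuous i : continuous (fun x : X => crd x i).
Proof.
move=> x; rewrite /crd; case: i => [[|[|[|//]]] ?] /=.
- exact: (cvg_comp _ _ (@cvg_fst _ _ _ _ _) (@cvg_fst _ _ _ _ _)).
- exact: (cvg_comp _ _ (@cvg_fst _ _ _ _ _) (@cvg_snd _ _ _ _ _)).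
- exact: (@cvg_snd _ _ _ _ _).
Qed.

Lemma BalE (r : R) x : 0 < r -> Bal r x <-> \sum_(i < 3) crd x i ^+ 2 < r ^+ 2.
Proof.
move=> r0; rewrite /Bal /= /enorm /vnorm -{1}(ger0_norm (ltW r0)) -sqrtr_sqr.
by rewrite ltr_sqrt // exprn_gt0.
Qed.

Lemma Bal_crd (r : R) x i : 0 < r -> Bal r x -> `|crd x i| < r.
Proof.
move=> r0 /(BalE x r0) xr; rewrite -(ltr_pXn2r (n:=2)) ?nnegrE // ?(ltW r0) //.
apply: le_lt_trans xr; rewrite real_normK ?num_real //.
by rewrite (bigD1 i) //= lerDl sumr_ge0 // => j _; rewrite sqr_ge0.
Qed.

Definition box (a : R) : set X := `[- a, a] `*` `[- a, a] `*` `[- a, a].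

Lemma boxP (a : R) x : box a x <-> forall i, `|crd x i| <= a.
Proof.
rewrite /box /= !in_itv /= -!ler_norml; split => [[[x0 x1] x2] [[|[|[|//]]] ?]|xa] //.
split; [split|].
- exact: (xa (Ordinal (isT : (0 < 3)%N))).
- exact: (xa (Ordinal (isT : (1 < 3)%N))).
- exact: (xa (Ordinal (isT : (2 < 3)%N))).
Qed.

Lemma compact_box (a : R) : compact (box a).
Proof. by apply: compact_setX; [apply: compact_setX|]; exact: segment_compact. Qed.

Lemma is_derive_line (h : X -> R) (v x : X) (s : R) : smooth h ->
  is_derive s 1 (fun s : R => h (s *: v + x)) ('D_v h (s *: v + x)).
Proof.
move=> sh.
have [|] := @derive_affine R X R (fun s : R => s *: v + x)
  (fun w : R => w *: v) h s 1.
  by move=> k; rewrite scalerDl scalerA -addrA.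
rewrite scale1r => dE DE.
apply: DeriveDef; last exact: DE.
by have := smooth_derivable sh (s *: v + x) v; rewrite -dE.
Qed.

End Geometry.

Section MaximumPrinciple.
Variable R : realType.
Local Notation X := (space3 R).
Implicit Types (x y : X) (i j : 'I_3).

Definition lap3 (h : X -> R) x : R := \sum_(i < 3) 'D_(evec R i) ('D_(evec R i) h) x.

(* A bump equal to 1 at the center forces |lap3 h| >= 6: compare h with
   F |x|^2 / 6 on the unit ball. *)
Lemma bump_laplacian_ge (h : X -> R) (F : R) : smooth h ->
  (forall x, ~ Bal 1 x -> h x = 0) -> h 0 = 1 ->
  (forall x, `|lap3 h x| <= F) -> 6 <= F.
Proof.
move=> sh h0 h1 hF; rewrite leNgt; apply/negP => F6.
(* G lies strictly between F and 6. Being below 6, it makes w smaller on the unit sphere than at 0,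
   so the maximum is interior; being above F, it makes the Laplacian of w, which is at least G - F,
   positive there. *)
pose G := (F + 6) / 2.
have [FG G6] : F < G /\ G < 6 by rewrite /G; split; lra.
have F0 : 0 <= F by apply: le_trans (hF 0).
pose q x : R := \sum_(i < 3) crd x i ^+ 2.
have q0 : q 0 = 0 by rewrite /q big1 // => i _; rewrite crd0 expr0n.
pose w x := h x + G / 6 * q x.
have cq : continuous q.
  have -> : q = (fun x => crd x ord0 ^+ 2 + (crd x (lift ord0 ord0) ^+ 2
      + crd x (lift ord0 (lift ord0 ord0)) ^+ 2)).
    by apply/funext => x; rewrite /q !big_ord_recl big_ord0 addr0.
  have c2 i : continuous (fun x => crd x i ^+ 2).
    by move=> x; apply: cvgM; exact: crd_continuous.
  by move=> x; apply: cvgD; [|apply: cvgD]; exact: c2.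
have cw : continuous w.
  move=> x; apply: cvgD; first exact: smooth_continuous.
  by apply: cvgM; [exact: cvg_cst|exact: cq].
pose A : set X := [set x | q x <= 1].
have A0 : A 0 by rewrite /A /= q0.
have cA : compact A.
  apply: (@subclosed_compact _ A (@box R 1)); last 2 first.
  - exact: compact_box.
  - move=> x Ax; apply/boxP => i; rewrite -(@ler_pXn2r _ 2) ?nnegrE //.
    rewrite expr1n real_normK ?num_real //; apply: le_trans Ax.
    by rewrite /q (bigD1 i) //= lerDl sumr_ge0 // => k _; rewrite sqr_ge0.
  - exact: (closed_comp (fun x _ => cq x) (@closed_le R 1)).
have [x [Ax xmax]] : exists x, A x /\ forall y, A y -> w y <= w x.
  have [|x Ax xmax] := @compact_EVT_max X R w A (ex_intro _ 0 A0) cA.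
    exact: continuous_subspaceT.
  by exists x; split; [rewrite inE in Ax|move=> y Ay; apply: xmax; rewrite inE].
have qx1 : q x < 1.
  rewrite lt_neqAle Ax andbT; apply/negP => /eqP qx.
  have nB : ~ Bal 1 x by move/(BalE x ltr01); rewrite -/(q x) qx expr1n ltxx.
  have := xmax 0 A0; rewrite /w q0 h1 qx (h0 _ nB); lra.
have key i : 'D_(evec R i) ('D_(evec R i) h) x + G / 3 <= 0.
  pose g s := w (s *: evec R i + x).
  have qE s : q (s *: evec R i + x) = q x + 2 * s * crd x i + s ^+ 2.
    rewrite /q (bigD1 i) //= [in RHS](bigD1 i) //= crdD crdZ crd_evec eqxx mulr1.
    rewrite (eq_bigr (fun k => crd x k ^+ 2)); first by ring.
    by move=> k ki; rewrite crdD crdZ crd_evec (negbTE ki) mulr0 add0r.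
  pose g' s := 'D_(evec R i) h (s *: evec R i + x) + G / 6 * (2 * crd x i + 2 * s).
  have gE : g = (fun s => h (s *: evec R i + x)) \+
                (fun s => G / 6 * (q x + 2 * s * crd x i + s ^+ 2)).
    by apply/funext => s; rewrite /g /w qE.
  have dg s : is_derive (s : R) 1 g (g' s).
    rewrite gE /g'; have ? := is_derive_line (evec R i) x s sh.
    apply: is_derive_eq; rewrite /GRing.scale /=; ring.
  have dg' : is_derive (0 : R) 1 g' ('D_(evec R i) ('D_(evec R i) h) x + G / 3).
    have := is_derive_line (evec R i) x 0 (smooth_derive (evec R i) sh).
    rewrite scale0r add0r => ?.
    by rewrite /g'; apply: is_derive_eq; rewrite /GRing.scale /=; field.
  have xi : `|crd x i| <= 1.
    apply/ltW/(@Bal_crd R 1 x i ltr01); apply/(BalE x ltr01).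
    by rewrite expr1n.
  (* For |s| below this radius, q grows by at most 2 |s| + s^2 <= 3 |s| < 1 - q x, so the segment
     stays in A. *)
  have e0 : 0 < (1 - q x) / 4 by lra.
  have qx0 : 0 <= q x by apply: sumr_ge0 => k _; rewrite sqr_ge0.
  have gmax s : `|s| < (1 - q x) / 4 -> g s <= g 0.
    move=> se; rewrite /g scale0r add0r; apply: xmax; rewrite /A /= qE.
    have : s * crd x i <= `|s|.
      by apply: le_trans (ler_norm _) _; rewrite normrM ler_piMr.
    have : s ^+ 2 <= `|s| by rewrite -real_normK ?num_real // expr2 ler_piMr //; lra.
    by lra.
  by have [] := local_max_second_derive e0 dg dg' gmax.
have : \sum_(i < 3) ('D_(evec R i) ('D_(evec R i) h) x + G / 3) <= 0.
  by apply: sumr_le0 => i _; exact: key.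
rewrite big_split /= -/(lap3 h x) sumr_const card_ord.
have := hF x; rewrite ler_norml => /andP[]; move: (lap3 h x) => l; lra.
Qed.


(** Here f1 and f2 are h along the lines followed by the two points x + s e and x - s e while s
    moves at speed b; the quadratic in s is the penalty of the doubling argument. *)
Lemma doubling_second_derive (f1 f2 f1' f2' : R -> R) (d1 d2 sg c s b e : R) :
  0 < e ->
  (forall t : R, is_derive t 1 f1 (f1' t)) -> is_derive (0 : R) 1 f1' d1 ->
  (forall t : R, is_derive t 1 f2 (f2' t)) -> is_derive (0 : R) 1 f2' d2 ->
  let g t := sg * (f1 t - f2 t)
             + (c ^+ 2 * (s + b * t) ^+ 2 - 2 * c * (s + b * t)) in
  (forall t, `|t| < e -> g t <= g 0) ->
  sg * (d1 - d2) + 2 * c ^+ 2 * b ^+ 2 <= 0.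
Proof.
move=> e0 df1 df1' df2 df2' g gmax.
pose g' t := sg * (f1' t - f2' t) + (2 * c ^+ 2 * b * (s + b * t) - 2 * c * b).
have dg t : is_derive (t : R) 1 g (g' t).
  by apply: is_derive_eq; rewrite /g' /GRing.scale /=; ring.
have dg' : is_derive (0 : R) 1 g' (sg * (d1 - d2) + 2 * c ^+ 2 * b ^+ 2).
  by apply: is_derive_eq; rewrite /GRing.scale /=; ring.
by have [] := local_max_second_derive e0 dg dg' gmax.
Qed.

(** Speed 1/2 moves only the first point and speed -1/2 only the second, each contributing c^2 / 2.
    The vanishing numbers u and v are second derivatives along the zero vector. *)
Lemma doubling_split (sg c a b u v : R) : u = 0 -> v = 0 ->
  sg * (a - u) + 2 * c ^+ 2 * 2^-1 ^+ 2 <= 0 ->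
  sg * (v - b) + 2 * c ^+ 2 * (- 2^-1) ^+ 2 <= 0 ->
  sg * (a - b) + c ^+ 2 * 1%:R <= 0.
Proof. by move=> -> ->; rewrite sqrrN; lra. Qed.

Lemma sum_doubling_le (sg c : R) j (a b : 'I_3 -> R) :
  (forall i, sg * (a i - b i) + c ^+ 2 * (i == j)%:R <= 0) ->
  sg * (\sum_i a i - \sum_i b i) + c ^+ 2 <= 0.
Proof.
move=> ab; have := sumr_le0 (P := predT) (index_enum _) (fun i _ => ab i).
rewrite big_split /= -mulr_sumr sumrB -mulr_sumr.
have -> : \sum_i (i == j)%:R = 1 :> R.
  by rewrite (bigD1 j) //= eqxx big1 ?addr0 // => i /negbTE ->.
by rewrite mulr1.
Qed.

(* Doubling of variables: h(x + s e) - h(x - s e) is dominated by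
   2 c s - c^2 s^2 as soon as c^2 > 2 F >= 2 |lap3 h|. *)
Lemma bump_difference_le (h : X -> R) (F c sg : R) j : smooth h ->
  (forall x, ~ Bal 1 x -> h x = 0) -> (forall x, 0 <= h x <= 1) ->
  (forall x, `|lap3 h x| <= F) -> 1 <= c -> 2 * F < c ^+ 2 -> `|sg| = 1 ->
  forall x s, 0 <= s <= c^-1 ->
    sg * (h (s *: evec R j + x) - h (- s *: evec R j + x))
      <= 2 * c * s - c ^+ 2 * s ^+ 2.
Proof.
move=> sh h0 h01 hF c1 cF sg1.
have c0 : 0 < c by lra.
pose e := evec R j.
(* The claim is that Psi is nonpositive. A positive maximum over K would have s in the interior of
   its range, where the second order conditions contradict c^2 > 2 F. *)
pose Psi (z : X * R) := sg * (h (z.2 *: e + z.1) - h (- z.2 *: e + z.1))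
  + (c ^+ 2 * z.2 ^+ 2 - 2 * c * z.2).
pose K : set (X * R) := box 2 `*` `[0, c^-1].
have cK : compact K by apply: compact_setX; [exact: compact_box|exact: segment_compact].
have cP : continuous Psi.
  have ce (k : R) : continuous (fun z : X * R => (k * z.2) *: e + z.1).
    move=> z; apply: cvgD; last exact: cvg_fst.
    by apply: cvgZr_tmp; apply: cvgM; [exact: cvg_cst|exact: cvg_snd].
  have ch (k : R) : continuous (fun z : X * R => h ((k * z.2) *: e + z.1)).
    move=> z; apply: (@continuous_comp _ _ _ (fun z : X * R => (k * z.2) *: e + z.1) h).
      exact: ce.
    exact: smooth_continuous.
  have -> : Psi = (fun z => sg * (h ((1 * z.2) *: e + z.1) - h ((- 1 * z.2) *: e + z.1))
      + (c ^+ 2 * (z.2 * z.2) - 2 * c * z.2)).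
    by apply/funext => z; rewrite mul1r mulN1r -expr2.
  move=> z; apply: cvgD.
    by apply: cvgM; [exact: cvg_cst|apply: cvgB; exact: ch].
  by apply: cvgB; apply: cvgM; (exact: cvg_cst || exact: cvg_snd ||
    (apply: cvgM; exact: cvg_snd)).
have quad_le0 s : 0 <= s <= c^-1 -> c ^+ 2 * s ^+ 2 - 2 * c * s <= 0.
  move=> /andP[s0 sc]; have cs1 : c * s <= 1 by rewrite mulrC -ler_pdivlMr // mul1r.
  have cs0 : 0 <= c * s by rewrite mulr_ge0 // ltW.
  have : (c * s) ^+ 2 <= c * s by rewrite expr2 ler_piMr.
  by rewrite exprMn; lra.
(* Since s <= 1, both x + s e and x - s e are outside the unit ball when x leaves the box, and only
   the penalty remains. A positive maximum over K is therefore global in x. *)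
have outside x s : 0 <= s <= c^-1 -> ~ box 2 x -> Psi (x, s) <= 0.
  move=> sc nB; have [s0 s1] : 0 <= s /\ s <= 1.
    move: sc => /andP[s0 sc]; split => //; apply: (le_trans sc).
    by rewrite invf_le1.
  have out t : `|t| <= 1 -> h (t *: e + x) = 0.
    move=> t1; apply: h0 => B; apply: nB; apply/boxP => i.
    have := Bal_crd i ltr01 B; rewrite crdD crdZ crd_evec => Bi.
    have -> : crd x i = (t * (i == j)%:R + crd x i) - t * (i == j)%:R by ring.
    apply: le_trans (ler_normB _ _) _.
    have : `|t * (i == j)%:R| <= 1.
      by rewrite normrM normr_nat; case: (i == j) => //=; rewrite ?mulr1 ?mulr0.
    lra.
  rewrite /Psi /= !out ?normrN ?ger0_norm // subrr mulr0 add0r; exact: quad_le0.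
suff Psi_le0 z : K z -> Psi z <= 0.
  move=> x s sc; have [Bx|nBx] := pselect (box 2 x).
    have := Psi_le0 (x, s) (conj Bx sc); rewrite /Psi /=; lra.
  have := outside x s sc nBx; rewrite /Psi /=; lra.
have Kne : K !=set0.
  exists (0, 0); split => /=.
    by apply/boxP => i; rewrite crd0 normr0.
  by rewrite in_itv /= lexx invr_ge0 ltW.
have [[x s]] := compact_EVT_max Kne cK (continuous_subspaceT cP).
rewrite inE => -[/= Bx]; rewrite in_itv /= => sc zmax Kz.
apply: le_trans (zmax z _) _; first by rewrite inE.
rewrite leNgt; apply/negP => Psi0.
have Pmax y t : 0 <= t <= c^-1 -> Psi (y, t) <= Psi (x, s).
  move=> tc; have [By|nBy] := pselect (box 2 y); last first.
    exact: le_trans (outside _ _ tc nBy) (ltW Psi0).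
  by apply: zmax; rewrite inE.
(* Psi vanishes at s = 0, and at s = 1/c the penalty is -1, which outweighs a difference of two
   values in [0, 1]. So s is interior. *)
have s0 : 0 < s.
  rewrite lt_neqAle (andP sc).1 andbT; apply/negP => /eqP s0; move: Psi0.
  rewrite /Psi -s0 /= oppr0 subrr mulr0 expr0n /= !mulr0 subrr addr0; lra.
have sc1 : s < c^-1.
  rewrite lt_neqAle (andP sc).2 andbT; apply/negP => /eqP s1; move: Psi0.
  rewrite /Psi s1 /= exprVn mulfV ?expf_neq0 ?gt_eqF // -mulrA mulfV ?gt_eqF //.
  set a := h _; set b := h _.
  have a01 : 0 <= a <= 1 by exact: h01.
  have b01 : 0 <= b <= 1 by exact: h01.
  have : sg * (a - b) <= 1.
    apply: le_trans (ler_norm _) _; rewrite normrM sg1 mul1r ler_norml; lra.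
  lra.
pose d := Num.min s (c^-1 - s).
have d0 : 0 < d by rewrite lt_min s0 subr_gt0.
pose P := s *: e + x; pose Q := - s *: e + x.
(* Let x move with velocity v and s with velocity b. The two points then move with velocities v + b
   e and v - b e, and the second derivative of Psi along this motion is nonpositive. *)
have test (v p q : X) (b : R) : `|b| <= 1 -> p = v + b *: e -> q = v - b *: e ->
  sg * ('D_p ('D_p h) P - 'D_q ('D_q h) Q) + 2 * c ^+ 2 * b ^+ 2 <= 0.
  move=> b1 pE qE.
  have dP := is_derive_line p P 0 (smooth_derive p sh).
  have dQ := is_derive_line q Q 0 (smooth_derive q sh).
  rewrite scale0r add0r in dP; rewrite scale0r add0r in dQ.
  apply: (doubling_second_derive (s := s) d0 (fun t => is_derive_line p P t sh) dP
    (fun t => is_derive_line q Q t sh) dQ) => tau taud.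
  rewrite mulr0 !addr0 !scale0r !add0r.
  have bt : `|b * tau| < d.
    by rewrite normrM; apply: le_lt_trans taud; rewrite ler_piMl.
  have := Pmax (tau *: v + x) (s + b * tau).
  rewrite /Psi /= -/P -/Q.
  have -> : (s + b * tau) *: e + (tau *: v + x) = tau *: p + P.
    by apply: crd_inj => i; rewrite /P pE !(crdD, crdZ); ring.
  have -> : - (s + b * tau) *: e + (tau *: v + x) = tau *: q + Q.
    by apply: crd_inj => i; rewrite /Q qE !(crdD, crdZ, crdN); ring.
  apply; move: bt; rewrite lt_min !ltr_norml => /andP[/andP[? ?] /andP[? ?]]; lra.
(* For i different from j both points are translated together with s fixed; for i = j one point
   moves at a time. *)
have diag i : sg * ('D_(evec R i) ('D_(evec R i) h) P - 'D_(evec R i) ('D_(evec R i) h) Q)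
   + c ^+ 2 * (i == j)%:R <= 0.
  have [->|ij] := eqVneq i j; last first.
    have := test (evec R i) (evec R i) (evec R i) 0.
    rewrite normr0 ler01 scale0r subr0 addr0 expr0n /= !mulr0.
    by move=> /(_ isT erefl erefl).
  have half : 2^-1 *: e + 2^-1 *: e = e.
    by rewrite -scalerDl (_ : 2^-1 + 2^-1 = 1) ?scale1r //; lra.
  have n2 : `|2^-1 : R| <= 1 by rewrite ger0_norm; lra.
  have n2' : `|- 2^-1 : R| <= 1 by rewrite normrN.
  have t1 := test (2^-1 *: e) e 0 2^-1 n2 (esym half) (esym (subrr _)).
  have [z1 z2] : e = 2^-1 *: e - - 2^-1 *: e /\ 0 = 2^-1 *: e + - 2^-1 *: e.
    by rewrite scaleNr opprK half subrr.
  have t2 := test (2^-1 *: e) 0 e (- 2^-1) n2' z2 z1.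
  have d01 : 'D_0 ('D_0 h) P = 0 by exact: derive0.
  have d02 : 'D_0 ('D_0 h) Q = 0 by exact: derive0.
  exact: doubling_split d02 d01 t1 t2.
have l2 : sg * (lap3 h P - lap3 h Q) + c ^+ 2 <= 0 := sum_doubling_le diag.
have : `|sg * (lap3 h P - lap3 h Q)| <= 2 * F.
  rewrite normrM sg1 mul1r mulr_natl mulr2n; apply: le_trans (ler_normB _ _) _.
  by apply: lerD; exact: hF.
move: (sg * _) l2 => l l2 /ler_normlP[+ _]; rewrite lerNl => l1.
have := le_trans (lerD l1 (lexx (c ^+ 2))) l2.
by rewrite addrC subr_le0 leNgt cF.
Qed.

(** Each partial derivative d satisfies d^2 <= 2 F. Otherwise the parabola of [bump_difference_le]
    for some c with 2 F < c^2 < d^2 would start with slope 2 c, below the slope 2 |d| of the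
    difference that it dominates. *)
Lemma bump_gradient_le (h : X -> R) (F : R) x : smooth h ->
  (forall x, ~ Bal 1 x -> h x = 0) -> (forall x, 0 <= h x <= 1) -> 6 <= F ->
  (forall x, `|lap3 h x| <= F) ->
  vnorm (fun j => 'D_(evec R j) h x) <= F.
Proof.
move=> sh h0 h01 F6 hF.
have d2 j : ('D_(evec R j) h x) ^+ 2 <= 2 * F.
  set d := 'D_(evec R j) h x; rewrite leNgt; apply/negP => dF.
  (* c^2 is the midpoint of 2 F and d^2, and 6 <= F gives c >= 1. *)
  pose c := Num.sqrt ((d ^+ 2 + 2 * F) / 2).
  have cE : c ^+ 2 = (d ^+ 2 + 2 * F) / 2 by rewrite sqr_sqrtr //; lra.
  have c0 : 0 <= c by exact: sqrtr_ge0.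
  have c1 : 1 <= c by rewrite -(@ler_pXn2r _ 2) ?nnegrE // cE expr1n; lra.
  have cF : 2 * F < c ^+ 2 by rewrite cE; lra.
  have cd : c < `|d|.
    by rewrite -(@ltr_pXn2r _ 2) ?nnegrE // real_normK ?num_real // cE; lra.
  have dn0 : d != 0 by rewrite -normr_gt0; apply: le_lt_trans cd.
  have diff := bump_difference_le j sh h0 h01 hF c1 cF
    (_ : `|Num.sg d| = 1) x.
  pose g s := Num.sg d * (h (s *: evec R j + x) - h (- s *: evec R j + x)) - 2 * c * s.
  have dg : is_derive (0 : R) 1 g (2 * `|d| - 2 * c).
    have d1 := is_derive_line (evec R j) x 0 sh.
    rewrite scale0r add0r -/d in d1.
    have d1N : is_derive (- 0 : R) 1 (fun s => h (s *: evec R j + x)) d by rewrite oppr0.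
    have d2 := is_derive1_comp d1N (is_deriveN (is_derive_id (0 : R) 1)).
    apply: is_derive_eq; rewrite /GRing.scale /=.
    have -> : `|d| = Num.sg d * d by rewrite normrEsg.
    ring.
  have [|r r0 rg] := derive_gt0_right dg; first by lra.
  pose s := Num.min (r / 2) c^-1.
  have s0 : 0 < s by rewrite lt_min divr_gt0 //= invr_gt0; lra.
  have sr : s < r by rewrite gt_min; apply/orP; left; lra.
  have := rg s; rewrite s0 sr => /(_ isT).
  rewrite /g oppr0 subrr !mulr0 subr0.
  have := diff _ s; rewrite normr_sg dn0 => /(_ erefl).
  rewrite (ltW s0) /s ge_min lexx orbT -/s => /(_ isT).
  have : 0 <= c ^+ 2 * s ^+ 2 by rewrite mulr_ge0 // sqr_ge0.
  lra.
rewrite /vnorm -(ger0_norm (_ : 0 <= F)); last by lra.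
rewrite -sqrtr_sqr ler_sqrt ?sqr_ge0 //.
apply: (@le_trans _ _ (\sum_(i < 3) 2 * F)); first by apply: ler_sum => i _; exact: d2.
rewrite sumr_const card_ord; have : 0 <= (F - 6) * F by rewrite mulr_ge0; lra.
rewrite mulrBl -expr2; lra.
Qed.

End MaximumPrinciple.

(** * Borel sets and product measures *)

Section CountableBasis.

(* [M] plays the role of a sigma-algebra containing a countable basis. *)
Definition countable_basis_in (T : topologicalType) (M : set (set T)) : Prop :=
  exists (I : countType) (B : I -> set T), (forall i, M (B i)) /\
    forall x A, nbhs x A -> exists i, B i x /\ B i `<=` A.

Lemma countable_basis_prod (T U : topologicalType) (M : set (set T))
  (N : set (set U)) (P : set (set (T * U))) :
  (forall A B, M A -> N B -> P (A `*` B)) ->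
  countable_basis_in M -> countable_basis_in N -> countable_basis_in P.
Proof.
move=> MNP [I [B [MB bB]]] [J [C [NC bC]]].
exists (I * J)%type, (fun ij => B ij.1 `*` C ij.2); split => [ij|[x y] A].
  exact: MNP.
move=> [[A1 A2] [/= xA1 yA2] AA].
have [i [Bx BA]] := bB _ _ xA1; have [j [Cy CA]] := bC _ _ yA2.
exists (i, j); split => //= -[a b] [/= /BA ? /CA ?]; exact: AA.
Qed.

Lemma countable_basis_real (R : realType) :
  countable_basis_in (T := R) (@measurable _ (measurableTypeR R)).
Proof.
exists (rat * rat)%type, (fun q => `]ratr q.1, ratr q.2[%classic); split => [q|].
  exact: measurable_itv.
move=> x A /nbhs_ballP[e /= e0 xA].
have xl : x - e < x by lra.
have xr : x < x + e by lra.
have [p] := rat_in_itvoo xl; have [q] := rat_in_itvoo xr.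
rewrite !in_itv /= => /andP[xq qe] /andP[ep px]; exists (p, q); split.
  by rewrite /= in_itv /= px.
move=> y /=; rewrite in_itv /= => /andP[py yq]; apply: xA.
by rewrite /ball /= ltr_norml; apply/andP; split; lra.
Qed.

(** [space3] and [spacetime] carry product sigma-algebras, which must be shown to contain the open
    sets of the product topology. An open set is the union of the basis elements inside it; the
    union runs over codes in nat, with the empty set at codes that give no such element. *)
Lemma countable_basis_open (T : topologicalType) (M : set (set T)) :
  (forall F : nat -> set T, (forall n, M (F n)) -> M (\bigcup_n F n)) -> M set0 ->
  countable_basis_in M -> forall A, open A -> M A.
Proof.
move=> Mbig M0 [I [B [MB bB]]] A oA.
pose F n := if (choice.unpickle n : option I) is Some i then
              if pselect (B i `<=` A) then B i else set0 else set0.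
have -> : A = \bigcup_n F n.
  apply/seteqP; split => [x Ax|x [n _]].
    have [i [Bx BA]] := bB x A (open_nbhs_nbhs (conj oA Ax)).
    by exists (choice.pickle i) => //; rewrite /F choice.pickleK; case: pselect.
  by rewrite /F; case: (choice.unpickle n) => // i; case: pselect => // BA /BA.
apply: Mbig => n; rewrite /F; case: (choice.unpickle n) => [i|] //.
by case: (pselect (B i `<=` A)) => BA //; exact: MB.
Qed.

End CountableBasis.

Section SpaceMeasure.
Variable R : realType.
Local Notation X := (space3 R).
Local Notation ST := (spacetime R).

Lemma countable_basis_space3 : countable_basis_in (T := X) (@measurable _ X).
Proof.
have b2 : countable_basis_in (T := (R * R)%type)
    (@measurable _ (measurableTypeR R * measurableTypeR R)%type).
  apply: (countable_basis_prod _ (@countable_basis_real R) (@countable_basis_real R)).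
  by move=> A B; exact: measurableX.
apply: (countable_basis_prod _ b2 (@countable_basis_real R)).
by move=> A B; exact: measurableX.
Qed.

Lemma countable_basis_spacetime : countable_basis_in (T := ST) (@measurable _ ST).
Proof.
apply: (countable_basis_prod _ (@countable_basis_real R) countable_basis_space3).
by move=> A B; exact: measurableX.
Qed.

Lemma open_measurable3 (A : set X) : open A -> measurable A.
Proof.
apply: (countable_basis_open _ _ countable_basis_space3) => //.
exact: bigcupT_measurable.
Qed.

Lemma open_measurable4 (A : set ST) : open A -> measurable A.
Proof.
apply: (countable_basis_open _ _ countable_basis_spacetime) => //.
exact: bigcupT_measurable.
Qed.

Lemma continuous_measurable3 (f : X -> R) : continuous f -> measurable_fun setT f.
Proof.
move=> /continuousP cf; apply: (measurability _ (RGenOpens.measurableE R)).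
move=> _ [_ [a [b ->] <-]]; rewrite setTI; apply: open_measurable3.
exact/cf/interval_open.
Qed.

Lemma continuous_measurable4 (f : ST -> R) : continuous f -> measurable_fun setT f.
Proof.
move=> /continuousP cf; apply: (measurability _ (RGenOpens.measurableE R)).
move=> _ [_ [a [b ->] <-]]; rewrite setTI; apply: open_measurable4.
exact/cf/interval_open.
Qed.

End SpaceMeasure.

(** * Tonelli and Fubini for products of sigma-finite measures *)

Section ProdSf.
Local Open Scope ereal_scope.
Context d1 d2 (R : realType) (T1 : measurableType d1) (T2 : measurableType d2)
  (m1 : {sigma_finite_measure set T1 -> \bar R})
  (m2 : {sigma_finite_measure set T2 -> \bar R}).

Lemma prod_sf_setX A B : measurable A -> measurable B ->
  prod_sf m1 m2 (A `*` B) = m1 A * m2 B.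
Proof. by move=> mA mB; exact: product_measure1E. Qed.

Lemma prod_sf_tonelli (f : T1 * T2 -> \bar R) : measurable_fun setT f ->
  (forall z, 0 <= f z) ->
  \int[prod_sf m1 m2]_z f z = \int[m1]_x \int[m2]_y f (x, y).
Proof. by move=> mf f0; exact: (fubini_tonelli1 (m1 := m1) (m2 := m2)). Qed.

Lemma prod_sf_measurable1 (f : T1 * T2 -> \bar R) :
  measurable_fun setT f -> (forall z, 0 <= f z) ->
  measurable_fun setT (fun x => \int[m2]_y f (x, y)).
Proof. by move=> mf f0; exact: (measurable_fun_fubini_tonelli_F (m2 := m2)). Qed.

Lemma prod_sf_fubini1 (f : T1 * T2 -> \bar R) :
  (prod_sf m1 m2).-integrable setT f ->
  \int[prod_sf m1 m2]_z f z = \int[m1]_x \int[m2]_y f (x, y).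
Proof. by move=> mf; apply/esym; exact: (@integral12_prod_meas1 _ _ _ _ _ m1 m2). Qed.

Lemma prod_sf_fubini2 (f : T1 * T2 -> \bar R) :
  (prod_sf m1 m2).-integrable setT f ->
  \int[prod_sf m1 m2]_z f z = \int[m2]_y \int[m1]_x f (x, y).
Proof. by move=> mf; apply/esym; exact: (@integral21_prod_meas1 _ _ _ _ _ m1 m2). Qed.

Lemma prod_sf_ae_integrable1 (f : T1 * T2 -> \bar R) :
  (prod_sf m1 m2).-integrable setT f ->
  {ae m1, forall x, m2.-integrable setT (fun y => f (x, y))}.
Proof. by move=> mf; exact: (@ae_integrable1 _ _ _ _ _ m1 m2). Qed.

End ProdSf.

(** * The domains: measurability, finite measure, full support *)

Section Domains.
Variable R : realType.
Local Notation X := (space3 R).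
Local Notation ST := (spacetime R).

Lemma sqrt_sum_continuous (T : topologicalType) n (f : 'I_n -> T -> R) :
  (forall i, continuous (f i)) -> continuous (fun z => \sum_(i < n) f i z ^+ 2).
Proof.
move=> cf; elim: n f cf => [|n IH] f cf.
  have -> : (fun z => \sum_(i < 0) f i z ^+ 2) = cst 0.
    by apply/funext => z; rewrite big_ord0.
  by move=> x; exact: cvg_cst.
have -> : (fun z => \sum_(i < n.+1) f i z ^+ 2) =
    (fun z => f ord0 z ^+ 2 + \sum_(i < n) f (lift ord0 i) z ^+ 2).
  by apply/funext => z; rewrite big_ord_recl.
move=> x; apply: cvgD; first by apply: cvgM; exact: cf.
by apply: IH => i; exact: cf.
Qed.

Lemma vnorm_continuous (T : topologicalType) (f : 'I_3 -> T -> R) :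
  (forall i, continuous (f i)) -> continuous (fun z => vnorm (f^~ z)).
Proof.
move=> cf z; apply: (@continuous_comp _ _ _ (fun z => \sum_i f i z ^+ 2) Num.sqrt).
  exact: sqrt_sum_continuous.
exact: sqrt_continuous.
Qed.

Lemma open_Bal (r : R) : open (Bal r).
Proof.
have -> : Bal r = (fun x : X => enorm x) @^-1` [set y | y < r] by [].
apply: open_comp; last exact: open_lt.
by move=> x _; apply: vnorm_continuous => i; exact: crd_continuous.
Qed.

Lemma measurable_Bal (r : R) : measurable (Bal r).
Proof. apply: open_measurable3; exact: open_Bal. Qed.

Lemma I1E : @I1 R = `]-1, 0[%classic.
Proof. by apply/seteqP; split=> t /=; rewrite /I1 /= in_itv. Qed.

Lemma measurable_I1 : measurable (@I1 R : set (measurableTypeR R)).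
Proof. rewrite I1E; exact: measurable_itv. Qed.

Lemma open_Q1 : open (@Q1 R).
Proof.
have -> : @Q1 R = ((fst : ST -> R) @^-1` (@I1 R)) `&` ((snd : ST -> X) @^-1` (Bal 1)).
  by [].
apply: openI; apply: open_comp.
- by move=> z _; exact: cvg_fst.
- by rewrite I1E; exact: interval_open.
- by move=> z _; exact: cvg_snd.
- exact: open_Bal.
Qed.

Lemma measurable_Q1 : measurable (@Q1 R).
Proof. apply: open_measurable4; exact: open_Q1. Qed.

Lemma leb1E (A : set R) : leb1 R A = lebesgue_measure A.
Proof. by []. Qed.

Lemma leb1_I1 : leb1 R (@I1 R) = 1%E.
Proof.
by rewrite I1E leb1E lebesgue_measure_itv /= lte_fin ltrN10 -EFinD sub0r opprK.
Qed.

Lemma leb3_Bal1 : (leb3 R (Bal 1) < +oo)%E.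
Proof.
have mi : measurable (`[-1, 1]%classic : set (measurableTypeR R)) by exact: measurable_itv.
have fi : leb1 R `[-1, 1]%classic \is a fin_num.
  by rewrite leb1E lebesgue_measure_itv /=; case: ifP.
apply: (@le_lt_trans _ _ (leb3 R (box 1))).
  apply: le_measure; rewrite ?inE; first exact: measurable_Bal.
    by apply: measurableX => //; exact: measurableX.
  by move=> x Bx; apply/boxP => i; apply/ltW/Bal_crd.
rewrite /leb3 /box prod_sf_setX // ?prod_sf_setX //; last exact: measurableX.
by rewrite ltey_eq !fin_numM.
Qed.

Lemma leb4_Q1 : (leb4 R (@Q1 R) < +oo)%E.
Proof.
rewrite /leb4 prod_sf_setX; [|exact: measurable_I1|exact: measurable_Bal].
by rewrite leb1_I1 mul1e leb3_Bal1.
Qed.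

(** Full support of the measure. [toU] stands for the identity from the carrier with its topology to
    the same carrier with its sigma-algebra. *)
Definition locally_positive (T : topologicalType) d (U : measurableType d)
  (toU : T -> U) (m : set U -> \bar R) : Prop :=
  forall (x : T) A, nbhs x A -> exists B : set U,
    [/\ measurable B, (0 < m B)%E & toU @^-1` B `<=` A].

Lemma leb1_locally_positive :
  @locally_positive R _ (measurableTypeR R) id (leb1 R).
Proof.
move=> x A /nbhs_ballP[e /= e0 xA]; exists (ball x e); split => //.
  by exact: measurable_ball.
have -> : leb1 R (ball x e) = (e *+ 2)%:E by exact: lebesgue_measure_ball (ltW e0).
by rewrite lte_fin mulrn_wgt0.
Qed.

Lemma prod_sf_locally_positive (T1 T2 : topologicalType) d1 d2
  (U1 : measurableType d1) (U2 : measurableType d2)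
  (m1 : {sigma_finite_measure set U1 -> \bar R})
  (m2 : {sigma_finite_measure set U2 -> \bar R}) (f1 : T1 -> U1) (f2 : T2 -> U2) :
  locally_positive f1 m1 -> locally_positive f2 m2 ->
  @locally_positive (T1 * T2)%type _ (U1 * U2)%type
    (fun z => (f1 z.1, f2 z.2)) (prod_sf m1 m2).
Proof.
move=> p1 p2 [x y] A [[A1 A2] [/= xA1 yA2] AA].
have [B1 [mB1 B10 BA1]] := p1 _ _ xA1; have [B2 [mB2 B20 BA2]] := p2 _ _ yA2.
exists (B1 `*` B2); split; first exact: measurableX.
  by rewrite prod_sf_setX // mule_gt0.
by move=> [a b] [/= B1a B2b]; apply: AA; split => /=; [exact: BA1|exact: BA2].
Qed.

Lemma leb4_locally_positive (z : ST) (A : set ST) : nbhs z A ->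
  exists B : set ST, [/\ measurable B, (0 < leb4 R B)%E & B `<=` A].
Proof.
move=> zA.
have p := prod_sf_locally_positive leb1_locally_positive
  (prod_sf_locally_positive (prod_sf_locally_positive leb1_locally_positive
     leb1_locally_positive) leb1_locally_positive).
have [B [mB B0 BA]] := p z A zA; exists B; split => //.
by move=> [t [[x1 x2] x3]] Bx; apply: BA.
Qed.

End Domains.

(** * The cutoff constant *)

Section Cutoff.
Variable R : realType.
Local Notation X := (space3 R).
Local Notation ST := (spacetime R).
Local Notation leb4 := (leb4 R).
Local Notation Q1 := (@Q1 R).

Lemma dx_slice (f : ST -> R) j t x :
  dx j f (t, x) = 'D_(evec R j) (fun y => f (t, y)) x.
Proof.
have [|_ ->] // := @derive_affine R ST X (fun y : X => (t, y) : ST)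
  (fun v : X => (0, v) : ST) f x (evec R j).
by move=> h; congr pair; rewrite /= scaler0 add0r.
Qed.

Lemma pair_continuous (t : R) : continuous (fun y : X => (t, y) : ST).
Proof.
move=> y; apply: (@cvg_pair _ _ _ (nbhs y) (nbhs t) (nbhs y) _ _ _ (fun _ : X => t) id).
  exact: cvg_cst.
exact: cvg_id.
Qed.

Lemma smooth_slice (f : ST -> R) t : smooth f -> smooth (fun y : X => f (t, y)).
Proof.
apply: (@smooth_affine R ST X (fun y : X => (t, y) : ST) (fun v : X => (0, v) : ST)).
  exact: pair_continuous.
by move=> x v h; congr pair; rewrite /= scaler0 add0r.
Qed.

Lemma lap_slice (f : ST -> R) t x : lap f (t, x) = lap3 (fun y => f (t, y)) x.
Proof.
have E j : (fun y => dx j f (t, y)) = 'D_(evec R j) (fun y => f (t, y)).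
  by apply/funext => y; exact: dx_slice.
rewrite /lap /lap3; apply: eq_bigr => j _; rewrite dx_slice.
exact: (congr1 (fun g => 'D_(evec R j) g x) (E j)).
Qed.

Lemma leb4_gt0 : (0 < leb4 setT)%E.
Proof.
have [B [mB B0 _]] := leb4_locally_positive (@filterT _ (nbhs (0 : ST)) _).
by apply: (lt_le_trans B0); apply: le_measure; rewrite ?inE.
Qed.

(** An essential supremum controls pointwise values here because Q1 is open and Lebesgue measure has
    full support: an open set on which |f| exceeds the supremum would have positive measure. *)
Lemma normLp_ge (f : ST -> R) z : continuous f -> Q1 z ->
  (`|f z|%:E <= normLp leb4 +oo Q1 f)%E.
Proof.
move=> cf Qz; rewrite leNgt; apply/negP => lt_f.
have : (normLp leb4 +oo Q1 f < `|f z|%:E)%E by [].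
rewrite /normLp unlock leb4_gt0 => {}lt_f.
have [N [mN N0 Nsub]] := @ess_sup_ge _ _ R leb4 (abse \o ((EFin \o f) \_ Q1)).
move: lt_f Nsub; set e := ess_sup _ _ => lt_f Nsub.
have e0 : (0 <= e)%E.
  by apply: ess_sup_gee; [exact: leb4_gt0|apply: nearW => w /=; exact: abse_ge0].
have efin : e \is a fin_num by rewrite ge0_fin_numE // (lt_trans lt_f) // ltry.
pose U := Q1 `&` (fun w => `|f w|) @^-1` [set y | fine e < y].
have oU : open U.
  apply: openI; first exact: open_Q1.
  apply: open_comp; last exact: open_gt.
  move=> w _; apply: (@continuous_comp _ _ _ f (fun y : R => `|y|)).
    exact: cf.
  exact: norm_continuous.
have Uz : U z by split => //=; rewrite -lte_fin fineK.
have [B [mB B0 BU]] := leb4_locally_positive (open_nbhs_nbhs (conj oU Uz)).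
have BN : B `<=` N.
  move=> w /BU[Qw /= fw]; apply: Nsub => /=.
  by rewrite patchE mem_set //= leNgt -(fineK efin) lte_fin fw.
have : (leb4 B <= leb4 N)%E by apply: le_measure; rewrite ?inE.
by rewrite N0 leNgt B0.
Qed.

Lemma normLp_le (f : ST -> R) (C : R) : 0 <= C -> (forall z, Q1 z -> `|f z| <= C) ->
  (normLp leb4 +oo Q1 f <= C%:E)%E.
Proof.
move=> C0 fC; rewrite /normLp unlock leb4_gt0; apply/ess_supP/nearW => z /=.
rewrite patchE; case: ifPn => [|_]; last by rewrite /= normr0 lee_fin.
by rewrite inE => /fC; rewrite /= lee_fin.
Qed.

Lemma bounded_on_Q1 (f : ST -> R) : continuous f ->
  exists2 C, 0 <= C & forall z, Q1 z -> `|f z| <= C.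
Proof.
move=> cf; pose K : set ST := `[-1, 0]%classic `*` box 1.
have cK : compact K by apply: compact_setX; [exact: segment_compact|exact: compact_box].
have K0 : K !=set0.
  exists (0, 0); split => /=; first by rewrite in_itv /= lexx lerN10.
  by apply/boxP => i; rewrite crd0 normr0.
have [|c Kc cmax] := @compact_EVT_max ST R (fun w => `|f w|) K K0 cK.
  apply: continuous_subspaceT => z.
  apply: (@continuous_comp _ _ _ f (fun y : R => `|y|)); first exact: cf.
  exact: norm_continuous.
exists `|f c| => // -[t x] [/= /andP[t1 t0] Bx]; apply: cmax; rewrite inE; split => /=.
  by rewrite in_itv /= !ltW.
by apply/boxP => i; apply/ltW/Bal_crd.
Qed.

Lemma normLp_fin (f : ST -> R) : continuous f ->
  exists2 C, normLp leb4 +oo Q1 f = C%:E & 0 <= C /\ forall z, Q1 z -> `|f z| <= C.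
Proof.
move=> cf; have [C C0 fC] := bounded_on_Q1 cf.
have nfin : normLp leb4 +oo Q1 f \is a fin_num.
  rewrite ge0_fin_numE ?Lnorm_ge0 //; apply: le_lt_trans (normLp_le C0 fC) _.
  exact: ltry.
exists (fine (normLp leb4 +oo Q1 f)); first by rewrite fineK.
split; first by rewrite fine_ge0 // Lnorm_ge0.
by move=> z Qz; rewrite -lee_fin fineK //; exact: normLp_ge.
Qed.

Variable chi : ST -> R.
Hypothesis hchi : loc_cutoff chi.

Let schi : smooth chi. Proof. by case: hchi. Qed.

Lemma smooth_grad_continuous (f : ST -> R) : smooth f ->
  continuous (fun z => vnorm (grad f z)).
Proof.
move=> sf; apply: vnorm_continuous => j.
by apply: smooth_continuous; exact: smooth_derive.
Qed.

Lemma smooth_lap_continuous (f : ST -> R) : smooth f -> continuous (lap f).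
Proof.
move=> sf; apply: smooth_continuous; apply: smooth_sum => j.
exact/smooth_derive/smooth_derive.
Qed.

(** The support of chi on t <= 0 lies in a compact set K over the open ball, so the slice vanishes
    in a neighbourhood of every outer point, the sphere included. Hence its derivatives vanish there
    too. *)
Lemma cutoff_slice t : -1 < t < 0 ->
  [/\ smooth (fun y : X => chi (t, y)),
      forall x, ~ Bal 1 x -> \forall y \near x, chi (t, y) = 0 &
      forall x, 0 <= chi (t, x) <= 1].
Proof.
move=> /andP[t1 t0]; have [_ [K [cK KA Kz]] c01 _] := hchi.
split; [exact: smooth_slice| |by move=> x; apply: c01; exact: ltW].
move=> x nBx; have nK : ~ K (t, x) by move=> /KA[].
have nearK : \forall y \near x, ~ K (t, y).
  exact: (@pair_continuous t x _ (near_notin_compact cK nK)).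
by apply: (filterS _ nearK) => y /= nKy; apply: Kz => //=; exact: ltW.
Qed.

Lemma cutoff_lap_out t x : -1 < t < 0 -> ~ Bal 1 x -> lap3 (fun y => chi (t, y)) x = 0.
Proof.
move=> ht nBx; have [_ /(_ _ nBx) near0 _] := cutoff_slice ht.
rewrite /lap3 big1 // => i _; apply: derive_eq0_nbhs.
have : nbhs x (nbhs^~ [set y | chi (t, y) = 0]) by exact: nbhs_interior.
by apply: filterS => y; exact: derive_eq0_nbhs.
Qed.

(* The bound g <= b is what absorbs the factor 2 of the term
   2 (grad chi . grad) u of the localized momentum equation. *)
Lemma C_chiE : exists a b g : R, [/\ C_chi chi = (a + b + g)%:E,
   [/\ 0 <= a, 0 <= g, g <= b & 6 <= b],
   forall z, Q1 z -> `|dt chi z| <= a, forall z, Q1 z -> `|lap chi z| <= b &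
   forall z, Q1 z -> vnorm (grad chi z) <= g].
Proof.
have [a aE [a0 ha]] := normLp_fin (smooth_continuous (smooth_derive ((1, 0) : ST) schi)).
have [b bE [b0 hb]] := normLp_fin (smooth_lap_continuous schi).
have [g gE [g0 hg]] := normLp_fin (smooth_grad_continuous schi).
have lapb t x : -1 < t < 0 -> `|lap3 (fun y => chi (t, y)) x| <= b.
  move=> ht; have [Bx|nBx] := pselect (Bal 1 x).
    by rewrite -lap_slice; apply: hb.
  by rewrite cutoff_lap_out // normr0.
have out t x : -1 < t < 0 -> ~ Bal 1 x -> chi (t, x) = 0.
  by move=> ht nBx; have [_ /(_ _ nBx) /nbhs_singleton] := cutoff_slice ht.
have b6 : 6 <= b.
  (* Any time in (-1/4, 0) would do: there chi is 1 at the spatial origin. *)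
  have ht : -1 < (- (1 / 8) : R) < 0 by apply/andP; split; lra.
  have [st _ _] := cutoff_slice ht.
  apply: (bump_laplacian_ge st) => //; [by move=> x; exact: out| |by move=> x; exact: lapb].
  have [_ _ _ chi1] := hchi; apply: chi1; split => /=.
    by apply/andP; split; lra.
  by apply/BalE; [lra|rewrite big1 => [|i _]; rewrite ?crd0 ?expr0n //=; lra].
exists a, b, g; split => //; first by rewrite /C_chi aE bE gE.
- split => //; rewrite -lee_fin -gE; apply: normLp_le => // -[t x] [/= ht Bx].
  have [st _ c01] := cutoff_slice ht.
  rewrite ger0_norm ?sqrtr_ge0 // /grad.
  have -> : (fun j => dx j chi (t, x)) = (fun j => 'D_(evec R j) (fun y => chi (t, y)) x).
    by apply/funext => j; exact: dx_slice.
  by apply: bump_gradient_le => // y; [exact: out|exact: lapb].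
- by move=> z Qz; apply: le_trans (hg z Qz); exact: ler_norm.
Qed.

End Cutoff.

(** * Energy, flux, pressure and cutoff errors *)

Section CauchySchwarz.
Variable R : realType.

(** Lagrange's identity: the defect in the squared inequality is half the double sum of the squares
    (a_i b_j - a_j b_i)^2. *)
Lemma CauchySchwarz_sum (I : finType) (a b : I -> R) :
  `|\sum_i a i * b i| <= Num.sqrt (\sum_i a i ^+ 2) * Num.sqrt (\sum_i b i ^+ 2).
Proof.
rewrite -sqrtr_sqr -sqrtrM; last by apply: sumr_ge0 => i _; exact: sqr_ge0.
rewrite ler_sqrt; last first.
  by rewrite mulr_ge0 //; apply: sumr_ge0 => i _; exact: sqr_ge0.
have : 0 <= \sum_i \sum_j (a i * b j - a j * b i) ^+ 2.
  by apply: sumr_ge0 => i _; apply: sumr_ge0 => j _; exact: sqr_ge0.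
have -> : \sum_i \sum_j (a i * b j - a j * b i) ^+ 2 =
    \sum_i \sum_j (a i ^+ 2 * b j ^+ 2) + \sum_i \sum_j (b i ^+ 2 * a j ^+ 2)
    - (\sum_i \sum_j (a i * b i) * (a j * b j)) *+ 2.
  rewrite -sumrMnl -big_split -sumrB /=; apply: eq_bigr => i _.
  rewrite -sumrMnl -big_split -sumrB /=; apply: eq_bigr => j _.
  by rewrite mulr2n; ring.
have dist (u w : I -> R) : \sum_i \sum_j u i * w j = (\sum_i u i) * (\sum_j w j).
  by rewrite mulr_suml; apply: eq_bigr => i _; rewrite mulr_sumr.
rewrite !dist -expr2 (mulrC (\sum_i b i ^+ 2)) -mulr2n -mulrnBl pmulrn_lge0 //.
by rewrite subr_ge0.
Qed.

Lemma vnorm_dot (a b : 'I_3 -> R) : `|\sum_(i < 3) a i * b i| <= vnorm a * vnorm b.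
Proof. exact: CauchySchwarz_sum. Qed.

Lemma mnorm_dot (a b : 'I_3 -> 'I_3 -> R) :
  `|\sum_(i < 3) \sum_(j < 3) a i j * b i j| <= mnorm a * mnorm b.
Proof.
rewrite /mnorm !pair_bigA /=.
exact: (CauchySchwarz_sum (fun p : 'I_3 * 'I_3 => a p.1 p.2) (fun p => b p.1 p.2)).
Qed.

Lemma mnorm_tensor (a b : 'I_3 -> R) : mnorm (fun i j => a i * b j) = vnorm a * vnorm b.
Proof.
rewrite /vnorm -sqrtrM; last by apply: sumr_ge0 => i _; exact: sqr_ge0.
rewrite /mnorm mulr_suml; congr (Num.sqrt _); apply: eq_bigr => i _.
by rewrite mulr_sumr; apply: eq_bigr => j _; rewrite exprMn.
Qed.

Lemma vnorm_ge0 (a : 'I_3 -> R) : 0 <= vnorm a. Proof. exact: sqrtr_ge0. Qed.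
Lemma mnorm_ge0 (a : 'I_3 -> 'I_3 -> R) : 0 <= mnorm a. Proof. exact: sqrtr_ge0. Qed.

Lemma vnorm_coord (a : 'I_3 -> R) i : `|a i| <= vnorm a.
Proof.
rewrite -sqrtr_sqr ler_sqrt; last by apply: sumr_ge0 => j _; exact: sqr_ge0.
by rewrite (bigD1 i) //= lerDl sumr_ge0 // => j _; exact: sqr_ge0.
Qed.

Lemma mnorm_coord (a : 'I_3 -> 'I_3 -> R) i j : `|a i j| <= mnorm a.
Proof.
have s0 k : 0 <= \sum_(l < 3) a k l ^+ 2 by apply: sumr_ge0 => l _; exact: sqr_ge0.
rewrite -sqrtr_sqr ler_sqrt; last by apply: sumr_ge0.
rewrite (bigD1 i) //= (bigD1 j) //= -addrA lerDl addr_ge0 //.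
  by apply: sumr_ge0 => k _; exact: sqr_ge0.
by apply: sumr_ge0.
Qed.

End CauchySchwarz.

Section IntegralBounds.
Context d (T : measurableType d) (R : realType) (mu : {measure set T -> \bar R}).
Variables (D : set T) (mD : measurable D).

Lemma normLpE (q : R) (f : T -> R) : q != 0 ->
  normLp mu q%:E D f = ((\int[mu]_(x in D) (`|f x| `^ q)%:E) `^ q^-1)%E.
Proof.
move=> q0; rewrite /normLp unlock; congr (_ `^ _)%E.
rewrite [RHS]integral_mkcond; apply: eq_integral => x _; rewrite !patchE.
by case: ifPn => _ //=; rewrite ?normr0 ?powR0.
Qed.

Lemma holder_on (p q : R) (f k : T -> R) : measurable_fun D f -> measurable_fun D k ->
  0 < p -> 0 < q -> p^-1 + q^-1 = 1 ->
  (\int[mu]_(x in D) (`|f x * k x|)%:E <=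
   (\int[mu]_(x in D) (`|f x| `^ p)%:E) `^ p^-1 * normLp mu q%:E D k)%E.
Proof.
move=> mf mk p0 q0 pq; rewrite -normLpE ?gt_eqF //.
have mp (h : T -> R) : measurable_fun D h -> measurable_fun setT (h \_ D).
  by move=> mh; apply/(measurable_restrictT _ _).1.
have := hoelder mu (mp _ mf) (mp _ mk) p0 q0 pq.
rewrite Lnorm1 /normLp.
have E (h : T -> R) : EFin \o h \_ D = (EFin \o h) \_ D.
  by apply/funext => x /=; rewrite !patchE; case: ifP.
rewrite !E => /(le_trans _) -> //; rewrite [leLHS]integral_mkcond.
rewrite le_eqVlt; apply/orP; left; apply/eqP; apply: eq_integral => x _ /=.
by rewrite !patchE; case: ifP => _ //=; rewrite mulr0 normr0.
Qed.

(** No integrability is asked of f: when the extended integral is infinite, its real value is 0 by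
    default. *)
Lemma abs_Rintegral_le (f : T -> R) : measurable_fun D f ->
  (`|\int[mu]_(x in D) f x|%:E <= \int[mu]_(x in D) (`|f x|)%:E)%E.
Proof.
move=> mf; have mf' : measurable_fun D (EFin \o f) by exact/measurable_EFinP.
apply: le_trans (le_abse_integral mu mD mf'); rewrite /Rintegral.
by case: (integral _ _ _) => //= [|]; rewrite normr0 leey.
Qed.

End IntegralBounds.

Section FlowBounds.
Variable R : realType.
Local Notation X := (space3 R).
Local Notation ST := (spacetime R).
Local Notation leb4 := (leb4 R).
Local Notation Q1 := (@Q1 R).
Variable v : flow R.
Hypothesis hv : flow_wf v.

Lemma measurable_u i : measurable_fun Q1 (flow_u v i).
Proof. by have [_ /(_ i)[]] := hv. Qed.

Lemma measurable_Du i j : measurable_fun Q1 (flow_Du v i j).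
Proof. by have [[_ /(_ i j)[]]] := hv. Qed.

Lemma measurable_pcirc : measurable_fun Q1 (pcirc v).
Proof. by have [_ _ _ []] := hv. Qed.

Lemma measurable_vnorm (f : 'I_3 -> ST -> R) :
  (forall i, measurable_fun Q1 (f i)) -> measurable_fun Q1 (fun z => vnorm (f^~ z)).
Proof.
move=> mf; have msum : measurable_fun Q1 (fun z => \sum_i f i z ^+ 2).
  by apply: measurable_sum => i; exact: measurable_funX.
exact: (measurableT_comp (continuous_measurable_fun (@sqrt_continuous R)) msum).
Qed.

Lemma measurable_mnorm (f : 'I_3 -> 'I_3 -> ST -> R) :
  (forall i j, measurable_fun Q1 (f i j)) ->
  measurable_fun Q1 (fun z => mnorm (fun i j => f i j z)).
Proof.
move=> mf; have msum : measurable_fun Q1 (fun z => \sum_i \sum_j f i j z ^+ 2).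
  by apply: measurable_sum => i; apply: measurable_sum => j; exact: measurable_funX.
exact: (measurableT_comp (continuous_measurable_fun (@sqrt_continuous R)) msum).
Qed.

Lemma measurable_uvec : measurable_fun Q1 (fun z => vnorm (uvec v z)).
Proof. exact: (measurable_vnorm measurable_u). Qed.

Lemma continuous_measurable_Q1 (f : ST -> R) : continuous f -> measurable_fun Q1 f.
Proof.
by move=> cf; apply: measurable_funS (continuous_measurable4 cf).
Qed.

(** By Tonelli the left side is the time integral of the slice energies, and the time interval has
    length 1. *)
Lemma int_u2_le : (\int[leb4]_(z in Q1) (vnorm (uvec v z) ^+ 2)%:E <= flow_A v)%E.
Proof.
pose F : ST -> \bar R := (fun z => (vnorm (uvec v z) ^+ 2)%:E) \_ Q1.
have mF : measurable_fun setT F.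
  apply/(measurable_restrictT _ _).1; first exact: measurable_Q1.
  by apply/measurable_EFinP; apply: measurable_funX; exact: measurable_uvec.
have F0 z : (0 <= F z)%E by apply: erestrict_ge0 => w _; rewrite lee_fin sqr_ge0.
rewrite integral_mkcond -/F.
rewrite (prod_sf_tonelli (leb1 R) (leb3 R) mF F0).
pose G : R -> \bar R :=
  (fun t => \int[leb3 R]_(x in Bal 1) (vnorm (uvec v (t, x)) ^+ 2)%:E)%E \_ (@I1 R).
have FG t : (\int[leb3 R]_x F (t, x))%E = G t.
  rewrite /G patchE; case: ifPn => ht.
    rewrite [RHS]integral_mkcond; apply: eq_integral => x _.
    rewrite /F !patchE; rewrite inE in ht.
    have -> : ((t, x) \in Q1) = (x \in Bal 1).
      by apply/idP/idP; rewrite !inE; [case|split].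
    by [].
  apply: integral0_eq => x _; rewrite /F patchE ifF //.
  by apply: contraNF ht; rewrite !inE => -[].
under eq_integral do rewrite FG.
have mG : measurable_fun setT G.
  have := prod_sf_measurable1 (leb3 R) mF F0.
  by under eq_fun do rewrite FG.
have G0 t : (0 <= G t)%E by rewrite -FG; exact: integral_ge0.
have A0 : (0 <= flow_A v)%E.
  apply: ess_sup_gee; last by apply: nearW.
  apply: (@lt_le_trans _ _ (leb1 R (@I1 R))); first by rewrite leb1_I1.
  by apply: le_measure; rewrite ?inE //; exact: measurable_I1.
apply: (@le_trans _ _ (\int[leb1 R]_(t in @I1 R) flow_A v)%E).
  rewrite [leLHS](_ : _ = \int[leb1 R]_(t in @I1 R) G t)%E; last first.
    rewrite [RHS]integral_mkcond; apply: eq_integral => t _.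
    by rewrite [RHS]patchE; case: ifPn => // /negbTE ht; rewrite /G patchE ht.
  apply: ae_ge0_le_integral => //.
  - exact: measurable_I1.
  - exact: measurable_funTS.
  - by apply: filterS (ess_sup_ge (leb1 R) G) => t /= ? _.
have -> : (\int[leb1 R]_(t in @I1 R) flow_A v = flow_A v * leb1 R (@I1 R))%E.
  by apply: integral_cst; exact: measurable_I1.
by rewrite leb1_I1 mule1.
Qed.

End FlowBounds.

Section SimpleEstimates.
Variable R : realType.
Local Notation X := (space3 R).
Local Notation ST := (spacetime R).
Local Notation leb4 := (leb4 R).
Local Notation Q1 := (@Q1 R).
Variable v : flow R.
Hypothesis hv : flow_wf v.
Variable S : loc_setup R.
Local Notation chi := (loc_chi S).
Hypothesis hchi : loc_cutoff chi.

Let schi : smooth chi. Proof. by case: hchi. Qed.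
Let mQ1 := @measurable_Q1 R.
Let U z := vnorm (uvec v z).
Let mU : measurable_fun Q1 U := measurable_uvec hv.
Let U0 z : 0 <= U z. Proof. exact: vnorm_ge0. Qed.

Let mdchi w : measurable_fun Q1 ('D_w chi).
Proof. by apply: continuous_measurable_Q1; apply/smooth_continuous/smooth_derive. Qed.

Lemma flow_A_ge0 : (0 <= flow_A v)%E.
Proof.
by apply: le_trans (int_u2_le hv); apply: integral_ge0 => z _; rewrite lee_fin sqr_ge0.
Qed.

Lemma flow_C_ge0 : (0 <= flow_C v)%E.
Proof. by apply: integral_ge0 => z _; rewrite lee_fin exprn_ge0 ?vnorm_ge0. Qed.

Lemma flow_D_ge0 : (0 <= flow_D v)%E.
Proof. by apply: integral_ge0 => z _; rewrite lee_fin powR_ge0. Qed.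

Lemma flow_E_ge0 : (0 <= flow_E v)%E.
Proof. by apply: integral_ge0 => z _; rewrite lee_fin sqr_ge0. Qed.

Lemma flow_CE : flow_C v = (\int[leb4]_(z in Q1) (`|U z| `^ 3)%:E)%E.
Proof.
by apply: eq_integral => z _; rewrite ger0_norm // powR_mulrn.
Qed.

(** The form in which |u|^2 is the factor in L^(3/2), paired by Hoelder with a test quantity in
    L^3. *)
Lemma flow_CE2 : flow_C v = (\int[leb4]_(z in Q1) (`|U z ^+ 2| `^ (3 / 2))%:E)%E.
Proof.
apply: eq_integral => z _; rewrite ger0_norm ?sqr_ge0 // -[U z ^+ 2]powR_mulrn // -powRrM.
by rewrite (_ : 2%:R * (3 / 2) = 3%:R) ?powR_mulrn //; field.
Qed.

Lemma flow_DE : flow_D v = (\int[leb4]_(z in Q1) (`|pcirc v z| `^ (3 / 2))%:E)%E.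
Proof. by []. Qed.

Lemma le_int_scale (f h : ST -> R) (c : R) : 0 <= c ->
  measurable_fun Q1 f -> measurable_fun Q1 h ->
  (forall z, Q1 z -> 0 <= f z) -> (forall z, Q1 z -> 0 <= h z) ->
  (forall z, Q1 z -> f z <= c * h z) ->
  (\int[leb4]_(z in Q1) (f z)%:E <= c%:E * \int[leb4]_(z in Q1) (h z)%:E)%E.
Proof.
move=> c0 mf mh f0 h0 fh; rewrite -ge0_integralZl_EFin //; last exact/measurable_EFinP.
apply: ge0_le_integral => //.
- exact/measurable_EFinP.
- by apply/measurable_EFinP; exact: measurable_funM.
Qed.

Lemma Err_en_le : (Err_en S v <= C_chi chi * flow_A v)%E.
Proof.
have [a [b [g [-> [a0 g0 gb b6] ha hb hg]]]] := C_chiE hchi.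
apply: (@le_trans _ _ ((a + b)%:E * \int[leb4]_(z in Q1) (U z ^+ 2)%:E)%E).
  apply: le_int_scale; first lra.
  - apply: measurable_funM; first exact: measurable_funX.
    apply: measurable_funD; apply: measurableT_comp => //; first exact: mdchi.
    by apply: continuous_measurable_Q1; exact: smooth_lap_continuous.
  - exact: measurable_funX.
  - by move=> z _; rewrite mulr_ge0 ?sqr_ge0 // addr_ge0.
  - by move=> z _; rewrite sqr_ge0.
  - move=> z Qz; rewrite mulrC ler_wpM2r ?sqr_ge0 //.
    by apply: lerD; [exact: ha|exact: hb].
apply: lee_pmul; rewrite ?lee_fin //; last exact: int_u2_le.
- lra.
- by apply: integral_ge0 => z _; rewrite lee_fin sqr_ge0.
- lra.
Qed.

Lemma Err_flux_le : (Err_flux S v <= C_chi chi * flow_C v)%E.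
Proof.
have [a [b [g [-> [a0 g0 gb b6] ha hb hg]]]] := C_chiE hchi.
apply: (@le_trans _ _ (g%:E * \int[leb4]_(z in Q1) (U z ^+ 3)%:E)%E).
  apply: le_int_scale => //.
  - apply: measurable_funM; first exact: measurable_funX.
    apply: measurableT_comp => //; apply: measurable_sum => i.
    by apply: measurable_funM; [exact: measurable_u|exact: mdchi].
  - exact: measurable_funX.
  - by move=> z _; rewrite mulr_ge0 ?sqr_ge0.
  - by move=> z _; rewrite exprn_ge0.
  - move=> z Qz; have -> : g * U z ^+ 3 = U z ^+ 2 * (g * U z) by ring.
    rewrite ler_wpM2l ?sqr_ge0 //.
    apply: le_trans (vnorm_dot (uvec v z) (grad chi z)) _.
    by rewrite [leLHS]mulrC ler_wpM2r ?vnorm_ge0 //; exact: hg.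
by apply: lee_wpmul2r; [exact: flow_C_ge0|rewrite lee_fin; lra].
Qed.

Lemma Err_lprs_le :
  (Err_lprs S v <= C_chi chi * (flow_C v `^ (1 / 3) * flow_D v `^ (2 / 3)))%E.
Proof.
have [a [b [g [-> [a0 g0 gb b6] ha hb hg]]]] := C_chiE hchi.
have mP := measurable_pcirc hv.
apply: (@le_trans _ _ (g%:E * \int[leb4]_(z in Q1) (`|pcirc v z * U z|)%:E)%E).
  apply: le_int_scale => //.
  - apply: measurable_funM; first by apply: measurable_funM => //; exact: measurableT_comp.
    by apply: continuous_measurable_Q1; exact: smooth_grad_continuous.
  - by apply: measurableT_comp => //; exact: measurable_funM.
  - by move=> z _; rewrite !mulr_ge0 ?vnorm_ge0.
  - move=> z Qz; rewrite normrM (ger0_norm (U0 z)) [leLHS]mulrC ler_wpM2r ?mulr_ge0 ?vnorm_ge0 //.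
    exact: hg.
apply: lee_pmul; rewrite ?lee_fin //; [by apply: integral_ge0|lra|].
have := @holder_on _ _ R leb4 Q1 mQ1 (3 / 2) 3 _ _ mP mU.
rewrite normLpE // -flow_CE -flow_DE muleC invf_div div1r.
by apply => //; lra.
Qed.

(** The tensor is (chi^2 - chi) times u (x) u, of modulus at most |u|^2. The constant obtained is
    therefore 1, and C_chi enters only through C_chi >= 1, which follows from 6 <= b. *)
Lemma Err_cut1_le : (Err_cut1 S v <= C_chi chi * flow_C v `^ (2 / 3))%E.
Proof.
have [a [b [g [-> [a0 g0 gb b6] ha hb hg]]]] := C_chiE hchi.
apply: ub_ereal_sup => _ [phi [tphi phi1] <-].
have sphi i : smooth (phi i) by case: (tphi i).
pose G z := mnorm (fun i j => dx j (phi i) z).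
have mdphi i j : measurable_fun Q1 (dx j (phi i)).
  by apply: continuous_measurable_Q1; apply/smooth_continuous/smooth_derive.
have mG : measurable_fun Q1 G by apply: measurable_mnorm => i j; exact: mdphi.
have mchi : measurable_fun Q1 chi by apply: continuous_measurable_Q1; exact: smooth_continuous.
set F := fun z => \sum_(i < 3) \sum_(j < 3) (chi z * flow_u v i z * (chi z * flow_u v j z)
   - chi z * flow_u v i z * flow_u v j z) * dx j (phi i) z.
have mF : measurable_fun Q1 F.
  apply: measurable_sum => i; apply: measurable_sum => j.
  apply: measurable_funM => //; apply: measurable_funB; apply: measurable_funM;
    do ?apply: measurable_funM => //; exact: measurable_u.
rewrite /div_pairing normrN; apply: le_trans (abs_Rintegral_le leb4 mQ1 mF) _.
apply: (@le_trans _ _ (1%:E * \int[leb4]_(z in Q1) (`|U z ^+ 2 * G z|)%:E)%E).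
  apply: le_int_scale => //; first exact: measurableT_comp.
    apply: measurableT_comp => //; apply: measurable_funM => //; exact: measurable_funX.
  move=> z Qz; rewrite mul1r [leRHS]ger0_norm ?mulr_ge0 ?sqr_ge0 ?mnorm_ge0 //.
  have [_ _ c01 _] := hchi; have /c01 /andP[c0 c1] : z.1 <= 0.
    by move: Qz => [/= /andP[_ /ltW]].
  have -> : F z = (chi z ^+ 2 - chi z) *
      \sum_(i < 3) \sum_(j < 3) (flow_u v i z * flow_u v j z) * dx j (phi i) z.
    rewrite mulr_sumr; apply: eq_bigr => i _; rewrite mulr_sumr; apply: eq_bigr => j _.
    by ring.
  rewrite normrM -[leRHS]mul1r; apply: ler_pM => //.
    have : chi z ^+ 2 <= chi z by rewrite expr2 ler_piMr.
    by have := sqr_ge0 (chi z); rewrite ler_norml => *; apply/andP; split; lra.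
  apply: le_trans (mnorm_dot (fun i j => flow_u v i z * flow_u v j z) _) _.
  by rewrite (mnorm_tensor (uvec v z) (uvec v z)) -expr2.
apply: lee_pmul; rewrite ?lee_fin //; [by apply: integral_ge0|lra|].
have mU2 : measurable_fun Q1 (fun z => U z ^+ 2) by exact: measurable_funX.
have p0 : 0 < 3 / 2 :> R by lra.
have pq : (3 / 2)^-1 + 3^-1 = 1 :> R by field.
have := holder_on leb4 mQ1 mU2 mG p0 (ltr0n R 3) pq.
rewrite -flow_CE2 invf_div => /le_trans; apply.
rewrite -[leRHS]mule1; apply: lee_wpmul2l; first exact: poweR_ge0.
by apply: le_trans phi1; rewrite leeDr // Lnorm_ge0.
Qed.

End SimpleEstimates.

(** * The momentum error *)

Section FubiniZero.
Local Open Scope ereal_scope.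
Context d1 d2 (R : realType) (T1 : measurableType d1) (T2 : measurableType d2)
  (m1 : {sigma_finite_measure set T1 -> \bar R})
  (m2 : {sigma_finite_measure set T2 -> \bar R}).

(** Integrability of the slice is offered as a premise so that these lemmas can be nested: in
    [int_derive_test] the premise of the outer application is the hypothesis of the inner one. *)
Lemma prod_sf_eq0_1 (f : T1 * T2 -> \bar R) :
  (prod_sf m1 m2).-integrable setT f ->
  {ae m1, forall x, m2.-integrable setT (fun y => f (x, y)) ->
     \int[m2]_y f (x, y) = 0} ->
  \int[prod_sf m1 m2]_z f z = 0.
Proof.
move=> fi f0; rewrite prod_sf_fubini1 // -(integral0 m1 setT).
apply: ae_eq_integral => //.
  exact: (measurable_fubini_F (m1 := m1) (m2 := m2)).
apply: filterS2 (prod_sf_ae_integrable1 fi) f0 => x h1 h2 _; exact: h2.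
Qed.

Lemma prod_sf_eq0_2 (f : T1 * T2 -> \bar R) :
  (prod_sf m1 m2).-integrable setT f ->
  {ae m2, forall y, m1.-integrable setT (fun x => f (x, y)) ->
     \int[m1]_x f (x, y) = 0} ->
  \int[prod_sf m1 m2]_z f z = 0.
Proof.
move=> fi f0; rewrite prod_sf_fubini2 // -(integral0 m2 setT).
apply: ae_eq_integral => //.
  exact: (measurable_fubini_G (m1 := m1) (m2 := m2)).
have := @ae_integrable2 _ _ _ _ _ m1 m2 f fi.
by move=> fi2; apply: filterS2 fi2 f0 => x h1 h2 _; exact: h2.
Qed.

End FubiniZero.

(** * Integrals of derivatives of test functions *)

Section CompactlySupported.
Variable R : realType.
Local Notation X := (space3 R).
Local Notation ST := (spacetime R).

Lemma int_derive_eq0 (f f' : R -> R) (M : R) : 0 < M ->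
  (forall s : R, is_derive s 1 f (f' s)) -> continuous f' ->
  (forall s, M <= `|s| -> f s = 0) -> (forall s, M <= `|s| -> f' s = 0) ->
  (\int[leb1 R]_s (f' s)%:E = 0)%E.
Proof.
move=> M0 df cf' f0 f'0.
have cf : continuous f.
  by move=> s; apply: differentiable_continuous; apply/derivable1_diffP; case: (df s).
have -> : (\int[leb1 R]_s (f' s)%:E = \int[lebesgue_measure]_(s in `[(- M)%R, M]) (f' s)%:E)%E.
  rewrite [RHS]integral_mkcond; apply: eq_integral => s _; rewrite patchE.
  case: ifPn => // sM; rewrite f'0 // leNgt; apply: contra sM => sM.
  by rewrite mem_setE in_itv /= -ler_norml ltW.
rewrite (@continuous_FTC2 R f' f) //.
- by rewrite !f0 ?sube0 // ?normrN ger0_norm // ltW.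
- by lra.
- exact: continuous_subspaceT.
- split; first by move=> s _; case: (df s).
    exact/cvg_at_right_filter/cf.
  exact/cvg_at_left_filter/cf.
- by move=> s _; rewrite derive1E; apply: derive_val.
Qed.

Lemma bounded_integrable d (T : measurableType d) (mu : {measure set T -> \bar R})
  (D : set T) (f : T -> R) (C : R) : measurable D -> (mu D < +oo)%E ->
  measurable_fun D f -> (forall x, D x -> `|f x| <= C) ->
  mu.-integrable D (EFin \o f).
Proof.
move=> mD muD mf fC; apply: (@le_integrable _ _ _ mu D mD _ (cst C%:E)).
- exact/measurable_EFinP.
- by move=> x Dx /=; rewrite lee_fin (le_trans (fC x Dx)) // ler_norm.
- apply/integrableP; split; first exact: measurable_cst.
  by rewrite integral_cst // ltey_eq fin_numM // ge0_fin_numE.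
Qed.

Lemma test_fun_bounded (f : X -> R) : test_fun (Bal 1) f ->
  exists C, forall x, Bal 1 x -> `|f x| <= C.
Proof.
move=> tf; have cf := smooth_continuous (test_fun_smooth tf).
have B0 : @box R 1 !=set0 by exists (0 : X); apply/boxP => i; rewrite crd0 normr0.
have [|c _ cmax] := @compact_EVT_max X R (fun x => `|f x|) (box 1) B0 (@compact_box R 1).
  apply: continuous_subspaceT => x.
  by apply: (@continuous_comp _ _ _ f (fun y : R => `|y|)); [exact: cf|exact: norm_continuous].
exists `|f c| => x Bx; apply: cmax; rewrite inE; apply/boxP => i.
by apply/ltW/Bal_crd.
Qed.

Lemma test_fun_integrable (f : X -> R) : test_fun (Bal 1) f ->
  (leb3 R).-integrable (Bal 1) (EFin \o f).
Proof.
move=> tf; have [C fC] := test_fun_bounded tf.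
apply: bounded_integrable fC; [exact: measurable_Bal|exact: leb3_Bal1|].
apply: measurable_funS (continuous_measurable3 _) => //.
exact/smooth_continuous/test_fun_smooth/tf.
Qed.

Lemma test_fun_patch (f : X -> R) : test_fun (Bal 1) f ->
  (EFin \o f) \_ (Bal 1) = EFin \o f.
Proof.
move=> tf; apply/funext => x; rewrite patchE; case: ifPn => //= nB.
by rewrite (test_fun_out tf) // => Bx; rewrite mem_set in nB.
Qed.

(** The base point has vanishing i-th coordinate, so s is the i-th coordinate along the line, and
    the line is outside the unit ball once |s| >= 1. *)
Lemma test_fun_line (f : X -> R) i (x0 : X) : test_fun (Bal 1) f -> crd x0 i = 0 ->
  (\int[leb1 R]_s ('D_(evec R i) f (s *: evec R i + x0))%:E = 0)%E.
Proof.
move=> tf x00; have sf := test_fun_smooth tf.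
have out s : 1 <= `|s| -> ~ Bal 1 (s *: evec R i + x0).
  move=> s1 /(Bal_crd i ltr01); rewrite crdD crdZ crd_evec eqxx mulr1 x00 addr0.
  by rewrite ltNge s1.
apply: (@int_derive_eq0 (fun s => f (s *: evec R i + x0)) _ 1 ltr01).
- by move=> s; exact: is_derive_line.
- apply: (smooth_continuous (f := 'D_(evec R i) f \o (fun s : R => s *: evec R i + x0))).
  apply: (@smooth_affine R X R _ (fun s : R => s *: evec R i)).
  + by move=> s; apply: cvgD; [exact: scalel_continuous|exact: cvg_cst].
  + by move=> s w h; rewrite scalerDl scalerA addrA.
  + exact: smooth_derive.
- by move=> s s1; rewrite (test_fun_out tf) //; exact: out.
- by move=> s s1; rewrite (test_fun_out (test_fun_derive _ tf)) //; exact: out.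
Qed.

Lemma int_derive_test (f : X -> R) i : test_fun (Bal 1) f ->
  (\int[leb3 R]_(x in Bal 1) ('D_(evec R i) f x)%:E = 0)%E.
Proof.
move=> tf; have tdf := test_fun_derive (evec R i) tf.
have gi := test_fun_integrable tdf.
rewrite integral_mkcond (test_fun_patch tdf).
have {}gi : (leb3 R).-integrable setT (EFin \o 'D_(evec R i) f).
  by rewrite -(test_fun_patch tdf); apply/(integrable_mkcond _ (@measurable_Bal R 1)).1.
have line x0 := test_fun_line (i := i) (x0 := x0) tf.
pose m := leb1 R; pose m2 := prod_sf m m.
pose G j : (measurableTypeR R * measurableTypeR R) * measurableTypeR R -> \bar R :=
  EFin \o 'D_(evec R j) f.
suff : (\int[prod_sf m2 m]_z G i z = 0)%E by [].
have {}gi : (prod_sf m2 m).-integrable setT (G i) by [].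
(* The integration along coordinate i must be the innermost one, so the order of the iterated
   integrals depends on i. *)
case: i tdf gi line => [[|[|[|//]]] Hi] tdf gi line.
- apply: (prod_sf_eq0_2 gi); apply: nearW => c gi2; apply: (prod_sf_eq0_2 gi2).
  apply: nearW => b _; apply: etrans (line ((0, b), c) erefl); apply: eq_integral => a _.
  have E : ((a, b), c) = a *: evec R (Ordinal Hi) + ((0, b), c) :> X.
    by apply: crd_inj => -[[|[|[|//]]] ?]; rewrite crdD crdZ crd_evec /crd /=; ring.
  exact: (congr1 (fun y => ('D_(evec R (Ordinal Hi)) f y)%:E) E).
- apply: (prod_sf_eq0_2 gi); apply: nearW => c gi2; apply: (prod_sf_eq0_1 gi2).
  apply: nearW => a _; apply: etrans (line ((a, 0), c) erefl); apply: eq_integral => b _.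
  have E : ((a, b), c) = b *: evec R (Ordinal Hi) + ((a, 0), c) :> X.
    by apply: crd_inj => -[[|[|[|//]]] ?]; rewrite crdD crdZ crd_evec /crd /=; ring.
  exact: (congr1 (fun y => ('D_(evec R (Ordinal Hi)) f y)%:E) E).
- apply: (prod_sf_eq0_1 gi); apply: nearW => -[a b] _; apply: etrans (line ((a, b), 0) erefl).
  apply: eq_integral => c _.
  have E : ((a, b), c) = c *: evec R (Ordinal Hi) + ((a, b), 0) :> X.
    by apply: crd_inj => -[[|[|[|//]]] ?]; rewrite crdD crdZ crd_evec /crd /=; ring.
  exact: (congr1 (fun y => ('D_(evec R (Ordinal Hi)) f y)%:E) E).
Qed.

End CompactlySupported.

(** * Integrable functions and null integrals on space-time *)

Section Momentum.
Variable R : realType.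
Local Notation X := (space3 R).
Local Notation ST := (spacetime R).
Local Notation leb4 := (leb4 R).
Local Notation Q1 := (@Q1 R).

Let mQ1 := @measurable_Q1 R.

Definition intQ (f : ST -> R) : Prop := leb4.-integrable Q1 (EFin \o f).

Lemma intQD f g : intQ f -> intQ g -> intQ (fun z => f z + g z).
Proof. by move=> fi gi; exact: (integrableD mQ1 fi gi). Qed.

Lemma intQZ (k : R) f : intQ f -> intQ (fun z => k * f z).
Proof. by move=> fi; exact: (integrableZl mQ1 k fi). Qed.

Lemma intQN f : intQ f -> intQ (fun z => - f z).
Proof.
move=> fi; have -> : (fun z => - f z) = (fun z => -1 * f z).
  by apply/funext => z; rewrite mulN1r.
exact: intQZ.
Qed.

Lemma intQ0 : intQ (fun=> 0). Proof. exact: integrable0. Qed.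

Lemma intQ_sum n (f : 'I_n -> ST -> R) : (forall i, intQ (f i)) ->
  intQ (fun z => \sum_(i < n) f i z).
Proof.
move=> fi; rewrite /intQ; have -> : EFin \o (fun z => \sum_(i < n) f i z) =
  (fun z => \sum_(i <- index_enum 'I_n) (f i z)%:E)%E.
  by apply/funext => z /=; rewrite sumEFin.
by apply: integrable_sum => // i _; exact: fi.
Qed.

Lemma intQ_measurable f : intQ f -> measurable_fun Q1 f.
Proof. by move=> /integrableP[/measurable_EFinP]. Qed.

Lemma intQ_le (f g : ST -> R) : measurable_fun Q1 f -> intQ g ->
  (forall z, Q1 z -> `|f z| <= `|g z|) -> intQ f.
Proof.
move=> mf gi fg; apply: (le_integrable mQ1 _ _ gi); first exact/measurable_EFinP.
by move=> z Qz /=; rewrite lee_fin fg.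
Qed.

Lemma intQM_cont (f k : ST -> R) : intQ f -> continuous k -> intQ (fun z => f z * k z).
Proof.
move=> fi ck; have [C C0 kC] := bounded_on_Q1 ck.
apply: (intQ_le _ (intQZ C fi)).
  by apply: measurable_funM; [exact: intQ_measurable|exact: continuous_measurable_Q1].
by move=> z Qz; rewrite !normrM mulrC ler_wpM2r // (le_trans (kC z Qz)) // ler_norm.
Qed.

(** Q1 has finite measure, so a power is controlled by 1 plus any higher one; this gives
    integrability of u, u (x) u, Du and the pressure from finite C, E and D. *)
Lemma intQ_dominated (f h : ST -> R) : measurable_fun Q1 f -> measurable_fun Q1 h ->
  (forall z, 0 <= h z) -> (\int[leb4]_(z in Q1) (h z)%:E < +oo)%E ->
  (forall z, Q1 z -> `|f z| <= 1 + h z) -> intQ f.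
Proof.
move=> mf mh h0 hoo fh; apply: (@intQ_le _ (fun z => 1 + h z)) => //.
  apply: intQD.
    by apply: (bounded_integrable (C := 1)) => //; [exact: leb4_Q1|move=> z _; rewrite normr1].
  apply/integrableP; split; first exact/measurable_EFinP.
  by under eq_integral do rewrite /= ger0_norm //.
by move=> z Qz; rewrite (le_trans (fh z Qz)) // ler_norm.
Qed.

(** Integrability is bundled because [Rintegral] is additive only on integrable functions. *)
Definition nullQ f := intQ f /\ \int[leb4]_(z in Q1) f z = 0.

Lemma nullQD f g : nullQ f -> nullQ g -> nullQ (fun z => f z + g z).
Proof.
move=> [fi f0] [gi g0]; split; first exact: intQD.
by rewrite RintegralD // f0 g0 addr0.
Qed.

Lemma nullQZ (k : R) f : nullQ f -> nullQ (fun z => k * f z).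
Proof. by move=> [fi f0]; split; [exact: intQZ|rewrite RintegralZl // f0 mulr0]. Qed.

Lemma nullQ_sum n (f : 'I_n -> ST -> R) : (forall i, nullQ (f i)) ->
  nullQ (fun z => \sum_(i < n) f i z).
Proof.
elim: n f => [|n IH] f fn.
  have -> : (fun z => \sum_(i < 0) f i z) = (fun=> 0 : R).
    by apply/funext => z; rewrite big_ord0.
  by split; [exact: intQ0|rewrite Rintegral_cst // mul0r].
have -> : (fun z => \sum_(i < n.+1) f i z) =
    (fun z => f ord0 z + \sum_(i < n) f (lift ord0 i) z).
  by apply/funext => z; rewrite big_ord_recl.
by apply: nullQD; [exact: fn|apply: IH => i; exact: fn].
Qed.

Lemma Q1_slice (f : ST -> R) t x : ((EFin \o f) \_ Q1) (t, x) =
  if t \in @I1 R then ((fun y => (f (t, y))%:E) \_ (Bal 1)) x else 0%E.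
Proof.
rewrite !patchE; have [ht|ht] := boolP (t \in _).
  rewrite (_ : ((t, x) \in Q1) = (x \in Bal 1)) //.
  by rewrite inE in ht; apply/idP/idP; rewrite !inE; [case|split].
by rewrite ifF //; apply: contraNF ht; rewrite !inE => -[].
Qed.

Lemma intQ_slice f : intQ f -> {ae leb1 R, forall t, @I1 R t ->
  (leb3 R).-integrable (Bal 1) (fun x => (f (t, x))%:E)}.
Proof.
move=> /(integrable_mkcond _ mQ1) fi.
apply: filterS (prod_sf_ae_integrable1 (m1 := leb1 R) (m2 := leb3 R) fi) => t ti It.
apply/(integrable_mkcond _ (@measurable_Bal R 1)).
move: ti; under eq_fun do rewrite Q1_slice.
by rewrite mem_set.
Qed.

Lemma nullQ_slice f : intQ f -> {ae leb1 R, forall t, @I1 R t ->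
    \int[leb3 R]_(x in Bal 1) (f (t, x))%:E = 0}%E ->
  nullQ f.
Proof.
move=> fi f0; split => //; rewrite /Rintegral.
suff -> : (\int[leb4]_(z in Q1) (f z)%:E = 0)%E by [].
rewrite integral_mkcond.
apply: (prod_sf_eq0_1 (m1 := leb1 R) (m2 := leb3 R)).
  by apply/(integrable_mkcond _ mQ1).
apply: (@filterS _ _ (ae_filter_ringOfSetsType (leb1 R)) _ _ _ f0) => t ft _.
under eq_integral do rewrite Q1_slice.
have [ht|_] := boolP (t \in _); last by rewrite integral0.
by rewrite -[RHS](ft (set_mem ht)) [RHS]integral_mkcond.
Qed.

Lemma test_fun_slice (f : ST -> R) t : test_fun Q1 f ->
  test_fun (Bal 1) (fun y : X => f (t, y)).
Proof.
move=> [sf [K [cK KQ fK]]]; split; first exact: smooth_slice.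
exists [set y | K (t, y)]; split.
- apply: (@subclosed_compact _ _ (@box R 1)).
  + apply: (@closed_comp _ _ (fun y : X => (t, y) : ST)).
      by move=> y _; exact: pair_continuous.
    exact: compact_closed_normed.
  + exact: compact_box.
  + by move=> y /= /KQ[_ By]; apply/boxP => i; apply/ltW/Bal_crd.
- by move=> y /= /KQ[].
- by move=> y nK; exact: fK.
Qed.

Variable v : flow R.
Hypothesis hv : flow_wf v.

(** The mean is constant on each time slice, where the derivative of psi integrates to 0.
    Integrability of the product is obtained from those of p and of [pcirc] against the same
    derivative. *)
Lemma mean_null (psi : ST -> R) i : test_fun Q1 psi ->
  intQ (fun z => pcirc v z * dx i psi z) ->
  nullQ (fun z => mean (Bal 1) (flow_p v) z.1 * dx i psi z).
Proof.
move=> tpsi pi; have tdpsi := test_fun_derive ((0, evec R i) : ST) tpsi.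
have [sd [K [cK KQ dK]]] := tdpsi.
have cd := smooth_continuous sd.
have mK : measurable K.
  rewrite -(setCK K); apply: measurableC; apply: open_measurable4.
  by rewrite openC; exact: compact_closed_normed.
have [_ _ [mp lp] _ _] := hv.
apply: nullQ_slice; last first.
  apply: nearW => t It; have tt := test_fun_slice t tpsi.
  under eq_integral do rewrite dx_slice EFinM /=.
  rewrite integralZl ?int_derive_test ?mule0 //; first exact: measurable_Bal.
  exact: (test_fun_integrable (test_fun_derive _ tt)).
(* p is only locally integrable, so the integral is moved to the compact set K outside which the
   derivative of psi vanishes. *)
have ip : intQ (fun z => flow_p v z * dx i psi z).
  have [C C0 dC] := bounded_on_Q1 cd.
  apply/(integrable_mkcond _ mQ1).
  have -> : (EFin \o (fun z => flow_p v z * dx i psi z)) \_ Q1 =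
            (EFin \o (fun z => flow_p v z * dx i psi z)) \_ K.
    apply/funext => z; rewrite !patchE; have [zK|zK] := boolP (z \in K).
      by rewrite mem_set //; apply: KQ; rewrite inE in zK.
    case: ifP => // _; rewrite /= /dx dK ?mulr0 // => Kz.
    by rewrite mem_set in zK.
  apply/(integrable_mkcond _ mK); apply: (le_integrable mK _ _ (integrableZl mK C (lp K cK KQ))).
    apply/measurable_EFinP; apply: measurable_funM; first exact: measurable_funS mp.
    apply: (measurable_funS mQ1 KQ); exact: continuous_measurable_Q1.
  move=> z Kz /=; rewrite lee_fin !normrM mulrC ler_wpM2r //.
  by rewrite (le_trans (dC z (KQ z Kz))) // ler_norm.
have -> : (fun z => mean (Bal 1) (flow_p v) z.1 * dx i psi z) =
   (fun z => flow_p v z * dx i psi z + - (pcirc v z * dx i psi z)).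
  by apply/funext => z; rewrite /pcirc; ring.
by apply: intQD => //; exact: intQN.
Qed.

(** [flow_wf] provides the weak gradient on almost every time slice. Slices of theta are admissible
    there, and Fubini assembles the slices. *)
Lemma weak_grad_null (theta : ST -> R) i j : test_fun Q1 theta ->
  intQ (flow_u v i) -> intQ (flow_Du v i j) ->
  nullQ (fun z => flow_u v i z * dx j theta z + flow_Du v i j z * theta z).
Proof.
move=> tt ui Dui; have [[_ _ wg] _ _ _ _] := hv.
have i1 : intQ (fun z => flow_u v i z * dx j theta z).
  apply: intQM_cont => //; apply: smooth_continuous.
  exact/smooth_derive/test_fun_smooth/tt.
have i2 : intQ (fun z => flow_Du v i j z * theta z).
  by apply: intQM_cont => //; exact/smooth_continuous/test_fun_smooth/tt.
apply: nullQ_slice; first exact: intQD.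
apply: (@filterS3 _ _ (ae_filter_ringOfSetsType (leb1 R)) _ _ _ _ _ wg
  (intQ_slice i1) (intQ_slice i2)) => t wt i1t i2t It.
have {}i1t := i1t It; have {}i2t := i2t It.
have := wt It _ (test_fun_slice t tt) i j.
under [LHS]eq_Rintegral do rewrite -dx_slice.
rewrite /Rintegral => E.
under eq_integral do rewrite EFinD.
rewrite integralD //; last exact: measurable_Bal.
(* The weak gradient identity equates real values of integrals; both integrals are finite for almost
   every t, so it holds in the extended reals. *)
rewrite -(fineK (integrable_fin_num _ i1t)); last exact: measurable_Bal.
rewrite -(fineK (integrable_fin_num _ i2t)); last exact: measurable_Bal.
by rewrite E -EFinD addNr.
Qed.

End Momentum.

Section MomentumAlgebra.
Variable R : realType.

(* With c, ct, cx, cxx the cutoff and its derivatives, phi, phit, phix, phixx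
   the test field, m = p - q the mean pressure: the localized pairing is the
   momentum equation tested with c phi, plus the commutator, plus null terms. *)
Lemma momentum_algebra (c ct p q : R) (u phi phit cx cxx : 'I_3 -> R)
  (phix phixx Du : 'I_3 -> 'I_3 -> R) :
  - (\sum_(i < 3) c * u i * phit i) - (\sum_(i < 3) c * u i * \sum_(j < 3) phixx i j)
  - (\sum_(i < 3) \sum_(j < 3) c * u i * u j * phix i j)
  - c * q * (\sum_(i < 3) phix i i) =
  (- (\sum_(i < 3) u i * (c * phit i + ct * phi i))
   - (\sum_(i < 3) u i * \sum_(j < 3) ((c * phixx i j + cx j * phix i j)
                                       + (cx j * phix i j + cxx j * phi i)))
   - (\sum_(i < 3) \sum_(j < 3) u i * u j * (c * phix i j + cx j * phi i))
   - p * (\sum_(i < 3) (c * phix i i + cx i * phi i)))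
  + ((\sum_(i < 3) \sum_(j < 3) 2 * (u i * (cx j * phix i j + cxx j * phi i)
                                     + Du i j * (cx j * phi i)))
     + \sum_(i < 3) (p - q) * (c * phix i i + cx i * phi i))
  + ((ct - \sum_(j < 3) cxx j) * (\sum_(i < 3) u i * phi i)
     - 2 * (\sum_(i < 3) \sum_(j < 3) Du i j * (phi i * cx j))
     + (\sum_(i < 3) \sum_(j < 3) u i * u j * (phi i * cx j))
     + q * (\sum_(i < 3) cx i * phi i)).
Proof.
rewrite !big_ord_recr !big_ord0 /=.
ring.
Qed.

End MomentumAlgebra.

Section MomentumEstimate.
Variable R : realType.
Local Notation X := (space3 R).
Local Notation ST := (spacetime R).
Local Notation leb4 := (leb4 R).
Local Notation Q1 := (@Q1 R).
Variable v : flow R.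
Hypothesis hv : flow_wf v.
Variable S : loc_setup R.
Local Notation chi := (loc_chi S).
Hypothesis hchi : loc_cutoff chi.

Let mQ1 := @measurable_Q1 R.
Let schi : smooth chi. Proof. by case: hchi. Qed.
Let U z := vnorm (uvec v z).
Let W z := mnorm (fun i j => flow_Du v i j z).
Let mU : measurable_fun Q1 U := measurable_uvec hv.
Let mW : measurable_fun Q1 W.
Proof. by apply: measurable_mnorm => i j; exact: measurable_Du. Qed.
Let U0 z : 0 <= U z. Proof. exact: vnorm_ge0. Qed.
Let W0 z : 0 <= W z. Proof. exact: mnorm_ge0. Qed.

Section Finite.
Hypothesis Cfin : (flow_C v < +oo)%E.
Hypothesis Dfin : (flow_D v < +oo)%E.
Hypothesis Efin : (flow_E v < +oo)%E.

Lemma le_1_powR (x r : R) : 0 <= x -> 1 <= r -> x <= 1 + x `^ r.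
Proof.
move=> x0 r1; have [x1|x1] := leP x 1.
  by rewrite (le_trans x1) // lerDl powR_ge0.
by rewrite (@le_trans _ _ (x `^ r)) ?lerDr // le1r_powR // ltW.
Qed.

Lemma intQ_uu i j : intQ (fun z => flow_u v i z * flow_u v j z).
Proof.
apply: (@intQ_dominated _ _ (fun z => U z ^+ 3)) => //.
- by apply: measurable_funM; exact: measurable_u.
- exact: measurable_funX.
- by move=> z; rewrite exprn_ge0.
- move=> z _; rewrite normrM (@le_trans _ _ (U z ^+ 2)) //.
    by rewrite expr2 ler_pM //; exact: (vnorm_coord (uvec v z)).
  apply: (le_trans (@le_1_powR (U z ^+ 2) (3 / 2) (sqr_ge0 _) _)); first lra.
  rewrite lerD2l -[U z ^+ 2]powR_mulrn // -powRrM.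
  by rewrite (_ : 2%:R * (3 / 2) = 3%:R) ?powR_mulrn //; field.
Qed.

Lemma intQ_u i : intQ (flow_u v i).
Proof.
apply: (@intQ_dominated _ _ (fun z => U z ^+ 3)) => //.
- exact: measurable_u.
- exact: measurable_funX.
- by move=> z; rewrite exprn_ge0.
- move=> z _; rewrite (le_trans (vnorm_coord (uvec v z) i)) //.
  by rewrite -(powR_mulrn 3 (U0 z)); apply: le_1_powR; [exact: U0|rewrite ler1n].
Qed.

Lemma intQ_Du i j : intQ (flow_Du v i j).
Proof.
apply: (@intQ_dominated _ _ (fun z => W z ^+ 2)) => //.
- exact: measurable_Du.
- exact: measurable_funX.
- by move=> z; rewrite sqr_ge0.
- move=> z _; rewrite (le_trans (mnorm_coord (fun i j => flow_Du v i j z) i j)) //.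
  by rewrite -(powR_mulrn 2 (W0 z)); apply: le_1_powR; [exact: W0|rewrite ler1n].
Qed.

Lemma intQ_pcirc : intQ (pcirc v).
Proof.
apply: (@intQ_dominated _ _ (fun z => `|pcirc v z| `^ (3 / 2))) => //.
- exact: measurable_pcirc.
- apply: (@measurableT_comp _ _ _ _ _ _ (fun x : R => x `^ (3 / 2))).
    exact: measurable_powR.
  by apply: measurableT_comp => //; exact: measurable_pcirc.
- by move=> z _; apply: le_1_powR => //; lra.
Qed.

(** P2 is the momentum equation tested with psi, Z1 collects the integrations by parts against
    theta, and Z2 the contribution of the mean pressure. Each is integrable with zero integral, so
    the claim reduces to a pointwise identity between the pairing's integrand and P2 + (Z1 + Z2) +
    P3. *)
Lemma momentum_pairingE (phi : 'I_3 -> ST -> R) : vtest phi ->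
  let P3 z :=
    (dt chi z - lap chi z) * (\sum_(i < 3) flow_u v i z * phi i z)
    - 2 * (\sum_(i < 3) \sum_(j < 3) flow_Du v i j z * (phi i z * dx j chi z))
    + (\sum_(i < 3) \sum_(j < 3) flow_u v i z * flow_u v j z * (phi i z * dx j chi z))
    + pcirc v z * (\sum_(i < 3) dx i chi z * phi i z) in
  intQ P3 /\
  mom_pairing (fun i z => chi z * flow_u v i z)
    (fun i j z => chi z * flow_u v i z * flow_u v j z)
    (fun z => chi z * pcirc v z) phi = \int[leb4]_(z in Q1) P3 z.
Proof.
move=> tphi P3; have sphi i : smooth (phi i) by case: (tphi i).
have cD (f : ST -> R) w : smooth f -> continuous ('D_w f).
  by move=> sf; exact/smooth_continuous/smooth_derive.
pose psi i : ST -> R := chi \* phi i.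
have tpsi i : test_fun Q1 (psi i) := test_funMl schi (tphi i).
have spsi i : smooth (psi i) by case: (tpsi i).
pose theta i j : ST -> R := phi i \* dx j chi.
have ttheta i j : test_fun Q1 (theta i j).
  have -> : theta i j = dx j chi \* phi i by apply/funext => z; rewrite /theta /= mulrC.
  exact: (test_funMl (smooth_derive _ schi) (tphi i)).
have cth i j : continuous (theta i j) by apply/smooth_continuous; case: (ttheta i j).
have P3i : intQ P3.
  have cphi i := smooth_continuous (sphi i).
  apply: intQD; [apply: intQD; [apply: intQD|]|].
  - have -> : (fun z => (dt chi z - lap chi z) * (\sum_(i < 3) flow_u v i z * phi i z)) =
      (fun z => \sum_(i < 3) flow_u v i z * (phi i z * (dt chi z - lap chi z))).
      apply/funext => z; rewrite mulr_sumr; apply: eq_bigr => i _; ring.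
    apply: intQ_sum => i; apply: intQM_cont; first exact: intQ_u.
    move=> z; apply: cvgM; first exact: cphi.
    by apply: cvgB; [exact: cD|exact: smooth_lap_continuous].
  - apply/intQN/intQZ; apply: intQ_sum => i; apply: intQ_sum => j.
    by apply: intQM_cont; [exact: intQ_Du|exact: cth].
  - apply: intQ_sum => i; apply: intQ_sum => j.
    by apply: intQM_cont; [exact: intQ_uu|exact: cth].
  - apply: intQM_cont; first exact: intQ_pcirc.
    apply: smooth_continuous; apply: smooth_sum => i.
    exact: (smoothM (smooth_derive _ schi) (sphi i)).
split => //.
pose P2 z := - (\sum_(i < 3) flow_u v i z * dt (psi i) z)
     - (\sum_(i < 3) flow_u v i z * lap (psi i) z)
     - (\sum_(i < 3) \sum_(j < 3) flow_u v i z * flow_u v j z * dx j (psi i) z)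
     - flow_p v z * (\sum_(i < 3) dx i (psi i) z).
pose Z1 z := \sum_(i < 3) \sum_(j < 3)
  2 * (flow_u v i z * dx j (theta i j) z + flow_Du v i j z * theta i j z).
pose Z2 z := \sum_(i < 3) mean (Bal 1) (flow_p v) z.1 * dx i (psi i) z.
have cdpsi j i : continuous (dx j (psi i)) := cD _ _ (spsi i).
have pd i : intQ (fun z => pcirc v z * dx i (psi i) z) :=
  intQM_cont intQ_pcirc (cdpsi i i).
have Z1n : nullQ Z1.
  apply: nullQ_sum => i; apply: nullQ_sum => j; apply: nullQZ.
  by apply: weak_grad_null => //; [exact: intQ_u|exact: intQ_Du].
have Z2n : nullQ Z2 by apply: nullQ_sum => i; exact: mean_null.
(* The momentum equation only gives the value of the integral. For integrability, p is split into
   [pcirc] and its mean. *)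
have P2n : nullQ P2.
  split; last by have [_ _ _ _ /(_ psi tpsi)] := hv.
  have pi i : intQ (fun z => flow_p v z * dx i (psi i) z).
    have -> : (fun z => flow_p v z * dx i (psi i) z) = (fun z =>
      pcirc v z * dx i (psi i) z + mean (Bal 1) (flow_p v) z.1 * dx i (psi i) z).
      by apply/funext => z; rewrite /pcirc; ring.
    by apply: intQD => //; case: (mean_null hv (tpsi i) (pd i)).
  apply: intQD; [apply: intQD; [apply: intQD|]|]; apply: intQN.
  - by apply: intQ_sum => i; exact: (intQM_cont (intQ_u i) (cD _ _ (spsi i))).
  - by apply: intQ_sum => i; exact: (intQM_cont (intQ_u i) (smooth_lap_continuous (spsi i))).
  - by apply: intQ_sum => i; apply: intQ_sum => j; exact: (intQM_cont (intQ_uu i j) (cdpsi j i)).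
  - have -> : (fun z => flow_p v z * (\sum_(i < 3) dx i (psi i) z)) =
      (fun z => \sum_(i < 3) flow_p v z * dx i (psi i) z).
      by apply/funext => z; rewrite mulr_sumr.
    exact: intQ_sum.
have [Zi Z0] := nullQD P2n (nullQD Z1n Z2n).
rewrite -[RHS]add0r -Z0 -RintegralD //.
rewrite /mom_pairing; apply: eq_Rintegral => z _.
have dpsi w i : 'D_w (psi i) = (chi \* 'D_w (phi i)) \+ ('D_w chi \* phi i) :=
  derive_mulE w schi (sphi i).
have sd w (f : ST -> R) : smooth f -> smooth ('D_w f) by exact: smooth_derive.
have dth i j : dx j (theta i j) z =
    dx j chi z * dx j (phi i) z + dx j (dx j chi) z * phi i z.
  have -> : theta i j = dx j chi \* phi i by apply/funext => y; rewrite /theta /= mulrC.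
  exact: (congr1 (fun g => g z) (derive_mulE _ (sd _ _ schi) (sphi i))).
have ddpsi i j : dx j (dx j (psi i)) z =
    (chi z * dx j (dx j (phi i)) z + dx j chi z * dx j (phi i) z) +
    (dx j chi z * dx j (phi i) z + dx j (dx j chi) z * phi i z).
  pose w : ST := (0, evec R j); have sf := sphi i.
  have E2 := derive_addE w (smoothM schi (sd w _ sf)) (smoothM (sd w _ schi) sf).
  apply: etrans (congr1 (fun f : ST -> R => 'D_w f z) (dpsi w i)) _.
  apply: etrans (congr1 (fun f : ST -> R => f z) E2) _.
  exact: (congr2 +%R
    (congr1 (fun f : ST -> R => f z) (derive_mulE w schi (sd w _ sf)))
    (congr1 (fun f : ST -> R => f z) (derive_mulE w (sd w _ schi) sf))).
have dpsiz w i : 'D_w (psi i) z = chi z * 'D_w (phi i) z + 'D_w chi z * phi i z :=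
  congr1 (fun f : ST -> R => f z) (dpsi w i).
apply: (etrans (momentum_algebra (chi z) (dt chi z) (flow_p v z) (pcirc v z)
  (uvec v z) (fun i => phi i z) (fun i => dt (phi i) z) (fun j => dx j chi z)
  (fun j => dx j (dx j chi) z) (fun i j => dx j (phi i) z)
  (fun i j => dx j (dx j (phi i)) z) (fun i j => flow_Du v i j z))).
congr (_ + _ + _).
- rewrite /P2; congr (- _ - _ - _ - _ * _).
  + by apply: eq_bigr => i _; congr (_ * _); exact/esym/dpsiz.
  + by apply: eq_bigr => i _; congr (_ * _); apply: eq_bigr => j _; exact/esym/ddpsi.
  + by apply: eq_bigr => i _; apply: eq_bigr => j _; congr (_ * _); exact/esym/dpsiz.
  + by apply: eq_bigr => i _; exact/esym/dpsiz.
- congr (_ + _).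
  + apply: eq_bigr => i _; apply: eq_bigr => j _; rewrite dth /theta /=.
    by rewrite (mulrC (phi i z)).
  + by apply: eq_bigr => i _; congr (_ * _); [rewrite /pcirc; ring|exact/esym/dpsiz].
Qed.

End Finite.
End MomentumEstimate.

(** * Duality estimate of the momentum error *)

Section MomentumBound.
Variable R : realType.
Local Notation ST := (spacetime R).
Local Notation leb4 := (leb4 R).
Local Notation Q1 := (@Q1 R).
Variable v : flow R.
Hypothesis hv : flow_wf v.
Variable S : loc_setup R.
Local Notation chi := (loc_chi S).
Hypothesis hchi : loc_cutoff chi.

Let mQ1 := @measurable_Q1 R.
Let U z := vnorm (uvec v z).
Let W z := mnorm (fun i j => flow_Du v i j z).
Let mU : measurable_fun Q1 U := measurable_uvec hv.
Let mW : measurable_fun Q1 W.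
Proof. by apply: measurable_mnorm => i j; exact: measurable_Du. Qed.
Let U0 z : 0 <= U z. Proof. exact: vnorm_ge0. Qed.
Let W0 z : 0 <= W z. Proof. exact: mnorm_ge0. Qed.

Lemma int_UV_le (f h : ST -> R) (M : \bar R) (p q k B : R) :
  measurable_fun Q1 f -> measurable_fun Q1 h -> 0 < p -> 0 < q -> p^-1 + q^-1 = 1 ->
  (\int[leb4]_(z in Q1) (`|f z| `^ p)%:E <= M)%E -> (normLp leb4 q%:E Q1 h <= 1)%E ->
  0 <= k <= B ->
  (k%:E * \int[leb4]_(z in Q1) (`|f z * h z|)%:E <= B%:E * M `^ p^-1)%E.
Proof.
move=> mf mh p0 q0 pq fM h1 /andP[k0 kB].
have I0 : (0 <= \int[leb4]_(z in Q1) (`|f z| `^ p)%:E)%E.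
  by apply: integral_ge0 => z _; rewrite lee_fin powR_ge0.
apply: lee_pmul; rewrite ?lee_fin //; first exact: integral_ge0.
apply: le_trans (holder_on leb4 mQ1 mf mh p0 q0 pq) _.
rewrite -[leRHS]mule1; apply: lee_pmul => //; first exact: poweR_ge0.
  exact: Lnorm_ge0.
apply: gt0_ler_poweR => //; first by rewrite invr_ge0 ltW.
  by rewrite in_itv /= leey andbT.
by rewrite in_itv /= leey andbT (le_trans I0).
Qed.

Lemma Err_mom_le : (Err_mom S v <= C_chi chi *
  (flow_A v `^ (1 / 2) + flow_E v `^ (1 / 2) + flow_C v `^ (2 / 3)
   + flow_D v `^ (2 / 3)))%E.
Proof.
have [a [b [g [CE [a0 g0 gb b6] ha hb hg]]]] := C_chiE hchi.
rewrite CE; set B := a + b + g.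
have B0 : 0 < B by rewrite /B; lra.
have [ab0 g20] : 0 <= a + b /\ 0 <= 2 * g by split; lra.
have abB : 0 <= a + b <= B by rewrite /B; apply/andP; split; lra.
(* The factor 2 is absorbed here: g <= b gives 2 g <= b + g <= B. *)
have g2B : 0 <= 2 * g <= B by rewrite /B; apply/andP; split; lra.
have gB : 0 <= g <= B by rewrite /B; apply/andP; split; lra.
have i22 : 2^-1 + 2^-1 = 1 :> R by lra.
have i323 : (3 / 2)^-1 + 3^-1 = 1 :> R by field.
have p32 : 0 < 3 / 2 :> R by lra.
have A0 := flow_A_ge0 hv; have C0 := flow_C_ge0 v; have D0 := flow_D_ge0 v.
have E0 := flow_E_ge0 v.
have ge0_nNy (x : \bar R) : (0 <= x)%E -> (x != -oo)%E by case: x.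
have nNy (x : \bar R) (r : R) : (x `^ r != -oo)%E.
  by apply: ge0_nNy; exact: poweR_ge0.
have h12 : 0 < 1 / 2 :> R by lra.
have h23 : 0 < 2 / 3 :> R by lra.
(* If E, C or D is infinite, the right side is +oo because B > 0. Otherwise the integrability behind
   [momentum_pairingE] is available. *)
have [Ey|Efin] := eqVneq (flow_E v) +oo%E.
  rewrite Ey poweRyr ?gt_eqF // addey ?nNy // !addye ?nNy //.
  by rewrite gt0_muley ?lte_fin // leey.
have [Cy|Cfin] := eqVneq (flow_C v) +oo%E.
  rewrite Cy poweRyr ?gt_eqF // addey; last by apply: ge0_nNy; rewrite !adde_ge0 ?poweR_ge0.
  by rewrite addye ?nNy // gt0_muley ?lte_fin // leey.
have [Dy|Dfin] := eqVneq (flow_D v) +oo%E.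
  rewrite Dy poweRyr ?gt_eqF // addey; last by apply: ge0_nNy; rewrite !adde_ge0 ?poweR_ge0.
  by rewrite gt0_muley ?lte_fin // leey.
rewrite -!ltey in Efin Cfin Dfin.
apply: ub_ereal_sup => _ [phi [tphi phi1] <-].
have sphi i : smooth (phi i) by case: (tphi i).
have [P3i ->] := momentum_pairingE hv hchi Cfin Dfin Efin tphi.
set P3 := (X in Rintegral _ _ X).
pose Phi z := vnorm (phi^~ z).
have Phi0 z : 0 <= Phi z by exact: vnorm_ge0.
have mPhi : measurable_fun Q1 Phi.
  by apply: measurable_vnorm => i; apply: continuous_measurable_Q1; exact: smooth_continuous.
have mpc := measurable_pcirc hv.
have mU2 : measurable_fun Q1 (fun z => U z ^+ 2) by exact: measurable_funX.
have N2 : (normLp leb4 2%:E Q1 Phi <= 1)%E.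
  by apply: le_trans phi1; rewrite leeDl // Lnorm_ge0.
have N3 : (normLp leb4 3%:E Q1 Phi <= 1)%E.
  by apply: le_trans phi1; rewrite leeDr // Lnorm_ge0.
apply: le_trans (abs_Rintegral_le leb4 mQ1 (intQ_measurable P3i)) _.
pose J (f : ST -> R) := (\int[leb4]_(z in Q1) (`|f z * Phi z|)%:E)%E.
have mJ (f : ST -> R) : measurable_fun Q1 f -> measurable_fun Q1 (fun z => (`|f z * Phi z|)%:E).
  move=> mf; apply/measurable_EFinP; apply: measurableT_comp => //.
  exact: measurable_funM.
have J0 (f : ST -> R) : (0 <= J f)%E by apply: integral_ge0 => z _; rewrite lee_fin.
(* Cauchy-Schwarz at each point splits P3 into four products with |phi|. Hoelder then uses exponents
   2 and 2 for u and Du, 3/2 and 3 for |u|^2 and the pressure. *)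
apply: (@le_trans _ _ ((a + b)%:E * J U + (2 * g)%:E * J W
   + g%:E * J (fun z => U z ^+ 2)%R + g%:E * J (pcirc v))%E).
  pose T (k : R) (f : ST -> R) z := (k%:E * (`|f z * Phi z|)%:E)%E.
  pose good (F : ST -> \bar R) := measurable_fun Q1 F /\ forall z, (0 <= F z)%E.
  have goodT k f : 0 <= k -> measurable_fun Q1 f -> good (T k f).
    move=> k0 mf; split; first by apply: measurable_funeM; exact: mJ.
    by move=> z; rewrite /T mule_ge0 ?lee_fin.
  have goodD F G : good F -> good G -> good (fun z => F z + G z)%E /\
      (\int[leb4]_(z in Q1) (F z + G z) =
       \int[leb4]_(z in Q1) F z + \int[leb4]_(z in Q1) G z)%E.
    move=> [mF F0] [mG G0]; split; last by rewrite ge0_integralD.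
    split; first exact: emeasurable_funD.
    by move=> z; rewrite adde_ge0.
  have TE k f : 0 <= k -> measurable_fun Q1 f ->
      (\int[leb4]_(z in Q1) T k f z = k%:E * J f)%E.
    move=> k0 mf; rewrite /T ge0_integralZl_EFin //; exact: mJ.
  rewrite -!TE //.
  have t1 := goodT _ _ ab0 mU; have t2 := goodT _ _ g20 mW.
  have t3 := goodT _ _ g0 mU2; have t4 := goodT _ _ g0 mpc.
  have [t12 <-] := goodD _ _ t1 t2; have [t123 <-] := goodD _ _ t12 t3.
  have [t1234 <-] := goodD _ _ t123 t4.
  apply: ge0_le_integral => //.
  - by apply/measurable_EFinP; apply: measurableT_comp => //; exact: intQ_measurable.
  - by case: t1234.
  move=> z Qz; rewrite /T -!EFinM -!EFinD lee_fin.
  have d1 : `|(dt chi z - lap chi z) * (\sum_(i < 3) flow_u v i z * phi i z)|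
      <= (a + b) * `|U z * Phi z|.
    rewrite normrM (ger0_norm (mulr_ge0 (U0 z) (Phi0 z))); apply: ler_pM => //.
      by apply: le_trans (ler_normB _ _) _; apply: lerD; [exact: ha|exact: hb].
    exact: (vnorm_dot (uvec v z) (phi^~ z)).
  have gr0 : vnorm (grad chi z) <= g by exact: hg.
  have d2 : `|- (2 * (\sum_(i < 3) \sum_(j < 3) flow_Du v i j z * (phi i z * dx j chi z)))|
      <= 2 * g * `|W z * Phi z|.
    rewrite normrN normrM (ger0_norm (mulr_ge0 (W0 z) (Phi0 z))) (ger0_norm (ler0n R 2)).
    rewrite -mulrA ler_pM2l //.
    apply: le_trans (mnorm_dot (fun i j => flow_Du v i j z) _) _.
    rewrite (mnorm_tensor (phi^~ z) (grad chi z)) mulrA [leRHS]mulrC.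
    exact: (ler_wpM2l (mulr_ge0 (W0 z) (Phi0 z)) gr0).
  have d3 : `|\sum_(i < 3) \sum_(j < 3) flow_u v i z * flow_u v j z * (phi i z * dx j chi z)|
      <= g * `|U z ^+ 2 * Phi z|.
    rewrite (ger0_norm (mulr_ge0 (sqr_ge0 (U z)) (Phi0 z))).
    apply: le_trans (mnorm_dot (fun i j => flow_u v i z * flow_u v j z) _) _.
    rewrite (mnorm_tensor (uvec v z) (uvec v z)) (mnorm_tensor (phi^~ z) (grad chi z)).
    rewrite -expr2 mulrA [leRHS]mulrC.
    exact: (ler_wpM2l (mulr_ge0 (sqr_ge0 (U z)) (Phi0 z)) gr0).
  have d4 : `|pcirc v z * (\sum_(i < 3) dx i chi z * phi i z)| <= g * `|pcirc v z * Phi z|.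
    rewrite !normrM mulrCA ler_wpM2l // (ger0_norm (Phi0 z)).
    apply: le_trans (vnorm_dot (grad chi z) (phi^~ z)) _.
    exact: (ler_wpM2r (Phi0 z) gr0).
  rewrite /P3; do 3 (apply: le_trans (ler_normD _ _) _; apply: lerD => //).
have j1 : ((a + b)%:E * J U <= B%:E * flow_A v `^ (1 / 2))%E.
  rewrite div1r; apply: (@int_UV_le U Phi (flow_A v) 2 2) => //.
  apply: le_trans (int_u2_le hv); rewrite le_eqVlt; apply/orP; left; apply/eqP.
  by apply: eq_integral => z _; rewrite ger0_norm // powR_mulrn.
have j2 : ((2 * g)%:E * J W <= B%:E * flow_E v `^ (1 / 2))%E.
  rewrite div1r; apply: (@int_UV_le W Phi (flow_E v) 2 2) => //.
  rewrite le_eqVlt; apply/orP; left; apply/eqP.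
  by apply: eq_integral => z _; rewrite ger0_norm // powR_mulrn.
have j3 : (g%:E * J (fun z => U z ^+ 2)%R <= B%:E * flow_C v `^ (2 / 3))%E.
  rewrite -invf_div; apply: (@int_UV_le (fun z => U z ^+ 2) Phi (flow_C v) _ 3) => //.
  by rewrite -flow_CE2.
have j4 : (g%:E * J (pcirc v) <= B%:E * flow_D v `^ (2 / 3))%E.
  by rewrite -invf_div; apply: (@int_UV_le (pcirc v) Phi (flow_D v) _ 3).
apply: le_trans (leeD (leeD (leeD j1 j2) j3) j4) _.
by rewrite -!ge0_muleDr ?adde_ge0 ?poweR_ge0.
Qed.

End MomentumBound.

(** * Comparison of the budgets *)

Section Budgets.
Variable R : realType.

Lemma C_chi_ge0 (chi : spacetime R -> R) : loc_cutoff chi -> (0 <= C_chi chi)%E.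
Proof.
move=> /C_chiE[a [b [g [-> [a0 g0 gb b6] _ _ _]]]]; rewrite lee_fin.
by rewrite !addr_ge0 // (le_trans g0).
Qed.

Lemma weighted_le (w : R) (c x y : \bar R) : 0 <= w -> (x <= c * y)%E ->
  (w%:E * x <= c * (w%:E * y))%E.
Proof. by move=> w0 xy; rewrite muleCA lee_wpmul2l // lee_fin. Qed.

Variables (Sc : {fset int}) (S : loc_setup R) (v : int -> flow R).
Hypothesis hS : loc_setup_wf Sc S.
Hypothesis hv : forall k, k \in Sc -> flow_wf (v k).

Let B_loc_term_ge0 k : k \in Sc -> [/\ 0 <= (w_en S k)%:E * flow_A (v k),
  0 <= (w_flux S k)%:E * flow_C (v k),
  0 <= (w_lprs S k)%:E * (flow_C (v k) `^ (1 / 3) * flow_D (v k) `^ (2 / 3)) &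
  0 <= (w_mom S k)%:E * (flow_A (v k) `^ (1 / 2) + flow_E (v k) `^ (1 / 2)
     + flow_C (v k) `^ (2 / 3) + flow_D (v k) `^ (2 / 3))]%E.
Proof.
move=> kS; have [? ? ? ? _] := hS.2 k kS.
have A0 := flow_A_ge0 (hv kS); have C0 := flow_C_ge0 (v k).
by split; apply: mule_ge0; rewrite ?lee_fin // ?mule_ge0 ?adde_ge0 ?poweR_ge0.
Qed.

Lemma B_loc_ge0 : (0 <= B_loc Sc S v)%E.
Proof.
apply: mule_ge0; first exact/C_chi_ge0/hS.1.
rewrite big_seq; apply: sume_ge0 => k kS.
by have [? ? ? ?] := B_loc_term_ge0 kS; rewrite !adde_ge0.
Qed.

Lemma B_cut_ge0 : (0 <= B_cut Sc S v)%E.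
Proof.
apply: mule_ge0; first exact/C_chi_ge0/hS.1.
rewrite big_seq; apply: sume_ge0 => k kS; have [_ _ _ _ ?] := hS.2 k kS.
by rewrite mule_ge0 ?lee_fin ?poweR_ge0.
Qed.

(** C_chi stands outside the sum in the budget; distributing it over extended reals rests on the
    nonnegativity of the terms. *)
Lemma Err_loc_le : (Err_loc Sc S v <= B_loc Sc S v)%E.
Proof.
rewrite /Err_loc /B_loc big_seq [in leRHS]big_seq ge0_sume_distrr; last first.
  by move=> k kS; have [? ? ? ?] := B_loc_term_ge0 kS; rewrite !adde_ge0.
apply: lee_sum => k kS; have [? ? ? ? _] := hS.2 k kS.
have [p1 p2 p3 p4] := B_loc_term_ge0 kS; have hk := hv kS; have hchi := hS.1.
rewrite [leRHS]ge0_muleDr ?adde_ge0 // [X in (_ <= X + _)%E]ge0_muleDr ?adde_ge0 //.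
rewrite [X in (_ <= X + _ + _)%E]ge0_muleDr //.
apply: leeD; [apply: leeD; [apply: leeD|]|]; apply: weighted_le => //.
- exact: Err_en_le.
- exact: Err_flux_le.
- exact: Err_lprs_le.
- exact: Err_mom_le.
Qed.

Lemma Err_cut_le : (Err_cut Sc S v <= B_cut Sc S v)%E.
Proof.
rewrite /Err_cut /B_cut big_seq [in leRHS]big_seq ge0_sume_distrr; last first.
  move=> k kS; have [_ _ _ _ ?] := hS.2 k kS.
  by rewrite mule_ge0 ?lee_fin ?poweR_ge0.
apply: lee_sum => k kS; have [_ _ _ _ ?] := hS.2 k kS.
by apply: weighted_le => //; apply: Err_cut1_le; [exact: hv|exact: hS.1].
Qed.

End Budgets.

(** * Truncation and pressure budgets, distances, finiteness *)

Section RealBudgets.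
Variable R : realType.

(** The supremum in [opnorm] bounds its set only if that set is bounded above, which is what
    [bounded_linear] provides; y is then normalized. *)
Lemma opnorm_bound (V W : normedModType R) (T : {linear V -> W}) y :
  bounded_linear T -> `|T y| <= opnorm T * `|y|.
Proof.
move=> [C TC]; have [->|y0] := eqVneq y 0; first by rewrite linear0 !normr0 mulr0.
have ny : 0 < `|y| by rewrite normr_gt0.
rewrite -ler_pdivrMr //; apply: sup_ubound.
  exists `|C| => _ [x /= x1 <-]; apply: le_trans (TC x) _.
  apply: le_trans (ler_norm _) _; rewrite normrM normr_id.
  by rewrite ler_piMr.
exists (`|y|^-1 *: y).
  by rewrite /= normrZ ger0_norm ?invr_ge0 // mulVf // gt_eqF.
by rewrite linearZ normrZ ger0_norm ?invr_ge0 // mulrC.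
Qed.

Lemma Err_tr_le (Sc : {fset int}) (S : trunc_setup R) (z : forall k, tr_Y S k) :
  trunc_setup_wf Sc S -> Err_tr Sc z <= B_tr Sc z.
Proof.
move=> hS; rewrite /Err_tr /B_tr big_seq [leRHS]big_seq; apply: ler_sum => k kS.
have [bT _ _ w0] := hS k kS; apply: ler_wpM2l => //.
apply: le_trans (ler_normB _ _) _; rewrite mulrDl mul1r lerD2l.
exact: opnorm_bound.
Qed.

Lemma B_prs_ge0 (Sc : {fset int}) (S : pressure_setup R) d :
  pressure_setup_wf Sc S -> (0 <= B_prs Sc S d)%E.
Proof.
move=> [[Cn _] [Cz _] hS]; rewrite /B_prs big_seq; apply: sume_ge0 => k kS.
have [_ _ w0] := hS k kS; apply: mule_ge0; rewrite ?lee_fin //.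
rewrite !adde_ge0 ?Lnorm_ge0 //.
- by rewrite !mule_ge0 ?poweR_ge0 ?Lnorm_ge0 // lee_fin exprn_ge0 // divr_ge0.
- rewrite mule_ge0 ?lee_fin //; apply: sume_ge0 => i _; apply: sume_ge0 => j _.
  exact: Lnorm_ge0.
- rewrite mule_ge0 ?lee_fin //; apply: sume_ge0 => i _; apply: sume_ge0 => j _.
  exact: Lnorm_ge0.
Qed.

(** The pressure entries are defined by the very terms of the budget, so the two sides are
    convertible. *)
Lemma Err_prsE (Sc : {fset int}) (S : pressure_setup R) d :
  Err_prs Sc S d = B_prs Sc S d.
Proof. by []. Qed.

Lemma dist_im_le (s : side R) (d : sD s) (a : sC s) : dist_im d <= `|d - sG a|.
Proof.
apply: ge_inf; last by exists a.
by exists 0 => _ [b _ <-].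
Qed.

Lemma dist_im_ge (s : side R) (d : sD s) (c : R) :
  (forall a, c <= `|d - sG a|) -> c <= dist_im d.
Proof.
move=> cd; apply: lb_le_inf; first by exists `|d - sG 0|, 0.
by move=> _ [a _ <-].
Qed.

Lemma adde_lty (x y : \bar R) : (0 <= x)%E -> (0 <= y)%E -> (x + y < +oo)%E ->
  (x < +oo)%E /\ (y < +oo)%E.
Proof. by case: x y => [r||] [s||] //=; rewrite !ltry. Qed.

Lemma ge0_lty_EFin (x : \bar R) : (0 <= x)%E -> (x < +oo)%E -> exists r : R, x = r%:E.
Proof. by case: x => [r||] // _ _; exists r. Qed.

End RealBudgets.

Theorem proposition16p25 (R : realType) (Sc : {fset int}) (L C : side R)
  (U : set (sD L)) (ch : chart (sD L) (sD C)) (CE CR : R)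
  (PS : pressure_setup R) (LS : loc_setup R)
  (TS : trunc_setup R) (RS : rep_setup R) (K : package_data (sD L) TS RS)
  (epsG deltaG ccl etac Deltac : R)
  (hL : side_wf L) (hC : side_wf C) (hch : chart_wf U ch)
  (hCE : 0 <= CE) (hCR : 0 <= CR)
  (hPS : pressure_setup_wf Sc PS) (hLS : loc_setup_wf Sc LS)
  (hTS : trunc_setup_wf Sc TS) (hRS : rep_setup_wf Sc RS)
  (hK : package_wf Sc PS U K)
  (lifting : [/\ 0 <= epsG < 1, 0 <= deltaG &
     forall d, U d -> forall b : sC C, exists a : sC L,
       `|d - sG a| <= (1 - epsG)^-1 * `|chart_map ch d - sG b|
                      + deltaG / (1 - epsG)])
  (detect_O : forall d, U d ->
     (`|sO (chart_map ch d)|%:E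
      - (Err_prs Sc PS (pk_prs K d) + Err_loc Sc LS (pk_flow K d)
         + (Err_tr Sc (pk_z K d))%:E + (pk_gauge K d)%:E)
      <= `|sO d|%:E)%E)
  (detect_E : forall d, U d ->
     ((CE * `|sE (chart_map ch d)|)%:E - Err_nl Sc LS K d
      <= (CE * `|sE d|)%:E)%E)
  (detect_Rep : forall d, U d ->
     CR * sRep d >= CR * sRep (chart_map ch d) - Err_rep Sc (pk_comp K d))
  (detect_P : forall d, U d ->
     pos_part (sP d) >= pos_part (sP (chart_map ch d))
                        - Err_prof (chart_map ch) d)
  (clean_gap : 0 < ccl /\ forall d, (chart_map ch @` U) d ->
     Fnorm CE CR d >= ccl * dist_im d)
  (budget : [/\ 0 <= etac, 0 <= Deltac & forall d, U d ->
     (B_conc Sc PS LS (chart_map ch) K d <= (etac * dist_im d + Deltac)%:E)%E])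
  (small : etac < ccl * (1 - epsG)) :
  let cloc := ccl * (1 - epsG) - etac in
  let Delta' := Deltac + ccl * deltaG in
  0 < cloc /\
  forall d, U d ->
    `|sO d| + CE * `|sE d| + CR * sRep d + pos_part (sP d)
      >= cloc * dist_im d - Delta' /\
    `|sO d| + CE * `|sE d| + CR * sRep d
      >= cloc * dist_im d - pos_part (sP d) - Delta'.
Proof.
move=> cloc Delta'; have [/andP[eps0 eps1] delta0 lift] := lifting.
have [ccl0 gap] := clean_gap; have [eta0 Del0 bud] := budget.
have e1 : 0 < 1 - epsG by rewrite subr_gt0.
split; first by rewrite /cloc subr_gt0.
move=> d Ud; set t := chart_map ch d.
have [rem0 gauge0 hk] := hK d Ud.
have hv k : k \in Sc -> flow_wf (pk_flow K d k) by move=> /hk[].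
have Bp0 := B_prs_ge0 (pk_prs K d) hPS.
have Bl0 := B_loc_ge0 hLS hv; have Bc0 := B_cut_ge0 (pk_flow K d) hLS.
have tr_le := Err_tr_le (pk_z K d) hTS.
have tr0 : 0 <= B_tr Sc (pk_z K d).
  apply: le_trans tr_le; rewrite /Err_tr big_seq; apply: sumr_ge0 => k kS.
  by have [_ _ _ w0] := hTS k kS; rewrite mulr_ge0.
have El := Err_loc_le hLS hv; have Ec := Err_cut_le hLS hv.
have dE := detect_E d Ud; have dO := detect_O d Ud.
have dR := detect_Rep d Ud; have dP := detect_P d Ud; have Bd := bud d Ud.
rewrite Err_prsE in dO; rewrite /Err_nl in dE; rewrite /B_conc in Bd.
move: Bp0 Bl0 Bc0 El Ec dE dO Bd.
move: (B_prs _ _ _) (B_loc _ _ _) (B_cut _ _ _) (Err_loc _ _ _) (Err_cut _ _ _).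
move=> Bp Bl Bc el ec Bp0 Bl0 Bc0 El Ec dE dO Bd.
have rep0 : 0 <= Err_rep Sc (pk_comp K d) by exact: sqrtr_ge0.
have prof0 : 0 <= Err_prof (chart_map ch) d by exact: normr_ge0.
(* The budget is at most a real number and all its terms are nonnegative, so each of them is finite
   and can be replaced by a real. *)
have := le_lt_trans Bd (ltry _); rewrite -!addeA => sum_fin.
have tail0 : (0 <= (pk_rem K d)%:E + ((Err_rep Sc (pk_comp K d))%:E
    + ((pk_gauge K d)%:E + (Err_prof (chart_map ch) d)%:E)))%E.
  by rewrite !adde_ge0 ?lee_fin.
have [|Bpfin] := adde_lty Bp0 _ sum_fin.
  by rewrite !adde_ge0 ?lee_fin.
move=> {}sum_fin; have [|Blfin] := adde_lty Bl0 _ sum_fin.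
  by rewrite !adde_ge0 ?lee_fin.
move=> {}sum_fin; have [||_] := adde_lty _ _ sum_fin.
- by rewrite lee_fin.
- by rewrite adde_ge0.
move=> {}sum_fin; have [//|Bcfin _] := adde_lty Bc0 _ sum_fin.
have [bp Bpr] := ge0_lty_EFin Bp0 Bpfin; have [bl Blr] := ge0_lty_EFin Bl0 Blfin.
have [bc Bcr] := ge0_lty_EFin Bc0 Bcfin; subst Bp Bl Bc.
move: Bd; rewrite -!EFinD lee_fin => Bd.
(* Replacing errors by their budgets subtracts more, so the detection inequality is only
   weakened. *)
have {}dO : `|sO t| - (bp + bl + B_tr Sc (pk_z K d) + pk_gauge K d) <= `|sO d|.
  rewrite -lee_fin EFinB; apply: le_trans dO; apply: leeB => //.
  by rewrite !EFinD; do 3 (apply: leeD => //).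
have {}dE : CE * `|sE t| - (bc + pk_rem K d) <= CE * `|sE d|.
  by rewrite -lee_fin EFinB; apply: le_trans dE; apply: leeB => //; rewrite EFinD leeD.
have Fgap : ccl * dist_im t <= Fnorm CE CR t by apply: gap; exists d.
(* For each b, the a given by lifting bounds the local distance in terms of the clean norm at b; the
   infimum over b is then taken. *)
have dist : (1 - epsG) * dist_im d - deltaG <= dist_im t.
  apply: dist_im_ge => b; have [a da] := lift d Ud b.
  have := le_trans (dist_im_le d a) da; rewrite -/t mulrC -mulrDl.
  by rewrite ler_pdivlMr // mulrC lerBlDr.
have {}dist : ccl * ((1 - epsG) * dist_im d - deltaG) <= ccl * dist_im t.
  by rewrite ler_pM2l.
(* When the four detection inequalities are added, the subtracted terms sum to the concrete
   budget. *)
have main : cloc * dist_im d - Delta' <=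
    `|sO d| + CE * `|sE d| + CR * sRep d + pos_part (sP d).
  move: Fgap dist Bd dO dE dR dP; rewrite /Fnorm /cloc /Delta' -/t.
  move: (dist_im d) (dist_im t) (`|sO t|) (`|sO d|) (CE * `|sE t|) (CE * `|sE d|).
  move: (CR * sRep t) (CR * sRep d) (pos_part (sP t)) (pos_part (sP d)).
  move: (Err_rep _ _) (Err_prof _ _) (B_tr _ _) (pk_gauge _ _) (pk_rem _ _).
  clear=> *; lra.
by split=> //; rewrite [leLHS]addrAC lerBlDr.
Qed.
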